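(* Let $L$ be a field and let $R_L$ be the ring of bounded-degree formal power series over $L$ in the infinitely many variables $x_1,x_2,\ldots$. Then every finitely generated homogeneous ideal of $R_L$ has a finite Gröbner basis with respect to the graded reverse lexicographic order.
   Context: For a commutative ring $A$, $R_A$ is the $A$-algebra of formal power series over $A$ of bounded degree in the variables $x_1,x_2,\ldots$: its elements are the formal, possibly infinite, sums $\sum_{|\alpha|\le d} c_\alpha x^\alpha$, where $d$ is some nonnegative integer (depending on the element), $\alpha=(\alpha_1,\alpha_2,\ldots)$ runs over the sequences of nonnegative integers whose sum $|\alpha|$ is finite and at most $d$, $x^\alpha=\prod_i x_i^{\alpha_i}$, and $c_\alpha\in A$. Addition and multiplication are as usual. A series is homogeneous of degree $d$ if all its terms with nonzero coefficient have degree $|\alpha|=d$; an ideal is homogeneous if it is generated by homogeneous elements. Monomials are ordered by the graded reverse lexicographic order (grevlex): $x^\alpha>x^\beta$ if either $|\alpha|>|\beta|$, or $|\alpha|=|\beta|$ and the last nonzero entry of $\alpha-\beta$ is negative. For nonzero $f$, $\operatorname{lm}(f)$ denotes the grevlex-largest monomial with nonzero coefficient in $f$ (this exists). A Gröbner basis of an ideal $I\subseteq R_L$ is a subset $B\subseteq I$ such that for each nonzero $h\in I$ there exists a nonzero $f\in B$ with $\operatorname{lm}(f)\mid\operatorname{lm}(h)$. *)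

(* Defs.v *)
From HB Require Import structures.
From mathcomp Require Import all_boot all_order all_algebra finmap.
From mathcomp Require Import boolp classical_sets cardinality fsbigop.
From mathcomp Require Import multinomials.monalg.

Set Implicit Arguments.
Unset Strict Implicit.
Unset Printing Implicit Defensive.

Import GRing.Theory.
Local Open Scope classical_set_scope.
Local Open Scope ring_scope.

(* Finitely supported exponent sequences; index [i] stands for the variable
   x_(i+1). In monalg, [mmul] is the product of monomials (the sum of the
   exponents), [mone] the unit monomial and [mdeg] the total degree. *)
Notation mon := {cmonom nat}.

Definition mdvd (a b : mon) : Prop := exists c : mon, b = mmul a c.

(* [grevlex a b] : x^a > x^b. *)
Definition grevlex (a b : mon) : Prop :=
  (mdeg b < mdeg a)%N \/
  mdeg a = mdeg b /\
  exists i : nat, (a i < b i)%N /\ forall j : nat, (i < j)%N -> a j = b j.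

Definition factorizations (m : mon) : set (mon * mon) :=
  [set p | mmul p.1 p.2 = m].

Section Monomials.
Implicit Types (a b d m : mon).

Lemma finite_mon (X : {fset nat}) (k : nat) :
  finite_set [set m : mon | (forall i, i \notin X -> m i = 0%N) /\
                            (forall i, m i <= k)%N].
Proof.
pose F (f : {ffun X -> 'I_k.+1}) : mon := [cmonom (f i : nat) | i : X]%M.
apply: (@sub_finite_set _ _ (F @` [set: {ffun X -> 'I_k.+1}])); last first.
  by apply: finite_image; exact: finite_finset.
move=> m [mX mk]; exists [ffun i : X => inord (m (val i))] => //.
apply/eqP/cmP => i; rewrite /F cmE fsfun_ffun.
case: insubP => [u iX <-|/mX ->//].
by rewrite /= ffunE inordK // ltnS.
Qed.

Lemma leq_mdeg m i : (m i <= mdeg m)%N.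
Proof.
rewrite mdegE; case: (mdomP m i) => // im.
by rewrite (big_fsetD1 i) //= leq_addr.
Qed.

Lemma finite_mdvd m : finite_set [set d : mon | mdvd d m].
Proof.
apply: sub_finite_set (finite_mon (finsupp m) (mdeg m)) => d [c mE].
have dm i : (d i <= m i)%N by rewrite mE cmM leq_addr.
split=> [i|i]; last exact: leq_trans (dm i) (leq_mdeg _ _).
by rewrite -cmE_eq0 => /eqP mi0; apply/eqP; have := dm i; rewrite mi0 leqn0.
Qed.

Definition mdivisors m : {fset mon} := fset_set [set d : mon | mdvd d m].

Lemma mem_mdivisors m d : d \in mdivisors m <-> mdvd d m.
Proof.
rewrite /mdivisors in_fset_set ?inE //; exact: finite_mdvd.
Qed.

Lemma mdvd_mull a b m : mdvd (mmul a b) m -> mdvd a m.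
Proof. by case=> c ->; exists (mmul b c); rewrite mulmA. Qed.

Lemma mdvd_mulr a b m : mdvd (mmul a b) m -> mdvd b m.
Proof. by rewrite mulmC; exact: mdvd_mull. Qed.

Lemma mdvd_refl m : mdvd m m.
Proof. by exists mone; rewrite mulm1. Qed.

Lemma finite_factorizations m : finite_set (factorizations m).
Proof.
apply: sub_finite_set (finite_setX (finite_mdvd m) (finite_mdvd m)) => -[a b] /=.
rewrite /factorizations /= => <-; split; first by exists b.
by exists a; rewrite mulmC.
Qed.

Lemma fsbig_factorizations (A : nmodType) (D : {fset mon}) d
    (F : mon * mon -> A) :
  (forall a, mdvd a d -> a \in D) ->
  \sum_(p \in factorizations d) F p =
  \sum_(a <- D) \sum_(b <- D) (if mmul a b == d then F (a, b) else 0).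
Proof.
move=> dD.
transitivity (\sum_(p <- [seq (a, b) | a <- D, b <- D])
                (if mmul p.1 p.2 == d then F p else 0)); last first.
  by rewrite big_allpairs_dep.
rewrite -big_mkcond -[RHS]big_filter.
rewrite (fsbigE [seq p <- [seq (a, b) | a <- D, b <- D] | mmul p.1 p.2 == d]).
- rewrite [LHS]big_seq_cond [RHS]big_seq; apply: eq_bigl => p.
  rewrite mem_filter; case: eqP => //= e; apply: andb_idr => _; exact/mem_set.
- by rewrite filter_uniq // allpairs_uniq ?fset_uniq // => -[? ?] [? ?].
- by move=> p /=; rewrite mem_filter => /andP[/eqP].
- move=> [a b] /= e; rewrite mem_filter e eqxx /= => /negP[].
  apply/allpairsP; exists (a, b); split => //=; apply: dD; rewrite -e.
    by exists b.
  by exists a; rewrite mulmC.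
Qed.

Lemma grevlex_irr a : ~ grevlex a a.
Proof. by case=> [|[_ [i []]]]; rewrite ltnn. Qed.

Lemma grevlex_trans a b d : grevlex a b -> grevlex b d -> grevlex a d.
Proof.
case=> [ab|[ab [i [abi abj]]]] [bd|[bd [k [bdk bdj]]]].
- by left; exact: ltn_trans bd ab.
- by left; rewrite -bd.
- by left; rewrite ab.
- right; split; first by rewrite ab.
  case: (ltngtP i k) => [ik|ki|e].
  + exists k; split; first by rewrite abj.
    by move=> j kj; rewrite abj ?(ltn_trans ik) // bdj.
  + exists i; split; first by rewrite -bdj.
    by move=> j ij; rewrite abj // bdj // (ltn_trans ki).
  + exists i; split; first by rewrite e in abi *; exact: ltn_trans abi bdk.
    by move=> j ij; rewrite abj // bdj // -e.
Qed.

Lemma mon_bound a : exists n, forall j, (n <= j)%N -> a j = 0%N.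
Proof.
exists (\max_(i <- finsupp a) i.+1)%N => j; case: (mdomP a j) => // ja.
by rewrite (big_fsetD1 j) //= leqNgt => /negP[]; rewrite leq_max leqnn.
Qed.

Lemma grevlex_total a b : a <> b -> grevlex a b \/ grevlex b a.
Proof.
move=> ab; case: (ltngtP (mdeg a) (mdeg b)) => [?|?|dab].
- by right; left.
- by left; left.
have [na ha] := mon_bound a; have [nb hb] := mon_bound b.
have exi : exists i, a i != b i.
  apply: contrapT => h; apply: ab; apply/eqP/cmP => i; apply/eqP.
  by apply: contrapT => /negP hi; apply: h; exists i.
have ubi i : a i != b i -> (i <= na + nb)%N.
  apply: contraR; rewrite -ltnNge => /ltnW h.
  by rewrite ha ?hb // (leq_trans _ h) // ?leq_addr ?leq_addl.
have [i hi maxi] := ex_maxnP exi ubi.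
have eqj j : (i < j)%N -> a j = b j.
  by move=> ij; apply/eqP; apply: contraLR ij; rewrite -leqNgt => /maxi.
case: (ltngtP (a i) (b i)) hi => // h _; [left|right]; right; split => //.
  by exists i.
by exists i; split => // j /eqj.
Qed.

Lemma grevlex_max (s : seq mon) : s != [::] ->
  exists2 m, m \in s & forall n, n \in s -> n = m \/ grevlex m n.
Proof.
elim: s => // a s IH _; have [->|/IH[m ms mmax]] := eqVneq s [::].
  by exists a; rewrite ?inE // => n; rewrite inE => /eqP; left.
have [am|/grevlex_total[am|ma]] := pselect (a = m).
- exists m; rewrite ?inE ?ms ?orbT // => n; rewrite inE => /orP[/eqP ->|/mmax //].
  by left.
- exists a; rewrite ?inE ?eqxx // => n; rewrite inE => /orP[/eqP ->|/mmax[->|mn]].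
  + by left.
  + by right.
  + by right; exact: grevlex_trans am mn.
- exists m; rewrite ?inE ?ms ?orbT // => n; rewrite inE => /orP[/eqP ->|/mmax //].
  by right.
Qed.

Lemma finite_grevlex a :
  finite_set [set m : mon | mdeg m = mdeg a /\ grevlex m a].
Proof.
have [n an] := mon_bound a.
apply: sub_finite_set (finite_mon [fset j in iota 0 n]%fset (mdeg a)) => m [dm].
case=> [|[_ [i [mi mj]]]]; first by rewrite dm ltnn.
split=> j; last by rewrite -dm leq_mdeg.
rewrite !inE mem_iota add0n -leqNgt => nj; rewrite mj ?an //.
apply: leq_trans nj; rewrite ltnNge; apply/negP => /an ai.
by have := mi; rewrite ai.
Qed.

End Monomials.

Section Series.
Variable A : comNzRingType.

Record bdseries : Type := BDSeries {
  sercoef :> mon -> A;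
  sercoef_bounded : exists d : nat, forall m : mon,
    (d < mdeg m)%N -> sercoef m = 0 }.

HB.instance Definition _ := gen_eqMixin bdseries.
HB.instance Definition _ := gen_choiceMixin bdseries.

Implicit Types (f g h : bdseries).

Lemma bdseriesP f g : (forall m, f m = g m) -> f = g.
Proof.
case: f g => [f Hf] [g Hg] /= fg; have {fg} e : f = g by apply/funext.
by case: _ / e Hg => Hg; congr BDSeries; exact: Prop_irrelevance.
Qed.

Fact ser0_subproof :
  exists d : nat, forall m : mon, (d < mdeg m)%N -> (0 : A) = 0.
Proof. by exists 0%N. Qed.
Definition ser0 : bdseries := BDSeries ser0_subproof.

Fact ser1_subproof : exists d : nat, forall m : mon,
  (d < mdeg m)%N -> (if m == mone then 1 else 0 : A) = 0.
Proof. by exists 0%N => m; rewrite lt0n mdeg_eq0 => /negbTE ->. Qed.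
Definition ser1 : bdseries := BDSeries ser1_subproof.

Fact seropp_subproof f : exists d : nat, forall m : mon,
  (d < mdeg m)%N -> - f m = 0.
Proof.
by case: (sercoef_bounded f) => d fd; exists d => m /fd ->; rewrite oppr0.
Qed.
Definition seropp f : bdseries := BDSeries (seropp_subproof f).

Fact seradd_subproof f g : exists d : nat, forall m : mon,
  (d < mdeg m)%N -> f m + g m = 0.
Proof.
case: (sercoef_bounded f) (sercoef_bounded g) => d fd [e ge].
exists (maxn d e) => m; rewrite gtn_max => /andP[/fd -> /ge ->].
by rewrite addr0.
Qed.
Definition seradd f g : bdseries := BDSeries (seradd_subproof f g).

Fact serscale_subproof (c : A) f : exists d : nat, forall m : mon,
  (d < mdeg m)%N -> c * f m = 0.
Proof.
by case: (sercoef_bounded f) => d fd; exists d => m /fd ->; rewrite mulr0.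
Qed.
Definition serscale (c : A) f : bdseries := BDSeries (serscale_subproof c f).

(* By [finite_factorizations] the sum below is genuinely finite. *)
Fact sermul_subproof f g : exists d : nat, forall m : mon,
  (d < mdeg m)%N -> \sum_(p \in factorizations m) f p.1 * g p.2 = 0.
Proof.
case: (sercoef_bounded f) (sercoef_bounded g) => d fd [e ge].
exists (d + e)%N => m dem; apply: fsbig1 => -[a b] /= abm.
have [da|ad] := ltnP d (mdeg a); first by rewrite fd // mul0r.
rewrite [g b]ge ?mulr0 // ltnNge; apply/negP => be.
by move: dem; rewrite -abm /= mdegM ltnNge leq_add.
Qed.
Definition sermul f g : bdseries := BDSeries (sermul_subproof f g).

Fact seraddA : associative seradd.
Proof. by move=> f g h; apply: bdseriesP => m /=; rewrite addrA. Qed.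
Fact seraddC : commutative seradd.
Proof. by move=> f g; apply: bdseriesP => m /=; rewrite addrC. Qed.
Fact seradd0 : left_id ser0 seradd.
Proof. by move=> f; apply: bdseriesP => m /=; rewrite add0r. Qed.
Fact seraddN : left_inverse ser0 seropp seradd.
Proof. by move=> f; apply: bdseriesP => m /=; rewrite addNr. Qed.

HB.instance Definition _ :=
  GRing.isZmodule.Build bdseries seraddA seraddC seradd0 seraddN.

Lemma sermulE (D : {fset mon}) f g m : (forall a, mdvd a m -> a \in D) ->
  sermul f g m =
  \sum_(a <- D) \sum_(b <- D) (if mmul a b == m then f a * g b else 0).
Proof.
by move=> Dm; rewrite /= (fsbig_factorizations (fun p => f p.1 * g p.2) Dm).
Qed.

Fact sermulC : commutative sermul.
Proof.
move=> f g; apply: bdseriesP => m.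
have Dm a : mdvd a m -> a \in mdivisors m by move/mem_mdivisors.
rewrite !(sermulE _ _ Dm) exchange_big; apply: eq_bigr => a _.
by apply: eq_bigr => b _; rewrite mulmC mulrC.
Qed.

Lemma sermulE3 f g h m : sermul (sermul f g) h m =
  \sum_(a <- mdivisors m) \sum_(b <- mdivisors m) \sum_(c <- mdivisors m)
    (if mmul (mmul a b) c == m then f a * g b * h c else 0).
Proof.
set D := mdivisors m.
have Dm a : mdvd a m -> a \in D by move/mem_mdivisors.
have Dd d : d \in D -> forall a, mdvd a d -> a \in D.
  move=> /mem_mdivisors dm a [b db]; apply: Dm.
  by apply: (@mdvd_mull a b); rewrite -db.
rewrite (sermulE _ _ Dm).
transitivity (\sum_(d <- D) \sum_(c <- D) \sum_(a <- D) \sum_(b <- D)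
  (if (mmul a b == d) && (mmul d c == m) then f a * g b * h c else 0)).
  apply: eq_big_seq => d dD; apply: eq_bigr => c _.
  rewrite (sermulE _ _ (Dd d dD)).
  case: ifP => _; last first.
    by rewrite big1 // => a _; rewrite big1 // => b _; rewrite andbF.
  rewrite mulr_suml; apply: eq_bigr => a _; rewrite mulr_suml.
  by apply: eq_bigr => b _; rewrite andbT; case: ifP; rewrite ?mul0r.
rewrite exchange_big /=.
under eq_bigr => c _.
  rewrite exchange_big /=.
  under eq_bigr => a _ do rewrite exchange_big /=.
  over.
rewrite exchange_big /=; apply: eq_bigr => a _.
rewrite exchange_big /=; apply: eq_bigr => b _.
apply: eq_bigr => c _.
case: ifP => [/eqP abc|abc]; last first.
  by rewrite big1 // => d _; case: eqP => // <-; rewrite abc.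
have abD : mmul a b \in D by apply: Dm; exists c.
rewrite (big_fsetD1 (mmul a b)) //= eqxx abc eqxx /= big1_seq ?addr0 // => d.
by rewrite in_fsetD1 => /andP[_ /andP[/negbTE dn _]]; rewrite eq_sym dn.
Qed.

Fact sermulA : associative sermul.
Proof.
move=> f g h; rewrite [LHS]sermulC; apply: bdseriesP => m.
rewrite !sermulE3 [RHS]exchange_big /=.
transitivity (\sum_(b <- mdivisors m) \sum_(c <- mdivisors m)
  \sum_(a <- mdivisors m)
    (if mmul (mmul a b) c == m then f a * g b * h c else 0)); last first.
  by apply: eq_bigr => b _; rewrite exchange_big.
apply: eq_bigr => b _; apply: eq_bigr => c _; apply: eq_bigr => a _.
by rewrite mulmC mulmA mulrC mulrA.
Qed.

Fact sermul1 : left_id ser1 sermul.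
Proof.
move=> f; apply: bdseriesP => m.
have Dm a : mdvd a m -> a \in mdivisors m by move/mem_mdivisors.
rewrite (sermulE _ _ Dm) (big_fsetD1 mone) /=; last first.
  by apply: Dm; exists m; rewrite mul1m.
rewrite [X in _ + X]big1_seq ?addr0; last first.
  move=> a; rewrite in_fsetD1 => /andP[_ /andP[/negbTE -> _]].
  by rewrite big1 // => b _; rewrite mul0r if_same.
rewrite (big_fsetD1 m) /=; last exact: Dm (mdvd_refl m).
rewrite mul1m !eqxx mul1r big1_seq ?addr0 // => b.
by rewrite in_fsetD1 mul1m => /andP[_ /andP[/negbTE -> _]].
Qed.

Fact sermulDl : left_distributive sermul seradd.
Proof.
move=> f g h; apply: bdseriesP => m.
have Dm a : mdvd a m -> a \in mdivisors m by move/mem_mdivisors.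
rewrite -[RHS]/(sermul f h m + sermul g h m) !(sermulE _ _ Dm) -big_split.
apply: eq_bigr => a _; rewrite -big_split; apply: eq_bigr => b _ /=.
by case: ifP; rewrite ?addr0 // mulrDl.
Qed.

Fact ser1_neq0 : ser1 != ser0.
Proof.
apply/eqP => /(congr1 (fun f : bdseries => f mone)) /=.
by rewrite eqxx => /eqP; rewrite oner_eq0.
Qed.

HB.instance Definition _ := GRing.Zmodule_isComNzRing.Build bdseries
  sermulA sermulC sermul1 sermulDl ser1_neq0.

Fact serscaleA c d f : serscale c (serscale d f) = serscale (c * d) f.
Proof. by apply: bdseriesP => m /=; rewrite mulrA. Qed.
Fact serscale1 : left_id 1 serscale.
Proof. by move=> f; apply: bdseriesP => m /=; rewrite mul1r. Qed.
Fact serscaleDr : right_distributive serscale +%R.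
Proof. by move=> c f g; apply: bdseriesP => m /=; rewrite mulrDr. Qed.
Fact serscaleDl f : {morph serscale^~ f : c d / c + d}.
Proof. by move=> c d; apply: bdseriesP => m /=; rewrite mulrDl. Qed.

HB.instance Definition _ := GRing.Zmodule_isLmodule.Build A bdseries
  serscaleA serscale1 serscaleDr serscaleDl.

Fact serscaleAl (c : A) f g : c *: (f * g) = (c *: f) * g.
Proof.
apply: bdseriesP => m; rewrite /= fsbig_finite; last exact: finite_factorizations.
rewrite fsbig_finite; last exact: finite_factorizations.
by rewrite mulr_sumr; apply: eq_bigr => p _; rewrite mulrA.
Qed.

HB.instance Definition _ := GRing.Lmodule_isLalgebra.Build A bdseries serscaleAl.
HB.instance Definition _ := GRing.Lalgebra_isComAlgebra.Build A bdseries.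

Lemma sercoefM f g m :
  (f * g) m = \sum_(p \in factorizations m) f p.1 * g p.2.
Proof. by []. Qed.

End Series.

Section LeadingMonomial.
Variable A : comNzRingType.
Implicit Types f : bdseries A.

Definition is_lm f (m : mon) : Prop :=
  f m != 0 /\ forall n : mon, f n != 0 -> n = m \/ grevlex m n.

(* The value at [f = 0] is a dummy; [lmP] justifies the definition. *)
Definition lm f : mon := xget mone [set m | is_lm f m].

Lemma lmP f : f != 0 -> is_lm f (lm f).
Proof.
move=> f0; apply: xgetPex.
have exd : exists d, `[< exists2 m, f m != 0 & mdeg m = d >].
  apply: contrapT => h; move/eqP: f0; apply; apply: bdseriesP => m /=.
  apply/eqP; apply: contrapT => /negP fm; apply: h.
  by exists (mdeg m); apply/asboolP; exists m.
have [D fD] := sercoef_bounded f.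
have ubd d : `[< exists2 m, f m != 0 & mdeg m = d >] -> (d <= D)%N.
  move=> /asboolP[m fm <-]; rewrite leqNgt; apply/negP => /fD fm0.
  by rewrite fm0 eqxx in fm.
have [d /asboolP[a fa ad] dmax] := ex_maxnP exd ubd.
have degle n : f n != 0 -> (mdeg n <= mdeg a)%N.
  by move=> fn; rewrite ad; apply: dmax; apply/asboolP; exists n.
pose T := [seq m <- a :: fset_set [set m : mon | mdeg m = mdeg a /\ grevlex m a]
             | f m != 0].
have memT n : n \in T <-> f n != 0 /\ (n = a \/ mdeg n = mdeg a /\ grevlex n a).
  rewrite mem_filter inE in_fset_set; last exact: finite_grevlex.
  split=> [/andP[-> /orP[/eqP|]]|[-> [->|h]]].
  - by split=> //; left.
  - by rewrite inE => h; split=> //; right.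
  - by rewrite eqxx.
  - by apply/orP; right; exact/mem_set.
have aT : a \in T by apply/memT; split=> //; left.
have T0 : T != [::] by apply/eqP => T0; rewrite T0 in aT.
have [m mT mmax] := grevlex_max T0.
have /memT[fm ma] := mT.
exists m; split=> // n fn.
have [->|/grevlex_total[na|an]] := pselect (n = a); first exact: mmax.
  apply: mmax; apply/memT; split=> //; right; split=> //.
  by case: na => [|[]//]; rewrite ltnNge degle.
by right; case: ma => [->//|[_ ma]]; exact: grevlex_trans ma an.
Qed.

Lemma is_lm_unique f m n : is_lm f m -> is_lm f n -> m = n.
Proof.
move=> [fm mm] [fn nn]; case: (mm n fn) => [->//|mn].
case: (nn m fm) => // nm; by case: (grevlex_irr (grevlex_trans mn nm)).
Qed.

End LeadingMonomial.

Section Ideals.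
Variable R : comNzRingType.
Implicit Types (I S : set R).

(* The library's [idealr_closed] also requires 1 \notin I, which is not wanted. *)
Definition is_ideal I : Prop :=
  I 0 /\ forall a u v : R, I u -> I v -> I (a * u + v).

Definition ideal_gen S : set R := smallest is_ideal S.

Lemma ideal_gen_is_ideal S : is_ideal (ideal_gen S).
Proof.
split=> [I [[I0 _] _]//|a u v Su Sv I [idI SI]].
by case: (idI) => _; apply; [exact: Su | exact: Sv].
Qed.

Lemma sub_ideal_gen S : S `<=` ideal_gen S.
Proof. exact: sub_smallest. Qed.

Definition fin_gen_ideal I : Prop :=
  exists S : set R, finite_set S /\ I = ideal_gen S.

End Ideals.

Section Groebner.
Variable A : comNzRingType.
Implicit Types (f : bdseries A) (I B : set (bdseries A)).

Definition homogeneous_of_degree (d : nat) f : Prop :=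
  forall m : mon, f m != 0 -> mdeg m = d.

Definition homogeneous f : Prop := exists d : nat, homogeneous_of_degree d f.

Definition homogeneous_ideal I : Prop :=
  exists S : set (bdseries A), S `<=` homogeneous /\ I = ideal_gen S.

Definition groebner_basis I B : Prop :=
  B `<=` I /\
  forall h : bdseries A, I h -> h != 0 ->
    exists f : bdseries A, [/\ B f, f != 0 & mdvd (lm f) (lm h)].

End Groebner.

(* Main.v *)
Require Import Defs.
From HB Require Import structures.
From mathcomp Require Import all_boot all_order all_algebra finmap.
From mathcomp Require Import boolp classical_sets cardinality fsbigop.
From mathcomp Require Import multinomials.monalg zify ring.
From mathcomp Require Import generic_quotient fraction.

(** Why every finitely generated homogeneous ideal I has a finite Groebner basis.

    Write x_0, x_1, ... for the variables, K for the field, and I_n for the image of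
    I in K[x_0, ..., x_n] when all later variables are set to zero.

    Grevlex and regularity.  Suppose that for every n >= N the variable x_n is a
    nonzero divisor modulo I_n.  Let h in I be homogeneous and let x_n, n >= N, be
    the last variable in its leading monomial.  All terms of h in x_0, ..., x_n are
    then divisible by x_n, so the truncation of h is x_n r, and r lies in I_n.  A
    series in I that truncates to r has the leading monomial lm h / x_n, because
    terms with later variables are smaller (homogeneous_divide, lm_reduce).
    Repeating this, every leading monomial is divisible by one in x_0, ..., x_(N-1),
    and Dickson's lemma applies (dickson).  It remains to find N; this is
    eventually_xvar_regular, for an arbitrary finite list of generators.

    Changing the field.  The property descends along field extensions
    (ideal_sum_descend), so K may be assumed infinite and perfect
    (perfect_infinite_extension).

    The ring is a polynomial ring.  This observation of Erman, Sam and Snowden is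
    needed in the following form: finitely many series are polynomials in finitely
    many members of a system of algebraically independent homogeneous generators,
    and these members form a regular sequence in the whole ring (seq_family,
    good_family_regular).  One chooses generators degree by degree.  Let B be a
    subalgebra generated so far, which contains all homogeneous elements of degree
    less than d, and let x be homogeneous of degree d and not in B.  The derivatives of x lie in B.  So the derivations lift to B[X]
    (lift_D) and turn a homogeneous relation for x into smaller relations.  A
    minimal relation is therefore killed by all of them, and this forces it to be
    constant in characteristic 0 and a p-th power in characteristic p
    (lift_D_const, lift_D_root, step_transc); the heart of the matter is that no
    b x + a, with a and b in B and b a nonzero constant for the derivations, is
    itself such a constant (step_const).

    Truncation.  A regular sequence g_1, ..., g_s stays regular in
    K[x_0, ..., x_(n-1)] for all large n (eventually_regular).  By induction on j, the
    quotient R / (g_1, ..., g_j) is a direct summand of a finite free module over a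
    ring P of series in all but j of the coordinates (retraction).
    Multiplication by g_(j+1) extends to an endomorphism of the free module whose
    determinant is nonzero, since g_(j+1) is regular (extmul_kernel), and regularity
    persists after truncation as soon as the truncated determinant is nonzero
    (extmul_regular).  After a linear change of coordinates the determinant is monic
    in one coordinate (monic_coordinates), and division by it produces a retraction
    for R / (g_1, ..., g_(j+1)) over the series in the remaining coordinates
    (poly_step).

    Flatness.  If a sequence of homogeneous elements of positive degree is regular
    in K[x_0, ..., x_(n-1)], this ring is flat over the subalgebra generated by the
    sequence (regular_flat).  A relation x_n r = h_1 f_1 + ... + h_k f_k modulo the
    variables after x_n, whose f_j are polynomials in the sequence, becomes a
    relation for the f_j when x_n is set to zero; by flatness it can be corrected so
    that x_n divides all the h_j, hence r is in the ideal (xvar_regular). *)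

Set Implicit Arguments.
Unset Strict Implicit.
Unset Printing Implicit Defensive.

Import GRing.Theory.
Local Open Scope ring_scope.

(** * Exponent vectors *)
Section ExponentVectors.
Implicit Types (a b c m : mon) (i j k n : nat).

Lemma monP a b : (forall i, a i = b i) -> a = b.
Proof. by move=> ab; apply/eqP/cmP. Qed.

(** Exponent vectors, and later the series given by their coefficients, are
    obtained from an opaque existence proof, so that the formula for their
    entries is the only access to them. *)
Fact mkmon_subproof : {M : nat -> (nat -> nat) -> mon |
  forall n F i, M n F i = if (i < n)%N then F i else 0%N}.
Proof.
exists (fun n F => mkcmonom [fsfun i in [fset j in iota 0 n]%fset => F i | 0%N]) => n F i.
by rewrite cmE fsfun_fun !inE mem_iota.
Qed.

Definition mkmon : nat -> (nat -> nat) -> mon := sval mkmon_subproof.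

Lemma mkmonE n F i : mkmon n F i = if (i < n)%N then F i else 0%N.
Proof. by rewrite /mkmon; case: mkmon_subproof. Qed.

Fact mpow_subproof : {M : nat -> nat -> mon |
  forall i k j, M i k j = if j == i then k else 0%N}.
Proof.
exists (fun i k => mkmon i.+1 (fun j => if j == i then k else 0%N)) => i k j.
by rewrite mkmonE ltnS; case: eqP => [->|]; rewrite ?leqnn // if_same.
Qed.

Definition mpow : nat -> nat -> mon := sval mpow_subproof.

Lemma mpowE i k j : mpow i k j = if j == i then k else 0%N.
Proof. by rewrite /mpow; case: mpow_subproof. Qed.

Fact mdivm_subproof : {M : mon -> mon -> mon |
  forall a b i, M a b i = (a i - b i)%N}.
Proof. by exists (fun a b => divcm a b) => a b i; apply: divcmE. Qed.

Definition mdivm : mon -> mon -> mon := sval mdivm_subproof.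

Lemma mdivmE a b i : mdivm a b i = (a i - b i)%N.
Proof. by rewrite /mdivm; case: mdivm_subproof. Qed.

Definition mdelete i m : mon := mdivm m (mpow i (m i)).

Lemma mdeleteE i m j : mdelete i m j = if j == i then 0%N else m j.
Proof. by rewrite mdivmE mpowE; case: eqP => [->|_]; rewrite ?subnn ?subn0. Qed.

Lemma mdeleteK i m : mmul (mpow i (m i)) (mdelete i m) = m.
Proof.
by apply: monP => j; rewrite cmM mpowE mdeleteE; case: eqP => [->|]; rewrite ?addn0.
Qed.

Lemma mmulI a b c : mmul a b = mmul a c -> b = c.
Proof.
move=> e; apply: monP => i; move: (congr1 (fun m : mon => m i) e).
by rewrite /= !cmM => /addnI.
Qed.

Lemma mdvdP a b : mdvd a b <-> forall i, (a i <= b i)%N.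
Proof.
split=> [[c ->] i|ab]; first by rewrite cmM leq_addr.
by exists (mdivm b a); apply: monP => i; rewrite cmM mdivmE subnKC.
Qed.

Lemma mdivmK a b : mdvd a b -> mmul a (mdivm b a) = b.
Proof. by move/mdvdP=> ab; apply: monP => i; rewrite cmM mdivmE subnKC. Qed.

Lemma mpowD i j k : mmul (mpow i j) (mpow i k) = mpow i (j + k).
Proof. by apply: monP => l; rewrite cmM !mpowE; case: eqP. Qed.

Lemma mpow0 i : mpow i 0 = mone.
Proof. by apply: monP => l; rewrite cm1 mpowE if_same. Qed.

Lemma mdeg_mpow i k : mdeg (mpow i k) = k.
Proof.
elim: k => [|k IH]; first by rewrite mpow0 mdeg1.
rewrite -addn1 -mpowD mdegM IH; congr addn.
rewrite -[RHS](mdegU i); congr mdeg; apply: monP => j.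
by rewrite mpowE cmU eq_sym; case: (i == j).
Qed.

Lemma mdeg_gt0 m i : (0 < m i)%N -> (0 < mdeg m)%N.
Proof. by move=> h; apply: leq_trans h (leq_mdeg _ _). Qed.

Lemma mdeg_neq0P m : m <> mone -> exists i, (0 < m i)%N.
Proof.
move=> m1; apply: contrapT => h; apply: m1; apply: monP => i.
by rewrite cm1; apply/eqP; rewrite -leqn0 leqNgt; apply/negP => hi; apply: h; exists i.
Qed.

Definition supp_lt n m : Prop := forall i, (n <= i)%N -> m i = 0%N.

Lemma supp_ltM n a b : supp_lt n (mmul a b) <-> supp_lt n a /\ supp_lt n b.
Proof.
split=> [h|[ha hb] i ni]; last by rewrite cmM ha ?hb.
by split=> i /h /eqP; rewrite cmM addn_eq0 => /andP[/eqP ? /eqP].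
Qed.

Lemma supp_lt_ex m : exists n, supp_lt n m.
Proof. exact: mon_bound. Qed.

Lemma supp_lt_le n k m : (n <= k)%N -> supp_lt n m -> supp_lt k m.
Proof. by move=> nk h i ki; apply: h; apply: leq_trans ki. Qed.

(** Shifting all variables by one frees x_0; this is what identifies the series
    without x_0 with all series. *)
Definition mshift m : mon :=
  mkmon (sval (cid (supp_lt_ex m))).+1 (fun i => if i is j.+1 then m j else 0%N).
Definition munshift m : mon :=
  mkmon (sval (cid (supp_lt_ex m))) (fun i => m i.+1).

Lemma mshiftE m i : mshift m i = if i is j.+1 then m j else 0%N.
Proof.
rewrite mkmonE; case: cid => n /= h; case: i => [//|i].
by rewrite ltnS; case: ltnP => // /h.
Qed.

Lemma munshiftE m i : munshift m i = m i.+1.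
Proof.
by rewrite mkmonE; case: cid => n /= h; case: ltnP => // /leqW /h.
Qed.

Lemma mshiftK m : munshift (mshift m) = m.
Proof. by apply: monP => i; rewrite munshiftE mshiftE. Qed.

Lemma munshiftK m : mshift (munshift m) = mdelete 0 m.
Proof. by apply: monP => -[|i]; rewrite mshiftE mdeleteE ?munshiftE. Qed.

Lemma mshiftM a b : mshift (mmul a b) = mmul (mshift a) (mshift b).
Proof. by apply: monP => -[|i]; rewrite cmM !mshiftE ?cmM. Qed.

Lemma mshift1 : mshift mone = mone.
Proof. by apply: monP => -[|i]; rewrite mshiftE !cm1. Qed.

Lemma munshiftM a b : munshift (mmul a b) = mmul (munshift a) (munshift b).
Proof. by apply: monP => i; rewrite cmM !munshiftE cmM. Qed.

End ExponentVectors.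

Lemma mdeg_mdelete (i : nat) (m : mon) : mdeg m = (m i + mdeg (mdelete i m))%N.
Proof. by rewrite -[in LHS](mdeleteK i m) mdegM mdeg_mpow. Qed.

Lemma mdeg_mshift (m : mon) : mdeg (mshift m) = mdeg m.
Proof.
(* both degrees are sums over a common range of variables *)
have degE n (a : mon) : supp_lt n a -> mdeg a = (\sum_(i < n) a i)%N.
  elim: n a => [|n IH] a ha.
    rewrite big_ord0; apply/eqP; rewrite mdeg_eq0; apply/eqP; apply: monP => i.
    by rewrite ha ?cm1.
  rewrite (mdeg_mdelete n) (IH (mdelete n a)) => [|i ni]; last first.
    by rewrite mdeleteE; case: eqP => // /eqP ni'; apply: ha; rewrite ltn_neqAle eq_sym ni'.
  rewrite big_ord_recr /= addnC; congr addn; apply: eq_bigr => i _.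
  by rewrite mdeleteE ltn_eqF.
have [n hn] := supp_lt_ex m.
rewrite (degE n.+1 (mshift m)) => [|[//|i] ni]; last by rewrite mshiftE hn.
rewrite (degE n m hn) big_ord_recl mshiftE add0n; apply: eq_bigr => i _.
by rewrite mshiftE.
Qed.

Lemma mdeg_munshift (m : mon) : mdeg (munshift m) = mdeg (mdelete 0 m).
Proof. by rewrite -munshiftK mdeg_mshift. Qed.

(** * Coefficients of series *)
Section Coefficients.
Variable A : comNzRingType.
Local Notation R := (bdseries A).
Implicit Types (f g h : R) (m : mon) (d i : nat).

Lemma serP f g : (forall m, f m = g m) -> f = g.
Proof. exact: bdseriesP. Qed.

Lemma ser0E m : (0 : R) m = 0. Proof. by []. Qed.
Lemma serDE f g m : (f + g) m = f m + g m. Proof. by []. Qed.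
Lemma serBE f g m : (f - g) m = f m - g m. Proof. by []. Qed.
Lemma serZE c f m : (c *: f) m = c * f m. Proof. by []. Qed.
Lemma ser1E m : (1 : R) m = (m == mone)%:R.
Proof.
transitivity (if m == mone then 1 else 0 : A); first by [].
by case: (m == mone).
Qed.
Lemma serCE (c : A) m : (c%:A : R) m = c *+ (m == mone).
Proof. by rewrite serZE ser1E; case: (m == mone); rewrite ?mulr1 ?mulr0. Qed.
Lemma serMnE f k m : (f *+ k) m = f m *+ k.
Proof. by elim: k => [|k IH]; rewrite ?mulr0n // !mulrS serDE IH. Qed.
Lemma ser_sumE I r (P : pred I) (F : I -> R) m :
  (\sum_(i <- r | P i) F i) m = \sum_(i <- r | P i) F i m.
Proof. by elim/big_rec2: _ => // i y1 y2 _ <-. Qed.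

Fact ser_of_subproof : {S : nat -> (mon -> A) -> R |
  forall d F m, S d F m = if (mdeg m <= d)%N then F m else 0}.
Proof.
have h d (F : mon -> A) : exists e : nat, forall m : mon, (e < mdeg m)%N ->
    (if (mdeg m <= d)%N then F m else 0) = 0.
  by exists d => m; rewrite ltnNge => /negbTE ->.
by exists (fun d F => BDSeries (h d F)).
Qed.

Definition ser_of : nat -> (mon -> A) -> R := sval ser_of_subproof.

Lemma ser_ofE d F m : ser_of d F m = if (mdeg m <= d)%N then F m else 0.
Proof. by rewrite /ser_of; case: ser_of_subproof. Qed.
End Coefficients.

(** * Coefficients of products *)
Section Products.
Variable A : comNzRingType.
Local Notation R := (bdseries A).
Implicit Types (f g h c : R) (m a b : mon) (d i j k n : nat).

Lemma sermul_eq0 f g m :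
  (forall a b, mmul a b = m -> f a * g b = 0) -> (f * g) m = 0.
Proof. by move=> h; rewrite sercoefM; apply: fsbig1 => -[a b] /=; apply: h. Qed.

Lemma sermul_single f g a b :
  (forall a' b', mmul a' b' = mmul a b -> a' <> a -> f a' * g b' = 0) ->
  (f * g) (mmul a b) = f a * g b.
Proof.
move=> h; rewrite sercoefM.
rewrite (fsbigD1 (a, b)) //; last exact: finite_factorizations.
rewrite fsbig1; first exact: addr0.
move=> [a' b'] /= [e ne]; apply: h => // ea.
by apply: ne; move: e; rewrite ea => e; rewrite (mmulI e : b' = b).
Qed.

(** A coefficient of a product only depends on the factorizations of its monomial:
    a bijection between factorizations that respects the coefficients transports
    it.  This gives multiplicativity of truncation and of the shift at once. *)
Lemma sermul_eq f f' g g' m m' (u v : mon -> mon) :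
  (forall a b, mmul a b = m' -> mmul (u a) (v b) = m) ->
  (forall a b, mmul a b = m ->
     exists a' b', [/\ mmul a' b' = m', u a' = a & v b' = b]) ->
  injective u -> injective v ->
  (forall a b, mmul a b = m' -> f (u a) * g (v b) = f' a * g' b) ->
  (f * g) m = (f' * g') m'.
Proof.
move=> uvm uvs ui vi e; rewrite !sercoefM.
rewrite (reindex_fsbig (fun p : mon * mon => (u p.1, v p.2)) (factorizations m')).
  by apply: eq_fsbigr => -[a b] /set_mem /= /e.
split.
- by move=> [a b] eab; apply: uvm.
- by move=> [a b] [a' b'] _ _ [/ui ea /vi eb]; rewrite ea eb.
- move=> [a b] /uvs [a' [b' [e' ea eb]]]; exists (a', b') => //.
  by rewrite /= ea eb.
Qed.

Fact xmon_subproof : {X : mon -> R | forall a m, X a m = (m == a)%:R}.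
Proof.
exists (fun a => ser_of (mdeg a) (fun m => (m == a)%:R)) => a m.
by rewrite ser_ofE; case: eqP => [->|]; rewrite ?leqnn // if_same.
Qed.

Definition xmon : mon -> R := sval xmon_subproof.

Lemma xmonE a m : xmon a m = (m == a)%:R.
Proof. by rewrite /xmon; case: xmon_subproof. Qed.

Lemma xmonM_coef a b f : (xmon a * f) (mmul a b) = f b.
Proof.
rewrite sermul_single ?xmonE ?eqxx ?mul1r // => a' b' _ /eqP /negbTE ne.
by rewrite xmonE ne mul0r.
Qed.

Lemma xmonM_coef0 a m f : ~ mdvd a m -> (xmon a * f) m = 0.
Proof.
move=> h; apply: sermul_eq0 => a' b e; rewrite xmonE; case: eqP => [ea|_].
  by case: h; exists b; rewrite -ea.
by rewrite mul0r.
Qed.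

Lemma xmonM a b : xmon a * xmon b = xmon (mmul a b).
Proof.
apply: serP => m; case: (pselect (mdvd a m)) => [[c ->]|h].
  rewrite xmonM_coef !xmonE; congr (nat_of_bool _)%:R.
  by apply/eqP/eqP => [->|/mmulI].
rewrite xmonM_coef0 // xmonE; case: eqP => // e; case: h; by exists b.
Qed.

Lemma xmon1 : xmon mone = 1.
Proof. by apply: serP => m; rewrite xmonE ser1E. Qed.

Definition xvar i : R := xmon (mpow i 1).

Lemma xvarX i k : xvar i ^+ k = xmon (mpow i k).
Proof.
elim: k => [|k IH]; first by rewrite expr0 mpow0 xmon1.
by rewrite exprS IH /xvar xmonM mpowD.
Qed.

(** * Homogeneous components *)
Local Notation hom := (@homogeneous_of_degree A).

Definition hcomp d f : R := ser_of d (fun m => if mdeg m == d then f m else 0).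

Lemma hcompE d f m : hcomp d f m = if mdeg m == d then f m else 0.
Proof. by rewrite ser_ofE; case: eqP => [->|]; rewrite ?leqnn // if_same. Qed.

Lemma hom_hcomp d f : hom d (hcomp d f).
Proof. by move=> m; rewrite hcompE; case: (eqVneq (mdeg m) d) => // _; case/eqP. Qed.

Lemma homP d f : hom d f <-> forall m, mdeg m <> d -> f m = 0.
Proof.
split=> [h m md|h m fm]; last first.
  by apply: contrapT => md; rewrite h ?eqxx // in fm.
by apply/eqP; apply: contrapT => /negP /h.
Qed.

Lemma hcomp_id d f : hom d f -> hcomp d f = f.
Proof.
by move=> /homP h; apply: serP => m; rewrite hcompE; case: eqP => // /h.
Qed.

Lemma hcomp_other d e f : hom d f -> e <> d -> hcomp e f = 0.
Proof.
move=> /homP h ed; apply: serP => m; rewrite hcompE; case: eqP => // me.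
by rewrite h // me.
Qed.

Lemma hcomp_is_additive d : zmod_morphism (hcomp d).
Proof.
by move=> f g; apply: serP => m; rewrite serBE !hcompE serBE; case: ifP; rewrite ?subr0.
Qed.
HB.instance Definition _ d := GRing.isZmodMorphism.Build R R (hcomp d) (hcomp_is_additive d).

Lemma hcompZ d (c : A) f : hcomp d (c *: f) = c *: hcomp d f.
Proof. by apply: serP => m; rewrite !(hcompE, serZE); case: ifP; rewrite ?mulr0. Qed.

Definition dle d f : Prop := forall m, (d < mdeg m)%N -> f m = 0.

Lemma dle_ex f : exists d, dle d f.
Proof. exact: sercoef_bounded. Qed.

Lemma hom_dle d f : hom d f -> dle d f.
Proof.
move=> /homP h m dm; apply: h => e; by rewrite e ltnn in dm.
Qed.

Lemma hcomp_sum d f : dle d f -> f = \sum_(k < d.+1) hcomp k f.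
Proof.
move=> h; apply: serP => m; rewrite ser_sumE.
case: (leqP (mdeg m) d) => [md|dm].
  rewrite (bigD1 (inord (mdeg m))) //= hcompE inordK ?ltnS // eqxx big1 ?addr0 // => k /eqP kd.
  rewrite hcompE; case: (eqVneq (mdeg m) k) => // e; case: kd.
  by apply: val_inj; rewrite /= inordK ?ltnS.
rewrite h // big1 // => k _; rewrite hcompE; case: eqP => // e.
by have := ltn_ord k; rewrite -e ltnS leqNgt dm.
Qed.

Lemma hcomp_eq0 d f : dle d f -> (forall k, hcomp k f = 0) -> f = 0.
Proof. by move=> h e; rewrite (hcomp_sum h) big1. Qed.

Lemma homM d e f g : hom d f -> hom e g -> hom (d + e) (f * g).
Proof.
move=> /homP hf /homP hg; apply/homP => m md; apply: sermul_eq0 => a b ab.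
case: (eqVneq (mdeg a) d) => [ad|/eqP /hf ->]; last by rewrite mul0r.
rewrite [g b]hg ?mulr0 // => be; apply: md; by rewrite -ab mdegM ad be.
Qed.

Lemma homD d f g : hom d f -> hom d g -> hom d (f + g).
Proof.
by move=> /homP hf /homP hg; apply/homP => m md; rewrite serDE hf ?hg ?addr0.
Qed.

Lemma homZ d (c : A) f : hom d f -> hom d (c *: f).
Proof. by move=> /homP hf; apply/homP => m md; rewrite serZE hf ?mulr0. Qed.

Lemma hom1 : hom 0 1.
Proof.
by apply/homP => m md; rewrite ser1E -mdeg_eq0; case: eqP.
Qed.

Lemma homX d f k : hom d f -> hom (k * d) (f ^+ k).
Proof.
move=> h; elim: k => [|k IH]; first by rewrite expr0 mul0n; apply: hom1.
by rewrite exprS mulSn; apply: homM.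
Qed.

Lemma hom_xmon a : hom (mdeg a) (xmon a).
Proof. by move=> m; rewrite xmonE; case: (eqVneq m a) => [->|_] //; rewrite eqxx. Qed.

Lemma hom_xvar i : hom 1 (xvar i).
Proof. by rewrite -[1%N](mdeg_mpow i); apply: hom_xmon. Qed.

Lemma hcomp_homM d e f g : hom e g -> hcomp (d + e) (f * g) = hcomp d f * g.
Proof.
move=> hg; have [D hD] := dle_ex f; rewrite [in LHS](hcomp_sum hD) mulr_suml raddf_sum.
have hk k : hom (k + e) (hcomp k f * g) by apply: homM => //; apply: hom_hcomp.
case: (leqP d D) => dD.
  rewrite (bigD1 (inord d)) //= inordK ?ltnS // (hcomp_id (hk d)) big1 ?addr0 // => k kd.
  apply: (hcomp_other (hk k)) => /addIn e'; case/eqP: kd; apply: val_inj.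
  by rewrite /= inordK ?ltnS.
rewrite big1 => [|k _].
  rewrite [hcomp d f](_ : _ = 0) ?mul0r //; apply: serP => m; rewrite hcompE.
  by case: eqP => // md; rewrite hD ?md.
apply: (hcomp_other (hk k)) => /addIn e'; by have := ltn_ord k; rewrite -e' ltnS leqNgt dD.
Qed.

Lemma hcomp_homM_lt d e f g : hom e g -> (d < e)%N -> hcomp d (f * g) = 0.
Proof.
move=> hg de; have [D hD] := dle_ex f; rewrite [in LHS](hcomp_sum hD) mulr_suml raddf_sum.
rewrite big1 // => k _; apply: (@hcomp_other (k + e)).
  by apply: homM => //; apply: hom_hcomp.
by move=> e'; move: de; rewrite e' ltnNge leq_addl.
Qed.

Lemma dleM d e f g : dle d f -> dle e g -> dle (d + e) (f * g).
Proof.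
move=> hf hg m dm; apply: sermul_eq0 => a b ab.
case: (ltnP d (mdeg a)) => [/hf ->|ad]; first by rewrite mul0r.
rewrite [g b]hg ?mulr0 // ltnNge; apply/negP => be.
by move: dm; rewrite -ab mdegM ltnNge leq_add.
Qed.

(** * Polynomials in one of the variables *)
Definition xfree i c : Prop := forall m, (0 < m i)%N -> c m = 0.

Lemma xfreeD i c f : xfree i c -> xfree i f -> xfree i (c + f).
Proof. by move=> hcf hf m mi; rewrite serDE hcf ?hf ?addr0. Qed.

Lemma xfreeM i c f : xfree i c -> xfree i f -> xfree i (c * f).
Proof.
move=> hcf hf m mi; apply: sermul_eq0 => a b ab; move: mi; rewrite -ab cmM addn_gt0.
by case/orP => [/hcf ->|/hf ->]; rewrite ?mul0r ?mulr0.
Qed.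

Lemma xfree_sum i I r (P : pred I) (F : I -> R) :
  (forall x, P x -> xfree i (F x)) -> xfree i (\sum_(x <- r | P x) F x).
Proof. by move=> h; elim/big_ind: _ => //; apply: xfreeD. Qed.

Lemma xfree_horner i (q : {poly R}) m :
  (forall j, xfree i q`_j) -> q.[xvar i] m = q`_(m i) (mdelete i m).
Proof.
move=> hq; have term j :
    (q`_j * xvar i ^+ j) m = if j == m i then q`_(m i) (mdelete i m) else 0.
  rewrite xvarX mulrC; case: (ltngtP j (m i)) => [jm|mj|->].
  - have dv : mdvd (mpow i j) m.
      by apply/mdvdP => l; rewrite mpowE; case: eqP => // ->; apply: ltnW.
    rewrite -(mdivmK dv) xmonM_coef hq // mdivmE mpowE eqxx; by rewrite subn_gt0.
  - by rewrite xmonM_coef0 // => /mdvdP /(_ i); rewrite mpowE eqxx leqNgt mj.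
  - by have := xmonM_coef (mpow i (m i)) (mdelete i m) q`_(m i); rewrite mdeleteK.
rewrite horner_coef ser_sumE; under eq_bigr => j _ do rewrite term.
case: (ltnP (m i) (size q)) => mq.
  by rewrite (bigD1 (Ordinal mq)) //= eqxx big1 ?addr0 // => j /eqP jm; case: eqP => // e;
     case: jm; apply: val_inj.
rewrite [q`_(m i)]nth_default // big1 // => j _; case: eqP => //.
Qed.

(** A series has only one expansion in powers of x_i with coefficients free of
    x_i.  Any two such expansions can therefore be compared by evaluation, and
    this is how xpoly is seen to be multiplicative. *)
Lemma xfree_horner_inj i (p q : {poly R}) :
  (forall j, xfree i p`_j) -> (forall j, xfree i q`_j) ->
  p.[xvar i] = q.[xvar i] -> p = q.
Proof.
move=> hp hq e; apply/polyP => j; apply: serP => m.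
case: (posnP (m i)) => mi; last by rewrite hp ?hq.
have := congr1 (fun f : R => f (mmul (mpow i j) m)) e.
rewrite /= !xfree_horner // cmM mpowE eqxx mi addn0.
suff -> : mdelete i (mmul (mpow i j) m) = m by [].
by apply: monP => l; rewrite mdeleteE cmM mpowE; case: eqP => [->|].
Qed.

(** The coefficient of x_i^j in the expansion of f in powers of x_i.  The bounded
    degree of f makes this expansion a polynomial, although f may involve
    infinitely many variables. *)
Definition slice i j f : R :=
  ser_of (sval (cid (dle_ex f)))
    (fun m => if m i == 0%N then f (mmul (mpow i j) m) else 0).

Lemma sliceE i j f m :
  slice i j f m = if m i == 0%N then f (mmul (mpow i j) m) else 0.
Proof.
rewrite ser_ofE; case: cid => d /= hd; case: leqP => // dm.
case: eqP => // _; rewrite hd // mdegM; apply: leq_trans dm _; exact: leq_addl.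
Qed.

Definition xpoly i f : {poly R} :=
  \poly_(j < (sval (cid (dle_ex f))).+1) slice i j f.

Lemma xpoly_coef i f j : (xpoly i f)`_j = slice i j f.
Proof.
rewrite coef_poly; case: cid => d /= hd; case: ltnP => // dj.
apply: serP => m; rewrite sliceE; case: eqP => // _.
by rewrite hd // mdegM mdeg_mpow; apply: leq_trans dj _; apply: leq_addr.
Qed.

Lemma xpoly_free i f j : xfree i (xpoly i f)`_j.
Proof. by move=> m; rewrite xpoly_coef sliceE; case: eqP => // ->. Qed.

Lemma xpolyK i f : (xpoly i f).[xvar i] = f.
Proof.
apply: serP => m; rewrite xfree_horner; last exact: xpoly_free.
by rewrite xpoly_coef sliceE mdeleteE eqxx mdeleteK.
Qed.

Lemma xpoly_is_additive i : zmod_morphism (xpoly i).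
Proof.
move=> f g; apply/polyP => j; rewrite coefB !xpoly_coef; apply: serP => m.
by rewrite serBE !sliceE serBE; case: ifP; rewrite ?subr0.
Qed.
HB.instance Definition _ i :=
  GRing.isZmodMorphism.Build R {poly R} (xpoly i) (xpoly_is_additive i).

Lemma xpoly_is_multiplicative i : monoid_morphism (xpoly i).
Proof.
split=> [|f g]; apply: (@xfree_horner_inj i); try exact: xpoly_free.
- move=> j m mi; rewrite coef1 ; case: eqP => // _; rewrite ser1E.
  by case: eqP => // m1; rewrite m1 cm1 in mi.
- by rewrite xpolyK hornerC.
- move=> j; rewrite coefM; apply: xfree_sum => k _.
  by apply: xfreeM; apply: xpoly_free.
- by rewrite hornerM !xpolyK.
Qed.
HB.instance Definition _ i :=
  GRing.isMonoidMorphism.Build R {poly R} (xpoly i) (xpoly_is_multiplicative i).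

(** * Truncation and shift *)
(** The quotient map that sets x_n, x_{n+1}, ... to zero. *)
Definition trunc n f : R :=
  ser_of (sval (cid (dle_ex f))) (fun m => if `[< supp_lt n m >] then f m else 0).

Lemma truncE n f m : trunc n f m = if `[< supp_lt n m >] then f m else 0.
Proof.
by rewrite ser_ofE; case: cid => d /= hd; case: leqP => // /hd ->; rewrite if_same.
Qed.

Lemma trunc_is_additive n : zmod_morphism (trunc n).
Proof.
by move=> f g; apply: serP => m; rewrite serBE !truncE serBE; case: ifP; rewrite ?subr0.
Qed.
HB.instance Definition _ n :=
  GRing.isZmodMorphism.Build R R (trunc n) (trunc_is_additive n).

Lemma trunc_is_multiplicative n : monoid_morphism (trunc n).
Proof.
split=> [|f g]; apply: serP => m; rewrite !truncE.
  case: asboolP => // h; rewrite ser1E; case: eqP => // m1; case: h => i _.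
  by rewrite m1 cm1.
case: asboolP => [h|h]; last first.
  apply/esym/sermul_eq0 => a b ab; rewrite !truncE.
  case: asboolP => ha; rewrite ?mul0r //; case: asboolP => hb; rewrite ?mulr0 //.
  by case: h; rewrite -ab; apply/supp_ltM.
apply: (@sermul_eq _ _ _ _ _ _ id id) => // [a b e|a b e]; first by exists a, b.
move: h; rewrite -e => /supp_ltM [ha hb].
by rewrite !truncE !asboolT.
Qed.
HB.instance Definition _ n :=
  GRing.isMonoidMorphism.Build R R (trunc n) (trunc_is_multiplicative n).

Definition vshift f : R :=
  ser_of (sval (cid (dle_ex f))) (fun m => f (mshift m)).

Lemma vshiftE f m : vshift f m = f (mshift m).
Proof.
rewrite ser_ofE; case: cid => d /= hd; case: leqP => // dm.
by rewrite hd // mdeg_mshift.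
Qed.

Lemma vshift_is_additive : zmod_morphism vshift.
Proof. by move=> f g; apply: serP => m; rewrite serBE !vshiftE serBE. Qed.
HB.instance Definition _ := GRing.isZmodMorphism.Build R R vshift vshift_is_additive.

Lemma mshift_inj : injective mshift.
Proof. exact: can_inj mshiftK. Qed.

Lemma vshift_is_multiplicative : monoid_morphism vshift.
Proof.
split=> [|f g]; apply: serP => m; rewrite !vshiftE.
  by rewrite !ser1E -{1}mshift1 (inj_eq mshift_inj).
apply: (@sermul_eq _ _ _ _ _ _ mshift mshift) => //; try exact: mshift_inj.
- by move=> a b <-; rewrite mshiftM.
- move=> a b e; exists (munshift a), (munshift b).
  have e0 : (a 0 + b 0 = 0)%N by rewrite -cmM e mshiftE.
  have : a 0%N = 0%N /\ b 0%N = 0%N by move/eqP: e0; rewrite addn_eq0 => /andP[/eqP ? /eqP].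
  case=> a0 b0; rewrite -munshiftM e mshiftK; split=> //; rewrite munshiftK; apply: monP => l;
    by rewrite mdeleteE; case: eqP => // ->.
- by move=> a b _; rewrite !vshiftE.
Qed.
HB.instance Definition _ :=
  GRing.isMonoidMorphism.Build R R vshift vshift_is_multiplicative.

Definition vunshift f : R :=
  ser_of (sval (cid (dle_ex f))) (fun m => if m 0%N == 0%N then f (munshift m) else 0).

Lemma vunshiftE f m : vunshift f m = if m 0%N == 0%N then f (munshift m) else 0.
Proof.
rewrite ser_ofE; case: cid => d /= hd; case: leqP => // dm.
case: eqP => // m0; rewrite hd // mdeg_munshift; by move: dm; rewrite (mdeg_mdelete 0) m0.
Qed.

Lemma vunshift_free f : xfree 0 (vunshift f).
Proof. by move=> m; rewrite vunshiftE; case: eqP => // ->. Qed.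

Lemma vunshiftK f : vshift (vunshift f) = f.
Proof. by apply: serP => m; rewrite vshiftE vunshiftE mshiftE mshiftK. Qed.

Lemma vshiftK f : xfree 0 f -> vunshift (vshift f) = f.
Proof.
move=> h; apply: serP => m; rewrite vunshiftE vshiftE; case: posnP => [m0|/h //].
rewrite munshiftK; congr (f _); apply: monP => l; by rewrite mdeleteE; case: eqP => // ->.
Qed.

Lemma vunshift_is_additive : zmod_morphism vunshift.
Proof.
by move=> f g; apply: serP => m; rewrite serBE !vunshiftE serBE; case: ifP; rewrite ?subr0.
Qed.
HB.instance Definition _ := GRing.isZmodMorphism.Build R R vunshift vunshift_is_additive.

Lemma vunshift_is_multiplicative : monoid_morphism vunshift.
Proof.
split=> [|f g].
  rewrite -[RHS]vshiftK ?rmorph1 // => m; rewrite ser1E.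
  by case: eqP => // ->; rewrite cm1.
rewrite -[RHS]vshiftK; last by apply: xfreeM; apply: vunshift_free.
by rewrite rmorphM; congr vunshift; rewrite -[f in LHS]vunshiftK -[g in LHS]vunshiftK.
Qed.
HB.instance Definition _ :=
  GRing.isMonoidMorphism.Build R R vunshift vunshift_is_multiplicative.

(** Splitting off x_0 and renumbering the others shows that the ring is isomorphic
    to the polynomials in one variable over itself.  This is what makes an
    induction on the number of removed coordinates possible without changing the
    ring. *)
Definition unroll f : {poly R} := map_poly vshift (xpoly 0 f).
Definition roll (p : {poly R}) : R := (map_poly vunshift p).[xvar 0].

HB.instance Definition _ := GRing.RMorphism.copy unroll (map_poly vshift \o xpoly 0).
HB.instance Definition _ :=
  GRing.RMorphism.copy roll (horner_eval (xvar 0) \o map_poly vunshift).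

Lemma unrollK : cancel unroll roll.
Proof.
move=> f; rewrite /roll /unroll -map_poly_comp.
rewrite (@map_poly_id _ (vunshift \o vshift)) ?xpolyK // => c /(nthP 0)[j _ <-] /=.
by apply: vshiftK; apply: xpoly_free.
Qed.

Lemma rollK : cancel roll unroll.
Proof.
move=> p; rewrite /roll /unroll.
suff -> : xpoly 0 (map_poly vunshift p).[xvar 0] = map_poly vunshift p.
  rewrite -map_poly_comp (@map_poly_id _ (vshift \o vunshift)) // => c _ /=.
  exact: vunshiftK.
apply: (@xfree_horner_inj 0); rewrite ?xpolyK //; first exact: xpoly_free.
by move=> j; rewrite coef_map; apply: vunshift_free.
Qed.

Lemma unroll_coef f j m : (unroll f)`_j m = f (mmul (mpow 0 j) (mshift m)).
Proof. by rewrite coef_map /= vshiftE xpoly_coef sliceE mshiftE. Qed.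

(** * Taylor expansion *)
(** f(x_i + T) as a polynomial in T.  Its coefficients are the divided derivatives
    of f, which see p-th powers in characteristic p where ordinary derivatives
    do not. *)
Definition taylor i f : {poly R} :=
  (map_poly polyC (xpoly i f)).[(xvar i)%:P + 'X].

HB.instance Definition _ i := GRing.RMorphism.copy (taylor i)
  (horner_eval ((xvar i)%:P + 'X) \o map_poly polyC \o xpoly i).

Lemma taylor_coefE i f k m :
  (taylor i f)`_k m = f (mmul (mpow i k) m) *+ 'C(m i + k, k).
Proof.
have -> : (taylor i f)`_k = (xpoly i f)^`N(k).[xvar i].
  rewrite /taylor nderiv_taylor; last exact: commr_polyX.
  rewrite size_map_polyC.
  under eq_bigr => j _ do rewrite nderivn_map horner_map /=.
  rewrite coef_sum.
  under eq_bigr => j _ do rewrite coefCM coefXn.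
  case: (ltnP k (size (xpoly i f))) => kf.
    rewrite (bigD1 (Ordinal kf)) //= eqxx mulr1 big1 ?addr0 // => j jk.
    case: eqP => [e|]; last by rewrite mulr0.
    by case/eqP: jk; apply: val_inj.
  rewrite big1 => [|j _]; last first.
    case: eqP => [e|]; last by rewrite mulr0.
    by have := ltn_ord j; rewrite -e ltnNge kf.
  by rewrite nderivn_poly0 // horner0.
rewrite xfree_horner; last first.
  by move=> j m' h; rewrite coef_nderivn serMnE xpoly_free // mul0rn.
rewrite coef_nderivn.
rewrite serMnE xpoly_coef sliceE mdeleteE eqxx [(k + _)%N in X in X = _]addnC; congr (f _ *+ _).
by rewrite [(m i + k)%N]addnC -mpowD -mulmA mdeleteK.
Qed.
End Products.

(** * The ring is an integral domain *)

Lemma grevlexM (a b c : mon) : grevlex a b -> grevlex (mmul a c) (mmul b c).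
Proof.
case=> [h|[h [i [abi abj]]]]; first by left; rewrite !mdegM ltn_add2r.
right; split; first by rewrite !mdegM h.
by exists i; split=> [|j ij]; rewrite !cmM ?ltn_add2r // abj.
Qed.

Section Domain.
Variable K : fieldType.
Local Notation R := (bdseries K).

(** As in a polynomial ring, the product of the leading monomials has only one
    factorization with nonzero coefficients: the order is compatible with
    multiplication, and leading monomials exist for series too. *)
Lemma lm_mul (f g : R) a b :
  is_lm f a -> is_lm g b -> (f * g) (mmul a b) = f a * g b.
Proof.
move=> [_ fa] [_ gb]; apply: sermul_single => a' b' e ne.
apply/eqP; apply: contrapT => /negP; rewrite mulf_eq0 negb_or => /andP[/fa fa' /gb gb'].
case: fa' => // /grevlexM aa'; apply: (@grevlex_irr (mmul a b)).
rewrite -[X in grevlex _ X]e; case: gb' => [->|bb']; first exact: aa'.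
apply: grevlex_trans (aa' b) _; rewrite ![mmul a' _]mulmC; exact: grevlexM.
Qed.

Lemma ser_mulf_eq0 (f g : R) : f * g = 0 -> (f == 0) || (g == 0).
Proof.
move=> fg0; apply: contrapT => /negP; rewrite negb_or => /andP[/lmP hf /lmP hg].
have := lm_mul hf hg; rewrite fg0 ser0E => /esym/eqP; rewrite mulf_eq0.
by case: hf hg => [/negbTE -> _] [/negbTE -> _].
Qed.

Definition ser_unit : pred R := fun f => `[< exists g : R, g * f = 1 >].
Definition ser_inv (f : R) : R :=
  if pselect (exists g : R, g * f = 1) is left h then sval (cid h) else f.

Fact ser_mulVx : {in ser_unit, left_inverse 1 ser_inv *%R}.
Proof.
move=> f /asboolP h; rewrite /ser_inv; case: pselect => // h'.
by case: cid.
Qed.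
Fact ser_unitPl (x y : R) : y * x = 1 -> ser_unit x.
Proof. by move=> h; apply/asboolP; exists y. Qed.
Fact ser_invx_out : {in [predC ser_unit], ser_inv =1 id}.
Proof. by move=> f /asboolP h; rewrite /ser_inv; case: pselect. Qed.

HB.instance Definition _ := GRing.ComNzRing_hasMulInverse.Build R
  ser_mulVx ser_unitPl ser_invx_out.
HB.instance Definition _ := GRing.ComUnitRing_isIntegral.Build R ser_mulf_eq0.

End Domain.

(** * Derivatives and their constants *)
Section Derivations.
Variable A : comNzRingType.
Local Notation R := (bdseries A).
Local Notation hom := (@homogeneous_of_degree A).
Implicit Types (f g : R) (d i j k : nat).

Definition homlt d f : Prop := exists2 e, (e < d)%N & hom e f.

Lemma hom0P f : hom 0 f -> f = (f mone)%:A.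
Proof.
move=> /homP h; apply: serP => m; rewrite serCE; case: (eqVneq m mone) => [->//|m1].
by rewrite h //; apply/eqP; rewrite mdeg_eq0.
Qed.

Lemma homC c : hom 0 (c%:A : R).
Proof. by apply: homZ; apply: hom1. Qed.

Lemma taylor0 i f : (taylor i f)`_0 = f.
Proof. by apply: serP => m; rewrite taylor_coefE mpow0 mul1m addn0 bin0. Qed.

Lemma taylor_dle i d f k : dle d f -> (0 < k)%N ->
  (taylor i f)`_k = 0 \/ (0 < d)%N /\ dle d.-1 (taylor i f)`_k.
Proof.
move=> h k0; case: (posnP d) => [d0|d0]; [left|right; split=> //].
  apply: serP => m; rewrite taylor_coefE h ?mul0rn // d0 mdegM mdeg_mpow.
  by rewrite addn_gt0 k0.
move=> m dm; rewrite taylor_coefE h ?mul0rn // mdegM mdeg_mpow.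
by rewrite -(prednK d0) -(prednK k0) addSn ltnS; apply: leq_trans dm _; apply: leq_addl.
Qed.

Lemma taylor_homlt i d f k : hom d f -> (0 < k)%N -> (0 < d)%N ->
  homlt d (taylor i f)`_k.
Proof.
move=> /homP h k0 d0; exists (d - k)%N; first by rewrite ltn_subrL k0 d0.
case: (leqP k d) => kd; apply/homP => m md; rewrite taylor_coefE h ?mul0rn //;
  rewrite mdegM mdeg_mpow => e.
  by case: md; rewrite -e addKn.
by move: kd; rewrite -e ltnNge leq_addr.
Qed.

Lemma taylorC i (c : A) : taylor i (c%:A) = (c%:A)%:P.
Proof.
apply/polyP => -[|k]; rewrite coefC /= ?taylor0 //; apply: serP => m.
rewrite taylor_coefE serCE; case: eqP => [e|]; last by rewrite mul0rn.
by move: (congr1 (fun m : mon => m i) e); rewrite /= cmM mpowE eqxx cm1.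
Qed.

(** A nonconstant monomial m of f contains some x_i, and the divided derivative of
    order m_i carries the coefficient of m unchanged. *)
Lemma taylor_const f : (forall i k, (0 < k)%N -> (taylor i f)`_k = 0) ->
  f = (f mone)%:A.
Proof.
move=> h; apply: serP => m; rewrite serCE; case: (eqVneq m mone) => [->//|/eqP m1].
have [i mi] := mdeg_neq0P m1.
have := congr1 (fun g : R => g (mdelete i m)) (h i (m i) mi).
by rewrite /= taylor_coefE mdeleteK mdeleteE eqxx add0n binn.
Qed.

Definition D i f : R := (taylor i f)`_1.

Lemma D_is_additive i : zmod_morphism (D i).
Proof. by move=> f g; rewrite /D rmorphB coefB. Qed.
HB.instance Definition _ i := GRing.isZmodMorphism.Build R R (D i) (D_is_additive i).

Lemma DM i f g : D i (f * g) = D i f * g + f * D i g.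
Proof.
by rewrite /D rmorphM coefM !big_ord_recl big_ord0 /= addr0 !taylor0 addrC.
Qed.

Lemma DC i (c : A) : D i (c%:A) = 0.
Proof. by rewrite /D taylorC coefC. Qed.

Lemma D1 i : D i 1 = 0.
Proof. by rewrite -(DC i 1) scale1r. Qed.

Lemma DX i f k : D i (f ^+ k) = k%:R * f ^+ k.-1 * D i f.
Proof.
elim: k => [|k IH]; first by rewrite expr0 D1 !mul0r.
rewrite exprS DM IH /=; case: k {IH} => [|k].
  by rewrite expr0 !mul0r mulr0 addr0 !mulr1 mul1r.
by rewrite /= -[k.+2]addn1 natrD exprS; ring.
Qed.

(** Chain rule: on relations over a subalgebra, D i acts as a derivation on
    polynomials that differentiates the coefficients and sends X to D i x. *)
Lemma D_horner i (p : {poly R}) x :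
  D i p.[x] = (map_poly (D i) p + D i x *: p^`()).[x].
Proof.
have D0 : D i 0 = 0 by rewrite raddf0.
elim/poly_ind: p => [|p c IH].
  by rewrite horner0 raddf0 deriv0 scaler0 map_poly0 addr0 horner0.
have mapD (q r : {poly R}) : map_poly (D i) (q + r) = map_poly (D i) q + map_poly (D i) r.
  by apply/polyP => j; rewrite coefD !coef_map_id0 // coefD raddfD.
have mapX (q : {poly R}) : map_poly (D i) (q * 'X) = map_poly (D i) q * 'X.
  by apply/polyP => j; rewrite coefMX !coef_map_id0 // coefMX; case: eqP; rewrite ?raddf0.
have mapC (a : R) : map_poly (D i) a%:P = (D i a)%:P.
  by apply/polyP => j; rewrite coef_map_id0 // !coefC; case: eqP.
rewrite !hornerE raddfD /= DM IH mapD mapX mapC derivD derivC addr0 derivM derivX.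
rewrite !hornerE; ring.
Qed.

Lemma D_coef i f m : D i f m = f (mmul (mpow i 1) m) *+ (m i).+1.
Proof. by rewrite /D taylor_coefE addn1 bin1. Qed.

Definition Dconst f : Prop := forall i, D i f = 0.

Lemma Dconst_coef f m : Dconst f -> forall i, f m *+ m i = 0.
Proof.
move=> h i; case: (posnP (m i)) => [->|mi]; first by rewrite mulr0n.
have dv : mdvd (mpow i 1) m by apply/mdvdP => l; rewrite mpowE; case: eqP => // ->.
have := congr1 (fun g : R => g (mdivm m (mpow i 1))) (h i).
by rewrite /= D_coef mdivmK // mdivmE mpowE eqxx subn1 prednK.
Qed.

Lemma Dconst_hcomp d f : Dconst f -> Dconst (hcomp d f).
Proof.
move=> h i; apply: serP => m; rewrite D_coef hcompE; case: ifP; rewrite ?mul0rn //.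
by rewrite -D_coef h.
Qed.

End Derivations.

(** * The Frobenius map *)
Section Frobenius.
Variables (K : fieldType) (p : nat).
Hypothesis pK : p \in [pchar K].
Local Notation R := (bdseries K).
Local Notation hom := (@homogeneous_of_degree K).
Implicit Types (f g : R).

Let p_gt0 : (0 < p)%N. Proof. exact: prime_gt0 (pcharf_prime pK). Qed.

Lemma ser_pchar : p \in [pchar R].
Proof. exact: (rmorph_pchar (in_alg R) pK). Qed.

Definition mscale (m : mon) : mon :=
  mkmon (sval (cid (supp_lt_ex m))) (fun i => p * m i)%N.

Lemma mscaleE m i : mscale m i = (p * m i)%N.
Proof. by rewrite mkmonE; case: cid => n /= h; case: ltnP => // /h ->; rewrite muln0. Qed.

Lemma mscale_inj : injective mscale.
Proof.
move=> a b e; apply: monP => i; move: (congr1 (fun m : mon => m i) e).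
by rewrite /= !mscaleE => /eqP; rewrite eqn_pmul2l // => /eqP.
Qed.

Lemma xmonX (a : mon) : (xmon K a : R) ^+ p = xmon K (mscale a).
Proof.
have h k : exists2 b : mon, (xmon K a : R) ^+ k = xmon K b & forall i, b i = (k * a i)%N.
  elim: k => [|k [b e hb]]; first by exists mone; rewrite ?xmon1 // => i; rewrite cm1.
  exists (mmul a b); first by rewrite exprS e xmonM.
  by move=> i; rewrite cmM hb mulSn.
by have [b -> hb] := h p; congr xmon; apply: monP => i; rewrite hb mscaleE.
Qed.

Lemma mdeg_mscale m : mdeg (mscale m) = (p * mdeg m)%N.
Proof.
have h := @homX _ _ _ p (@hom_xmon K m).
by rewrite (h (mscale m)) // xmonX xmonE eqxx oner_eq0.
Qed.

Lemma frobD (f g : R) : (f + g) ^+ p = f ^+ p + g ^+ p.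
Proof. exact: (pFrobenius_autD_comm ser_pchar (mulrC f g)). Qed.

Lemma frob_sum I r (P : pred I) (F : I -> R) :
  (\sum_(i <- r | P i) F i) ^+ p = \sum_(i <- r | P i) F i ^+ p.
Proof.
elim/big_rec2: _ => [|i y x _ <-]; first by rewrite expr0n gtn_eqF.
by rewrite frobD.
Qed.

(** The p-th power is additive, but f is an infinite sum of monomials.  Only the
    finitely many divisors of n matter for the coefficient of n, so f is split
    into its part on these divisors and a rest that contributes nothing. *)
Lemma frob_coef_sum f n :
  (f ^+ p) n = \sum_(a <- mdivisors n) f a ^+ p * (n == mscale a)%:R.
Proof.
pose f1 : R := \sum_(a <- mdivisors n) f a *: xmon K a.
pose f2 := f - f1.
have f20 a : mdvd a n -> f2 a = 0.
  move=> /mem_mdivisors an; rewrite serBE ser_sumE (big_fsetD1 a) // serZE xmonE eqxx mulr1.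
  rewrite big1_seq => [|b]; first by rewrite /= addr0 subrr.
  rewrite in_fsetD1 => /andP[_ /andP[ba _]].
  by rewrite serZE xmonE eq_sym (negbTE ba) mulr0.
have {1}-> : f = f1 + f2 by rewrite addrC subrK.
rewrite frobD serDE [(f2 ^+ p) n](_ : _ = 0) ?addr0; last first.
  rewrite -(prednK p_gt0) exprS; apply: sermul_eq0 => a b e; rewrite f20 ?mul0r //.
  by exists b.
rewrite frob_sum ser_sumE; apply: eq_bigr => a _.
by rewrite exprZn serZE xmonX xmonE.
Qed.

Lemma frob_coef f m : (f ^+ p) (mscale m) = f m ^+ p.
Proof.
rewrite frob_coef_sum (big_fsetD1 m) /=; last first.
  by apply/mem_mdivisors/mdvdP => i; rewrite mscaleE leq_pmull.
rewrite eqxx mulr1 big1_seq ?addr0 // => a; rewrite in_fsetD1 => /andP[_ /andP[am _]].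
by rewrite (inj_eq mscale_inj) eq_sym (negbTE am) mulr0.
Qed.

Lemma frob_coef0 f n : (forall a, n <> mscale a) -> (f ^+ p) n = 0.
Proof.
by move=> h; rewrite frob_coef_sum big1 // => a _; case: eqP => [/h//|]; rewrite mulr0.
Qed.

Lemma frob_eq0 f : f ^+ p = 0 -> f = 0.
Proof. by move/eqP; rewrite expf_eq0 p_gt0 => /eqP. Qed.

Lemma frob_inj f g : f ^+ p = g ^+ p -> f = g.
Proof.
move=> e; apply/eqP; rewrite -subr_eq0; apply/eqP/frob_eq0.
have : (f - g + g) ^+ p = g ^+ p by rewrite subrK.
by rewrite frobD => /(canRL (addrK _)); rewrite subrr.
Qed.

Lemma frob_coef_neq0 f m : f m != 0 -> (f ^+ p) (mscale m) != 0.
Proof. by rewrite frob_coef; apply: expf_neq0. Qed.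

Lemma Dconst_frob f : Dconst (f ^+ p).
Proof. by move=> i; rewrite DX (pcharf0 ser_pchar) !mul0r. Qed.

Lemma poly_frob (q : {poly R}) :
  q ^+ p = \sum_(j < size q) (q`_j ^+ p)%:P * 'X^(j * p).
Proof.
have pRX : p \in [pchar {poly R}] by apply: (rmorph_pchar polyC ser_pchar).
rewrite -[in LHS](coefK q) poly_def -(pFrobenius_autE pRX) rmorph_sum.
apply: eq_bigr => j _.
by rewrite /= pFrobenius_autE exprZn -exprM -mul_polyC.
Qed.

Lemma poly_frob_coef (q : {poly R}) k : (q ^+ p)`_(p * k) = q`_k ^+ p.
Proof.
rewrite poly_frob coef_sum; under eq_bigr => j _ do rewrite coefCM coefXn.
case: (ltnP k (size q)) => ks.
  rewrite (bigD1 (Ordinal ks)) //= mulnC eqxx mulr1 big1 ?addr0 // => j jk.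
  rewrite eqn_pmul2r //; case: (eqVneq k j) => [e|_]; last by rewrite mulr0.
  by case/eqP: jk; apply: val_inj.
rewrite (nth_default _ ks) expr0n gtn_eqF // big1 // => j _.
by rewrite mulnC eqn_pmul2r // gtn_eqF ?mulr0 //; apply: leq_trans ks.
Qed.

Lemma poly_frob_coef0 (q : {poly R}) l : ~~ (p %| l)%N -> (q ^+ p)`_l = 0.
Proof.
move=> pl; rewrite poly_frob coef_sum big1 // => j _; rewrite coefCM coefXn.
case: eqP => [e|]; last by rewrite mulr0.
by case/negP: pl; rewrite e dvdn_mull.
Qed.

Hypothesis perfK : forall a : K, exists b, b ^+ p = a.

(** If all derivatives of f vanish, every exponent in f is divisible by p, and the
    coefficients have p-th roots because the field is perfect. *)
Lemma Dconst_root f : Dconst f -> exists g, f = g ^+ p.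
Proof.
move=> hf; pose rt a := sval (cid (perfK a)).
have rtE a : rt a ^+ p = a by rewrite /rt; case: cid.
have [d hd] := dle_ex f.
exists (ser_of d (fun m => rt (f (mscale m)))); apply: serP => n.
case: (pselect (exists a, n = mscale a)) => [[a ->]|h].
  rewrite frob_coef ser_ofE; case: leqP => da; first by rewrite rtE.
  rewrite hd ?expr0n ?gtn_eqF //; apply: leq_trans da _; rewrite mdeg_mscale.
  exact: leq_pmull.
rewrite frob_coef0 => [|a na]; last by case: h; exists a.
apply: contrapT => fn; case: h.
have pn i : (p %| n i)%N.
  have := Dconst_coef n hf i; rewrite -mulr_natr => /eqP; rewrite mulf_eq0.
  by case: (eqVneq (f n) 0) => [/fn //|_] /=; rewrite -(dvdn_pcharf pK).
have [N hN] := supp_lt_ex n.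
exists (mkmon N (fun i => n i %/ p)%N); apply: monP => i.
rewrite mscaleE mkmonE; case: ltnP => [_|/hN ->]; last by rewrite muln0.
by rewrite mulnC divnK.
Qed.
End Frobenius.

(** * Subalgebras *)
Section Subalgebras.
Variable K : fieldType.
Local Notation R := (bdseries K).
Local Notation hom := (@homogeneous_of_degree K).
Implicit Types (f g x z : R) (S B : R -> Prop) (P Q : {poly R}) (d e i j k : nat).

Inductive alg S : R -> Prop :=
| alg_const c : alg S c%:A
| alg_gen z : S z -> alg S z
| alg_add f g : alg S f -> alg S g -> alg S (f + g)
| alg_mul f g : alg S f -> alg S g -> alg S (f * g).

Record subalg B : Prop := Subalg {
  subalg_const : forall c, B c%:A;
  subalg_add : forall f g, B f -> B g -> B (f + g);
  subalg_mul : forall f g, B f -> B g -> B (f * g) }.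

Lemma alg_subalg S : subalg (alg S).
Proof. by split; [apply: alg_const | apply: alg_add | apply: alg_mul]. Qed.

Lemma alg_min S B : subalg B -> (forall z, S z -> B z) -> forall f, alg S f -> B f.
Proof. by move=> [bc bD bM] SB f; elim=> //; auto. Qed.

Lemma alg_mono S S' : (forall z, S z -> S' z) -> forall f, alg S f -> alg S' f.
Proof.
by move=> h; apply: alg_min; [exact: alg_subalg | move=> z /h; apply: alg_gen].
Qed.

Section SubalgTheory.
Variable B : R -> Prop.
Hypothesis hB : subalg B.

Lemma subalg0 : B 0.
Proof. by have := subalg_const hB 0; rewrite scale0r. Qed.
Lemma subalg1 : B 1.
Proof. by have := subalg_const hB 1; rewrite scale1r. Qed.
Lemma subalgZ c f : B f -> B (c *: f).
Proof. by move=> h; rewrite -mulr_algl; apply: (subalg_mul hB) => //; apply: (subalg_const hB). Qed.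
Lemma subalgB f g : B f -> B g -> B (f - g).
Proof. by move=> hf hg; rewrite -scaleN1r; apply: (subalg_add hB) => //; apply: subalgZ. Qed.
Lemma subalgX f k : B f -> B (f ^+ k).
Proof.
move=> hf; elim: k => [|k IH]; first by rewrite expr0; apply: subalg1.
by rewrite exprS; apply: (subalg_mul hB).
Qed.
Lemma subalg_sum I r (p : pred I) (F : I -> R) :
  (forall u, p u -> B (F u)) -> B (\sum_(u <- r | p u) F u).
Proof. by move=> h; elim/big_ind: _ => //; [apply: subalg0 | apply: (subalg_add hB)]. Qed.
Lemma subalgMn f k : B f -> B (f *+ k).
Proof. by move=> hf; rewrite -scaler_nat; apply: subalgZ. Qed.

Definition polyIn P : Prop := forall j, B P`_j.

Lemma polyInC f : B f -> polyIn f%:P.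
Proof. by move=> hf j; rewrite coefC; case: ifP => _ //; apply: subalg0. Qed.
Lemma polyInX : polyIn 'X.
Proof. by move=> j; rewrite coefX; case: eqP => _; [apply: subalg1 | apply: subalg0]. Qed.
Lemma polyInD P Q : polyIn P -> polyIn Q -> polyIn (P + Q).
Proof. by move=> hP hQ j; rewrite coefD; apply: (subalg_add hB). Qed.
Lemma polyInM P Q : polyIn P -> polyIn Q -> polyIn (P * Q).
Proof.
move=> hP hQ j; rewrite coefM; apply: subalg_sum => u _.
exact: (subalg_mul hB).
Qed.

Lemma polyIn_horner P x : polyIn P -> B x -> B P.[x].
Proof.
move=> hP hx; rewrite horner_coef; apply: subalg_sum => u _.
by apply: (subalg_mul hB) => //; apply: subalgX.
Qed.

Definition adjoin x f : Prop := exists2 P, polyIn P & f = P.[x].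

Lemma adjoin_subalg x : subalg (adjoin x).
Proof.
split=> [c|f g [P hP ->] [Q hQ ->]|f g [P hP ->] [Q hQ ->]].
- by exists (c%:A)%:P; rewrite ?hornerC //; apply: polyInC; apply: (subalg_const hB).
- by exists (P + Q); rewrite ?hornerD //; apply: polyInD.
- by exists (P * Q); rewrite ?hornerM //; apply: polyInM.
Qed.

Definition transc x : Prop := forall P, polyIn P -> P.[x] = 0 -> P = 0.

End SubalgTheory.

Lemma alg_adjoin S x f :
  alg (fun z => S z \/ z = x) f <-> adjoin (alg S) x f.
Proof.
have hS := alg_subalg S; split.
  apply: alg_min; first exact: adjoin_subalg.
  move=> z [Sz|->]; last by exists 'X; [apply: polyInX | rewrite hornerX].
  by exists z%:P; [apply: polyInC => //; apply: alg_gen | rewrite hornerC].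
case=> P hP ->; apply: polyIn_horner; first exact: alg_subalg.
  by move=> j; apply: alg_mono (hP j) => z; left.
by apply: alg_gen; right.
Qed.

(** * Adjoining one more generator *)
Definition perfect_field : Prop :=
  [pchar K] =i pred0 \/ exists2 p, p \in [pchar K] & forall a : K, exists b, b ^+ p = a.

(** What an induction over generators of degree d has to know about the subalgebra
    generated so far.  Components reduce relations to homogeneous ones; Taylor
    coefficients and the elements of smaller degree put all derivatives of a new
    generator x into B; p-th roots allow one to pass from a relation that is a
    p-th power to its root. *)
Record good d B : Prop := Good {
  good_subalg : subalg B;
  good_hcomp : forall k f, B f -> B (hcomp k f);
  good_taylor : forall i k f, B f -> B (taylor i f)`_k;
  good_root : forall p f, p \in [pchar K] -> B (f ^+ p) -> B f;
  good_low : forall f, homlt d f -> B f }.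

Lemma sermul_neq0 f g m : (f * g) m <> 0 ->
  exists a b, [/\ mmul a b = m, f a <> 0 & g b <> 0].
Proof.
move=> fg; apply: contrapT => h; apply: fg; apply: sermul_eq0 => a b ab.
case: (eqVneq (f a) 0) => [->|/eqP fa]; first by rewrite mul0r.
case: (eqVneq (g b) 0) => [->|/eqP gb]; first by rewrite mulr0.
by case: h; exists a, b.
Qed.

Lemma D_neq0 i f m : D i f m <> 0 -> f (mmul (mpow i 1) m) <> 0.
Proof. by move=> h e; apply: h; rewrite D_coef e mul0rn. Qed.

Lemma Dconst0 f : [pchar K] =i pred0 -> Dconst f -> f = (f mone)%:A.
Proof.
move=> /pcharf0P ch hf; apply: serP => m; rewrite serCE.
case: (eqVneq m mone) => [->//|/eqP /mdeg_neq0P [i mi]].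
have /eqP := Dconst_coef m hf i; rewrite -mulr_natr mulf_eq0 ch.
by rewrite gtn_eqF // orbF => /eqP.
Qed.

Section Step.
Hypothesis perfK : perfect_field.
Variables (d : nat) (B : R -> Prop) (x : R).
Hypotheses (d_gt0 : (0 < d)%N) (hB : good d B) (hx : hom d x) (xB : ~ B x).

Let sB : subalg B := good_subalg hB.

Lemma step_taylor i k : (0 < k)%N -> B (taylor i x)`_k.
Proof. by move=> k0; apply: (good_low hB); apply: taylor_homlt. Qed.

Lemma step_D i : B (D i x).
Proof. exact: step_taylor. Qed.

(** In characteristic 0 a constant for the derivations is a scalar; in
    characteristic p it is a p-th power, and the root has degree smaller than d,
    hence lies in B. *)
Lemma step_low_const g : hom d g -> Dconst g -> B g.
Proof.
move=> hg Dg; case: perfK => [ch0|[p pK perf]].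
  by rewrite (Dconst0 ch0 Dg); apply: (subalg_const sB).
have p_gt0 := prime_gt0 (pcharf_prime pK); have p_gt1 := prime_gt1 (pcharf_prime pK).
have [e eg] := Dconst_root pK perf Dg.
suff Be : B e by rewrite eg; apply: subalgX.
apply: (good_low hB); exists (d %/ p)%N; first exact: ltn_Pdiv.
move=> m /(frob_coef_neq0 pK); rewrite -eg => /hg; rewrite (mdeg_mscale K) => <-.
by rewrite mulKn.
Qed.

Lemma step_const_lin c a : c != 0 -> B a -> ~ Dconst (c *: x + a).
Proof.
move=> c0 Ba hD; apply: xB.
have Bg : B (hcomp d (c *: x + a)).
  by apply: step_low_const; [apply: hom_hcomp | apply: Dconst_hcomp].
have := subalgB sB Bg (good_hcomp hB d Ba); rewrite raddfD /= addrK hcompZ (hcomp_id hx) => Bcx.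
by rewrite -(scalerK c0 x); apply: subalgZ.
Qed.

(** The multiplier b ^ p is lowered in degree: if b ^ p x + a is a constant for the
    derivations, it is a p-th power, so its Taylor coefficient of order p k is a
    p-th power too, hence again such a constant.  This coefficient has the form
    b_k ^ p x + a_k, where b_k is the Taylor coefficient of b of order k and the
    remaining terms only involve proper Taylor coefficients of x, which lie in B.
    The process stops when b is a scalar, where x would lie in B. *)
Lemma step_const_frob p : p \in [pchar K] -> (forall a : K, exists b, b ^+ p = a) ->
  forall n b a, dle n b -> B b -> b <> 0 -> B a -> ~ Dconst (b ^+ p * x + a).
Proof.
move=> pK perf; have p_gt0 := prime_gt0 (pcharf_prime pK).
suff key n b a : dle n b -> B b -> b <> 0 -> B a -> Dconst (b ^+ p * x + a) ->
    exists b' a', [/\ (0 < n)%N, dle n.-1 b', B b', b' <> 0 & B a' /\ Dconst (b' ^+ p * x + a')].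
  elim=> [|n IH] b a bn Bb b0 Ba hD; have [b' [a' [n0 bn' Bb' b0' [Ba' hD']]]] := key _ _ _ bn Bb b0 Ba hD.
    by [].
  exact: (IH b' a').
move=> bn Bb b0 Ba hD.
case: (pselect (exists i k, (0 < k)%N /\ (taylor i b)`_k <> 0)) => [[i [k [k0 bk]]]|bconst]; last first.
  have bE : b = (b mone)%:A.
    by apply: taylor_const => i k k0; apply: contrapT => h; apply: bconst; exists i, k.
  have c0 : b mone != 0 by apply/eqP => e; apply: b0; rewrite bE e scale0r.
  case: (@step_const_lin ((b mone) ^+ p) a) => //; first by rewrite expf_neq0.
  by move: hD; rewrite {1}bE exprZn expr1n mulr_algl.
case: (taylor_dle i bn k0) => [/bk //|[n0 bn']].
have [g hg] := Dconst_root pK perf hD.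
exists (taylor i b)`_k,
  (\sum_(l < p * k) (taylor i (b ^+ p))`_l * (taylor i x)`_(p * k - l) + (taylor i a)`_(p * k)).
split=> //; first exact: (good_taylor hB).
split.
  apply: (subalg_add sB); last exact: (good_taylor hB).
  apply: subalg_sum => // l _; apply: (subalg_mul sB).
    by apply: (good_taylor hB); apply: subalgX.
  by apply: step_taylor; rewrite subn_gt0.
have -> : (taylor i b)`_k ^+ p * x +
  (\sum_(l < p * k) (taylor i (b ^+ p))`_l * (taylor i x)`_(p * k - l) + (taylor i a)`_(p * k)) =
  (taylor i (b ^+ p * x + a))`_(p * k).
  rewrite rmorphD rmorphM coefD coefM big_ord_recr /= subnn taylor0.
  rewrite -(poly_frob_coef pK) -[taylor i b ^+ p]rmorphXn /=.
  by rewrite addrA [_ * x + _]addrC.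
by rewrite hg rmorphXn (poly_frob_coef pK); apply: Dconst_frob.
Qed.

(** The obstruction behind the whole construction.  A constant b is a scalar in
    characteristic 0 and the p-th power of an element of B in characteristic p. *)
Lemma step_const b a : B b -> b <> 0 -> Dconst b -> B a -> ~ Dconst (b * x + a).
Proof.
move=> Bb b0 Db Ba; case: perfK => [ch0|[p pK perf]].
  rewrite (Dconst0 ch0 Db) mulr_algl; apply: step_const_lin => //.
  by apply/eqP => e; apply: b0; rewrite (Dconst0 ch0 Db) e scale0r.
have [c bc] := Dconst_root pK perf Db; rewrite bc.
have [n cn] := dle_ex c; apply: (step_const_frob pK perf cn) => //.
  by apply: (good_root hB pK); rewrite -bc.
by move=> c0; apply: b0; rewrite bc c0 expr0n gtn_eqF // (prime_gt0 (pcharf_prime pK)).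
Qed.

(** The derivation of B[X] that corresponds to D i under evaluation at x.  It
    lowers the weight of a polynomial when X is given the degree of x. *)
Definition lift_D i P : {poly R} := map_poly (D i) P + D i x *: P^`().

Lemma lift_D_coef i P j : (lift_D i P)`_j = D i P`_j + D i x * (P`_j.+1 *+ j.+1).
Proof. by rewrite coefD coefZ coef_deriv coef_map_id0 // raddf0. Qed.

Lemma lift_D_polyIn i P : polyIn B P -> polyIn B (lift_D i P).
Proof.
move=> hP j; rewrite lift_D_coef; apply: (subalg_add sB).
  exact: (good_taylor hB).
by apply: (subalg_mul sB); [apply: step_D | apply: subalgMn].
Qed.

Lemma natr_coef f j : (j%:R : K) = 0 -> f *+ j = 0.
Proof. by move=> j0; rewrite -scaler_nat j0 scale0r. Qed.

(** Let l be the largest index that is nonzero in K and has a nonzero coefficient.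
    Comparing coefficients, P_l is a constant for the derivations, and the
    equation for P_(l-1) says that l P_l x + P_(l-1) is one too, which step_const
    excludes. *)
Lemma lift_D_const P : polyIn B P -> (forall i, lift_D i P = 0) ->
  (forall j, (j%:R : K) != 0 -> P`_j = 0) /\ (forall j, Dconst P`_j).
Proof.
move=> hP h.
have rel i j : D i P`_j + D i x * (P`_j.+1 *+ j.+1) = 0 by rewrite -lift_D_coef h coef0.
have P0 j : (j%:R : K) != 0 -> P`_j = 0.
  move=> j0; apply: contrapT => Pj.
  have ex : exists j, ((j%:R : K) != 0) && (P`_j != 0) by exists j; rewrite j0; apply/eqP.
  have ub l : ((l%:R : K) != 0) && (P`_l != 0) -> (l <= size P)%N.
    by case/andP => _; apply: contraR; rewrite -ltnNge => /ltnW /(nth_default _) ->.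
  case: (ex_maxnP ex ub) => l /andP[l0 Pl] lmax.
  have nextl : P`_l.+1 *+ l.+1 = 0.
    case: (eqVneq (l.+1%:R : K) 0) => [/natr_coef -> //|l1].
    case: (eqVneq P`_l.+1 0) => [->|Pl1]; first by rewrite mul0rn.
    by have := lmax l.+1; rewrite l1 Pl1 => /(_ isT); rewrite ltnn.
  have DPl : Dconst P`_l by move=> i; have := rel i l; rewrite nextl mulr0 addr0.
  case: l l0 Pl lmax nextl DPl => [|l] l0 Pl lmax nextl DPl.
    by rewrite eqxx in l0.
  have Pll : P`_l.+1 *+ l.+1 <> 0.
    by rewrite -scaler_nat => /eqP; rewrite scaler_eq0 (negbTE l0) (negbTE Pl).
  apply: (@step_const (P`_l.+1 *+ l.+1) P`_l) => //.
  - exact: subalgMn.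
  - by move=> i; rewrite raddfMn /= DPl mul0rn.
  - move=> i; rewrite raddfD /= DM raddfMn /= DPl mul0rn mul0r add0r addrC.
    by rewrite [_ * D i x]mulrC.
split=> // j i; case: (eqVneq (j%:R : K) 0) => j0; last by rewrite P0 // raddf0.
have := rel i j; rewrite [P`_j.+1]P0 ?mul0rn ?mulr0 ?addr0 //.
by rewrite -addn1 natrD j0 add0r oner_eq0.
Qed.

(** All exponents in P are divisible by p and all its coefficients are p-th powers
    in the ring; their roots lie in B because B is closed under roots. *)
Lemma lift_D_root p P : p \in [pchar K] -> (forall a : K, exists b, b ^+ p = a) ->
  polyIn B P -> (forall i, lift_D i P = 0) -> exists2 Q, polyIn B Q & P = Q ^+ p.
Proof.
move=> pK perf hP /(lift_D_const hP) [P0 DP].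
have p_gt0 := prime_gt0 (pcharf_prime pK).
pose rt j := sval (cid (Dconst_root pK perf (DP j))).
have rtE j : rt j ^+ p = P`_j by rewrite /rt; case: cid.
have rt0 j : P`_j = 0 -> rt j = 0 by rewrite -rtE; apply: (frob_eq0 pK).
pose Q := \poly_(j < size P) rt (p * j)%N.
have QE j : Q`_j = rt (p * j)%N.
  rewrite coef_poly; case: ltnP => // jP; rewrite rt0 // nth_default //.
  by apply: leq_trans jP _; apply: leq_pmull.
exists Q => [j|]; first by rewrite QE; apply: (good_root hB pK); rewrite rtE.
apply/polyP => j; case: (boolP (p %| j)%N) => pj; last first.
  by rewrite (poly_frob_coef0 pK) // P0 // -(dvdn_pcharf pK).
by rewrite -(divnK pj) mulnC (poly_frob_coef pK) QE rtE.
Qed.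

(** Weighted homogeneity, where X has the degree d of x. *)
Definition whomog e P : Prop := forall j m, P`_j m <> 0 -> (mdeg m + j * d)%N = e.

(** Induction on the weight e.  The derivations lift_D i turn a relation into
    relations of smaller weight, so they kill it.  Then P is a scalar in
    characteristic 0, and a p-th power in characteristic p, whose root is a
    relation of weight e / p. *)
Lemma step_transc_hom e P : whomog e P -> polyIn B P -> P.[x] = 0 -> P = 0.
Proof.
elim/ltn_ind: e P => e IH P wP hP Px0.
have constP : (forall j, P`_j <> 0 -> j = 0%N) -> P = 0.
  move=> h; have PE : P = (P`_0)%:P.
    apply/polyP => -[|j]; rewrite coefC //=; apply: contrapT => Pj; by have := h _ Pj.
  by move: Px0; rewrite PE hornerC => ->.
have nz f : f <> 0 -> exists m, f m <> 0.
  move=> f0; apply: contrapT => h; apply: f0; apply: serP => m; apply: contrapT => fm.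
  by apply: h; exists m.
case: (posnP e) => [e0|e0].
  apply: constP => j /nz [m /wP]; rewrite e0 => /eqP; rewrite addn_eq0 muln_eq0.
  by rewrite (gtn_eqF d_gt0) orbF => /andP[_ /eqP].
have DX0 i : lift_D i P = 0.
  apply: (IH e.-1); rewrite ?ltn_predL //; first last.
  - by rewrite -D_horner Px0 raddf0.
  - exact: lift_D_polyIn.
  move=> j m; rewrite lift_D_coef serDE => h.
  case: (eqVneq (D i P`_j m) 0) => [D0|/eqP /D_neq0 /wP]; last first.
    by rewrite mdegM mdeg_mpow => <-.
  rewrite D0 add0r in h; have [a [b [<- /D_neq0 xa]]] := sermul_neq0 h.
  rewrite serMnE => Pb; have /wP <- : P`_j.+1 b <> 0 by move=> e1; apply: Pb; rewrite e1 mul0rn.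
  have <- : (mdeg (mmul (mpow i 1) a)) = d by apply: hx; apply/eqP.
  by rewrite !mdegM mdeg_mpow; nia.
case: perfK => [ch0|[p pK perf]].
  have [P0 _] := lift_D_const hP DX0; apply: constP => j Pj; apply: contrapT => j0; apply: Pj.
  by apply: P0; move/pcharf0P: ch0 => ->; apply/eqP.
have [Q hQ PQ] := lift_D_root pK perf hP DX0.
have p_gt0 := prime_gt0 (pcharf_prime pK); have p_gt1 := prime_gt1 (pcharf_prime pK).
suff Q0 : Q = 0 by rewrite PQ Q0 expr0n gtn_eqF.
apply: (IH (e %/ p)%N) => //; first exact: ltn_Pdiv.
- move=> j m /eqP /(frob_coef_neq0 pK) Qj.
  have /wP <- : P`_(p * j) (mscale p m) <> 0 by rewrite PQ (poly_frob_coef pK); apply/eqP.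
  by rewrite (mdeg_mscale K) -mulnA -mulnDr mulKn.
- by apply: (frob_eq0 pK); rewrite -horner_exp -PQ.
Qed.

(** Every weighted component of a relation is a relation. *)
Lemma step_transc : transc B x.
Proof.
move=> P hP Px0.
pose C e : {poly R} := \poly_(j < size P) (if (j * d <= e)%N then hcomp (e - j * d) P`_j else 0).
have CE e j : (C e)`_j = if (j * d <= e)%N then hcomp (e - j * d) P`_j else 0.
  by rewrite coef_poly; case: ltnP => // /(nth_default _) ->; rewrite raddf0 if_same.
have C0 e : C e = 0.
  apply: (@step_transc_hom e).
  - move=> j m; rewrite CE; case: leqP => // je; rewrite hcompE.
    by case: eqP => // -> _; rewrite subnK.
  - move=> j; rewrite CE; case: ifP => _; [exact: (good_hcomp hB) | exact: subalg0].
  - have <- : hcomp e P.[x] = (C e).[x]; last by rewrite Px0 raddf0.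
    rewrite horner_coef raddf_sum horner_poly; apply: eq_bigr => j _ /=.
    case: leqP => je; last by rewrite mul0r (hcomp_homM_lt _ (@homX _ _ _ j hx)).
    by rewrite -{1}(subnK je) hcomp_homM //; apply: homX.
apply/polyP => j; rewrite coef0; have [n hn] := dle_ex P`_j; apply: (hcomp_eq0 hn) => k.
have := congr1 (fun Q : {poly R} => Q`_j) (C0 (k + j * d)%N).
by rewrite /= CE leq_addl addnK coef0.
Qed.

(** The p-th power of f is killed by the derivations, so by transcendence of x the
    polynomial over B that represents it is killed by their lifts and is a p-th
    power itself. *)
Lemma step_root p f : p \in [pchar K] -> adjoin B x (f ^+ p) -> adjoin B x f.
Proof.
move=> pK [P hP fP]; case: perfK => [ch0|[q qK perf]]; first by rewrite ch0 in pK.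
have qp : q = p by move: qK; rewrite (pcharf_eq pK) inE => /eqP.
subst q; have DX0 i : lift_D i P = 0.
  apply: step_transc; first exact: lift_D_polyIn.
  by rewrite -D_horner -fP; apply: Dconst_frob.
have [Q hQ PQ] := lift_D_root pK perf hP DX0.
exists Q => //; apply: (frob_inj pK); by rewrite fP PQ horner_exp.
Qed.
End Step.
End Subalgebras.

(** * Algebraically independent homogeneous elements *)
Section Towers.
Variable K : fieldType.
Local Notation R := (bdseries K).
Local Notation hom := (@homogeneous_of_degree K).
Implicit Types (f g h x z : R) (S B J : R -> Prop) (P Q : {poly R}) (d i j k : nat) (l : seq R).

Hypothesis perfK : perfect_field K.

(** All homogeneous elements of degree less than d, with finitely many more of
    degree d.  Taking all lower degrees at once makes the choices in different
    degrees independent of each other. *)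
Definition gens d l z : Prop := homlt d z \/ z \in l.

Fixpoint chain d l : Prop :=
  if l is x :: l' then [/\ chain d l', hom d x & ~ alg (gens d l') x] else True.

Lemma chain_hom d l : chain d l -> forall z, z \in l -> hom d z.
Proof.
elim: l => // x l IH [cl hx _] z; rewrite inE => /orP[/eqP -> //|]; exact: IH.
Qed.

Lemma algE d x l f : alg (gens d (x :: l)) f <-> adjoin (alg (gens d l)) x f.
Proof.
rewrite -alg_adjoin; split; apply: alg_mono => z; rewrite /gens inE.
  by case=> [|/orP[/eqP|]]; tauto.
by case=> [[hz|zl]|->]; [left|right|right]; rewrite ?zl ?eqxx ?orbT.
Qed.

Lemma hom_const f : hom 0 f -> exists c, f = c%:A.
Proof. by move=> /hom0P ->; eexists. Qed.

Lemma alg_hcomp S : (forall z, S z -> exists d, hom d z) ->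
  forall f, alg S f -> forall k, alg S (hcomp k f).
Proof.
move=> hS; have sS := alg_subalg S.
have hom_ok z d k : alg S z -> hom d z -> alg S (hcomp k z).
  move=> Sz hz; case: (eqVneq k d) => [->|/eqP kd]; first by rewrite hcomp_id.
  by rewrite (hcomp_other hz) //; apply: subalg0.
move=> f; elim=> {f} [c|z Sz|f g _ IHf _ IHg|f g _ IHf _ IHg] k.
- by apply: (hom_ok _ 0%N k (alg_const S c)); apply: homC.
- by have [d hz] := hS z Sz; apply: (hom_ok _ d k (alg_gen Sz)).
- by rewrite raddfD; apply: alg_add; [apply: IHf | apply: IHg].
- have [D hD] := dle_ex g; rewrite (hcomp_sum hD) mulr_sumr raddf_sum.
  apply: subalg_sum => // j _; rewrite /=; case: (leqP j k) => jk.
    have -> : hcomp k (f * hcomp j g) = hcomp (k - j) f * hcomp j g.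
      by rewrite -{1}(subnK jk); apply: hcomp_homM; apply: hom_hcomp.
    by apply: alg_mul; [apply: IHf | apply: IHg].
  by rewrite (hcomp_homM_lt _ (@hom_hcomp _ j g)) //; apply: subalg0.
Qed.

Lemma alg_taylor S :
  (forall z, S z -> forall i k, (0 < k)%N -> alg S (taylor i z)`_k) ->
  forall f, alg S f -> forall i k, alg S (taylor i f)`_k.
Proof.
move=> hS; have sS := alg_subalg S.
move=> f; elim=> {f} [c|z Sz|f g _ IHf _ IHg|f g _ IHf _ IHg] i k.
- by rewrite taylorC; apply: polyInC => //; apply: alg_const.
- by case: k => [|k]; [rewrite taylor0; apply: alg_gen | apply: hS].
- by rewrite rmorphD coefD; apply: alg_add; [apply: IHf | apply: IHg].
- rewrite rmorphM coefM; apply: subalg_sum => // j _.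
  by apply: alg_mul; [apply: IHf | apply: IHg].
Qed.

Lemma gens_taylor d l : (forall z, z \in l -> hom d z) ->
  forall z, gens d l z -> forall i k, (0 < k)%N -> alg (gens d l) (taylor i z)`_k.
Proof.
move=> hl z hz i k k0.
have [e ed hz'] : exists2 e, (e <= d)%N & hom e z.
  by case: hz => [[e /ltnW]|/hl]; [exists e | exists d].
case: (posnP e) => [e0|e0].
  move: hz'; rewrite e0 => /hom_const [c ->]; rewrite taylorC coefC gtn_eqF //.
  by apply: subalg0; apply: alg_subalg.
have [e' e'e he'] := taylor_homlt i hz' k0 e0.
by apply: alg_gen; left; exists e' => //; apply: leq_trans ed.
Qed.

Lemma gens_good d l : (0 < d)%N -> (forall z, z \in l -> hom d z) ->
  (forall p f, p \in [pchar K] -> alg (gens d l) (f ^+ p) -> alg (gens d l) f) ->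
  good d (alg (gens d l)).
Proof.
move=> d0 hl hroot; split=> //.
- exact: alg_subalg.
- move=> k f hf; apply: alg_hcomp => // z [[e _ hz]|/hl hz]; by [exists e | exists d].
- by move=> i k f hf; apply: alg_taylor => //; apply: gens_taylor.
- by move=> f hf; apply: alg_gen; left.
Qed.

Lemma chain_good_of d l : (0 < d)%N -> good d (alg (gens d [::])) -> chain d l ->
  good d (alg (gens d l)).
Proof.
move=> d0 g0; elim: l => // x l IH [cl hx xl]; have gl := IH cl.
apply: gens_good => // [|p f pK].
  by move=> z; rewrite inE => /orP[/eqP -> //|]; apply: chain_hom.
rewrite !algE; exact: (step_root perfK d0 gl hx xl).
Qed.

(** Go through l0 and adjoin those elements that are not yet generated. *)
Lemma chain_ext d l l0 : chain d l -> (forall z, z \in l0 -> hom d z) ->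
  exists2 l', chain d l' & (forall z, z \in l -> z \in l') /\
    forall z, z \in l0 -> alg (gens d l') z.
Proof.
move=> cl; elim: l0 => [|x l0 IH] hl0; first by exists l.
have [|l' cl' [ll' l0l']] := IH; first by move=> z zl; apply: hl0; rewrite inE zl orbT.
have hx : hom d x by apply: hl0; rewrite inE eqxx.
case: (pselect (alg (gens d l') x)) => xl'.
  exists l' => //; split=> // z; rewrite inE => /orP[/eqP -> //|]; exact: l0l'.
exists (x :: l') => //; split=> z; first by rewrite inE => /ll' ->; rewrite orbT.
rewrite inE => /orP[/eqP ->|/l0l'].
  by apply: alg_gen; right; rewrite inE eqxx.
apply: alg_mono => u [|ul]; [by left | by right; rewrite inE ul orbT].
Qed.

Lemma alg_homlt_fin d f : alg (gens d.+1 [::]) f ->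
  exists2 l, (forall z, z \in l -> hom d z) & alg (gens d l) f.
Proof.
elim=> {f} [c|z|f g _ [l1 h1 a1] _ [l2 h2 a2]|f g _ [l1 h1 a1] _ [l2 h2 a2]].
- by exists [::] => //; apply: alg_const.
- case=> [[e]|//]; rewrite ltnS leq_eqVlt => /orP[/eqP -> hz|ed hz].
    exists [:: z] => [u|]; first by rewrite inE => /eqP ->.
    by apply: alg_gen; right; rewrite inE.
  by exists [::] => //; apply: alg_gen; left; exists e.
all: exists (l1 ++ l2) => [z|]; first by rewrite mem_cat => /orP[/h1|/h2].
all: have [m1 m2] : alg (gens d (l1 ++ l2)) f /\ alg (gens d (l1 ++ l2)) g by
  split; [apply: alg_mono a1 | apply: alg_mono a2] => u [|ul]; [by left | right | by left | right];
  rewrite mem_cat ul ?orbT.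
  exact: alg_add.
exact: alg_mul.
Qed.

(** Only closure under p-th roots needs an argument, by induction on d.  A
    given f ^ p involves finitely many generators of the top degree; they lie in
    the subalgebra of a chain over the lower degrees, and step_root shows that such
    a subalgebra contains f. *)
Lemma good_homlt d : (0 < d)%N -> good d (alg (gens d [::])).
Proof.
case: d => // d _; elim: d => [|d IH].
  apply: gens_good => // p f pK hf.
  have p_gt0 := prime_gt0 (pcharf_prime pK).
  have {hf} h0 : hom 0 (f ^+ p).
    elim: hf => {f} [c|z|f g _ hf _ hg|f g _ hf _ hg].
    - exact: homC.
    - by case=> [[e]|//]; rewrite ltnS leqn0 => /eqP ->.
    - exact: homD.
    - exact: (homM hf hg).
  have [c ->] : exists c, f = c%:A; last exact: alg_const.
  apply: hom_const => m /(frob_coef_neq0 pK) /h0 /eqP.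
  by rewrite (mdeg_mscale K) muln_eq0 gtn_eqF //= => /eqP.
apply: gens_good => // p f pK /alg_homlt_fin [l0 hl0 hf].
have [//|l cl [_ ll]] := @chain_ext d.+1 [::] l0 _ hl0.
have hf' : alg (gens d.+1 l) (f ^+ p).
  apply: alg_min hf; first exact: alg_subalg.
  by move=> z [hz|/ll //]; apply: alg_gen; left.
have := good_root (chain_good_of (ltn0Sn d) IH cl) pK hf'.
apply: alg_mono => z [[e ed hz]|/(chain_hom cl) hz]; left; [exists e | exists d.+1] => //.
exact: ltnW.
Qed.

Lemma chain_good d l : (0 < d)%N -> chain d l -> good d (alg (gens d l)).
Proof. by move=> d0; apply: chain_good_of => //; apply: good_homlt. Qed.

Lemma chain_transc d x l : (0 < d)%N -> chain d (x :: l) -> transc (alg (gens d l)) x.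
Proof. by move=> d0 [cl hx xl]; apply: (step_transc perfK d0 (chain_good d0 cl) hx xl). Qed.

Definition span_of l z : Prop := z \in l.

Fixpoint tower l : Prop :=
  if l is x :: l' then tower l' /\ transc (alg (span_of l')) x else True.

Lemma transc_sub B B' x : (forall f, B f -> B' f) -> transc B' x -> transc B x.
Proof. by move=> h t P hP; apply: t => j; apply: h. Qed.

(** A family chooses finitely many new generators in each degree.  It is enlarged
    repeatedly, one degree at a time; only the generators of degree at most n, in
    the list flat e n, form a concrete tower. *)
Definition family := nat -> seq R.
Definition good_family (e : family) : Prop :=
  e 0%N = [::] /\ forall d, chain d (e d).

Fixpoint flat (e : family) n : seq R := if n is n'.+1 then e n ++ flat e n' else [::].

Lemma mem_flat (e : family) n z : z \in flat e n <-> exists2 d, (0 < d <= n)%N & z \in e d.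
Proof.
elim: n => [|n IH] /=; first by split=> // -[[|d]].
rewrite mem_cat; split.
  case/orP => [zn|/IH [d /andP[d0 dn] zd]]; first by exists n.+1; rewrite ?leqnn.
  by exists d => //; rewrite d0 ltnW.
case=> d /andP[d0]; rewrite leq_eqVlt => /orP[/eqP -> ->//|dn zd].
by apply/orP; right; apply/IH; exists d; rewrite ?d0.
Qed.

Lemma flat_tower e n : good_family e -> tower (flat e n).
Proof.
case=> e0 ce; elim: n => [//|n IH] /=.
have := ce n.+1; have sub : forall z, z \in flat e n -> homlt n.+1 z.
  move=> z /mem_flat [d /andP[_ dn] zd]; exists d => //; exact: (chain_hom (ce d)).
elim: (e n.+1) => [//|x l IHl] c /=; split; first by apply: IHl; case: c.
apply: transc_sub (chain_transc (ltn0Sn n) c); apply: alg_mono => z.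
by rewrite /span_of mem_cat => /orP[zl|/sub ?]; [right | left].
Qed.

Definition in_family (e : family) z : Prop := exists d, z \in e d.
Definition subfamily (e e' : family) : Prop := forall d z, z \in e d -> z \in e' d.

Lemma subfamily_alg e e' f : subfamily e e' -> alg (in_family e) f -> alg (in_family e') f.
Proof. by move=> h; apply: alg_mono => z [d /h zd]; exists d. Qed.

(** If f is not generated by the lower degrees and the generators chosen in its
    degree, it becomes a new generator.  Otherwise f is a polynomial in chosen
    generators and in homogeneous elements of smaller degree, which are brought
    into the family by induction. *)
Lemma hom_family d e f : good_family e -> hom d f ->
  exists2 e', good_family e' & subfamily e e' /\ alg (in_family e') f.
Proof.
elim/ltn_ind: d e f => d IH e f he hf.
case: (posnP d) => [d0|d0].
  exists e => //; split=> //; move: hf; rewrite d0 => /hom_const [c ->].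
  exact: alg_const.
case: (pselect (alg (gens d (e d)) f)) => [af|naf]; last first.
  exists (fun k => if k == d then f :: e d else e k).
    case: he => e0 ce; split=> [|k]; first by rewrite ltn_eqF.
    by case: eqP => [->|] //.
  split=> [k z|]; first by case: eqP => [->|//]; rewrite inE => ->; rewrite orbT.
  by apply: alg_gen; exists d; rewrite eqxx inE eqxx.
suff: forall e0, good_family e0 -> subfamily e e0 ->
    exists2 e', good_family e' & subfamily e0 e' /\ alg (in_family e') f by exact.
elim: af => {f hf} [c|z zg|f g _ IHf _ IHg|f g _ IHf _ IHg] e0 he0 ee0.
- by exists e0 => //; split=> //; apply: alg_const.
- case: zg => [[k kd hz]|zd]; first exact: (IH k kd).
  by exists e0 => //; split=> //; apply: alg_gen; exists d; apply: ee0.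
all: have [e1 he1 [e01 a1]] := IHf _ he0 ee0.
all: have [|e2 he2 [e12 a2]] := IHg e1 he1; first by move=> k z /ee0 /e01.
all: exists e2 => //; split; first by move=> k z /e01 /e12.
  by apply: alg_add => //; apply: subfamily_alg a1.
by apply: alg_mul => //; apply: subfamily_alg a1.
Qed.

Lemma seq_family e (fs : seq R) : good_family e ->
  exists2 e', good_family e' & subfamily e e' /\ forall f, f \in fs -> alg (in_family e') f.
Proof.
elim: fs e => [|f fs IH] e he; first by exists e => //; split.
have [n hn] := dle_ex f.
have [e1 he1 [ee1 a1]] : exists2 e', good_family e' & subfamily e e' /\
    alg (in_family e') (\sum_(k < n.+1) hcomp k f).
  elim: n.+1 => [|k [e1 he1 [ee1 a1]]].
    exists e => //; split=> //; rewrite big_ord0; apply: subalg0; exact: alg_subalg.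
  have [e2 he2 [e12 a2]] := hom_family he1 (@hom_hcomp _ k f).
  exists e2 => //; split; first by move=> d z /ee1 /e12.
  by rewrite big_ord_recr /=; apply: alg_add => //; apply: subfamily_alg a1.
have [e2 he2 [e12 a2]] := IH e1 he1.
exists e2 => //; split; first by move=> d z /ee1 /e12.
move=> g; rewrite inE => /orP[/eqP ->|/a2 //].
by rewrite (hcomp_sum hn); apply: subfamily_alg a1.
Qed.

Lemma alg_flat e (fs : seq R) : good_family e -> (forall f, f \in fs -> alg (in_family e) f) ->
  forall n0, exists2 n, (n0 <= n)%N & forall f, f \in fs -> alg (span_of (flat e n)) f.
Proof.
move=> [e0 ce] h n0.
have mono n n' f : (n <= n')%N -> alg (span_of (flat e n)) f -> alg (span_of (flat e n')) f.
  move=> nn'; apply: alg_mono => z /mem_flat [d /andP[d0 dn] zd]; apply/mem_flat; exists d => //.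
  by rewrite d0 (leq_trans dn).
have one f : alg (in_family e) f -> exists n, alg (span_of (flat e n)) f.
  elim=> {f} [c|z [d zd]|f g _ [n1 a1] _ [n2 a2]|f g _ [n1 a1] _ [n2 a2]].
  - by exists 0%N; apply: alg_const.
  - exists d; apply: alg_gen; apply/mem_flat; exists d => //.
    by rewrite leqnn andbT lt0n; apply/eqP => d0; rewrite d0 e0 in zd.
  - exists (maxn n1 n2); apply: alg_add.
      exact: mono (leq_maxl n1 n2) a1.
    exact: mono (leq_maxr n1 n2) a2.
  - exists (maxn n1 n2); apply: alg_mul.
      exact: mono (leq_maxl n1 n2) a1.
    exact: mono (leq_maxr n1 n2) a2.
elim: fs h => [|f fs IH] h; first by exists n0.
have [|n n0n hn] := IH; first by move=> g gf; apply: h; rewrite inE gf orbT.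
have [|n1 h1] := one f; first by apply: h; rewrite inE eqxx.
exists (maxn n n1); first by apply: leq_trans n0n (leq_maxl _ _).
move=> g; rewrite inE => /orP[/eqP ->|/hn].
  exact: mono (leq_maxr n n1) h1.
exact: mono (leq_maxl n n1).
Qed.

(** * Towers are regular sequences *)
(** Linear combinations of elements of J with coefficients in a subalgebra B: the
    ideal generated by J is seen both in the whole ring and in a subring. *)
Inductive lincomb B J : R -> Prop :=
| lincomb0 : lincomb B J 0
| lincombD b z f : B b -> J z -> lincomb B J f -> lincomb B J (b * z + f).

Lemma lincomb_add B J f g : lincomb B J f -> lincomb B J g -> lincomb B J (f + g).
Proof.
by move=> hf hg; elim: hf => [|b z h Bb Jz _ IH]; rewrite ?add0r // -addrA; apply: lincombD.
Qed.

Lemma lincomb_gen B J b z : B b -> J z -> lincomb B J (b * z).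
Proof. by move=> Bb Jz; rewrite -[b * z]addr0; apply: lincombD => //; apply: lincomb0. Qed.

Lemma lincomb_mul B J a f : subalg B -> B a -> lincomb B J f -> lincomb B J (a * f).
Proof.
move=> sB Ba; elim=> [|b z h Bb Jz _ IH]; first by rewrite mulr0; apply: lincomb0.
by rewrite mulrDr mulrA; apply: lincombD => //; apply: (subalg_mul sB).
Qed.

Lemma lincomb_sum B J I r (p : pred I) (F : I -> R) :
  (forall u, p u -> lincomb B J (F u)) -> lincomb B J (\sum_(u <- r | p u) F u).
Proof. by move=> h; elim/big_ind: _ => //; [apply: lincomb0 | apply: lincomb_add]. Qed.

Lemma lincomb_mono B B' J J' f : (forall b, B b -> B' b) -> (forall z, J z -> J' z) ->
  lincomb B J f -> lincomb B' J' f.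
Proof. by move=> hB hJ; elim=> [|b z h /hB Bb /hJ Jz _ IH]; [apply: lincomb0 | apply: lincombD]. Qed.

Lemma lincomb_in_alg S J f : (forall z, J z -> alg S z) -> lincomb (alg S) J f -> alg S f.
Proof.
move=> hJ; elim=> [|b z h Bb /hJ Jz _ IH]; first by apply: subalg0; apply: alg_subalg.
by apply: alg_add => //; apply: alg_mul.
Qed.

Lemma alg_span_cons x l f : alg (span_of (x :: l)) f <-> adjoin (alg (span_of l)) x f.
Proof.
rewrite -alg_adjoin; split; apply: alg_mono => z; rewrite /span_of inE.
  by case/orP => [/eqP|]; tauto.
by case=> [|->]; rewrite ?eqxx ?orbT // => ->; rewrite orbT.
Qed.

(** Over B with x transcendental, an ideal generated by elements of B consists of
    the polynomials in x all of whose coefficients lie in the ideal. *)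
Lemma lincomb_poly x l J P : transc (alg (span_of l)) x -> (forall z, J z -> alg (span_of l) z) ->
  polyIn (alg (span_of l)) P ->
  lincomb (alg (span_of (x :: l))) J P.[x] <-> forall j, lincomb (alg (span_of l)) J P`_j.
Proof.
move=> tx hJ hP; set B := alg (span_of l); have sB : subalg B by apply: alg_subalg.
split=> [h j|h]; last first.
  rewrite horner_coef; apply: lincomb_sum => j _; rewrite mulrC; apply: lincomb_mul.
  - exact: alg_subalg.
  - apply: subalgX; [exact: alg_subalg | apply: alg_gen; rewrite /span_of inE eqxx //].
  - apply: lincomb_mono (h j) => // b; apply: alg_mono => z; rewrite /span_of inE => ->.
    by rewrite orbT.
have [Q hQ QE] : exists2 Q : {poly R}, (forall j, lincomb B J Q`_j) & P.[x] = Q.[x].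
  elim: h => [|b z f Bb Jz _ [Q hQ ->]].
    by exists 0 => [i|]; rewrite ?horner0 ?coef0 //; apply: lincomb0.
  have [b' hb' ->] := (alg_span_cons x l b).1 Bb.
  exists (b' * z%:P + Q); last by rewrite hornerD hornerM hornerC.
  by move=> i; rewrite coefD coefMC; apply: lincombD.
suff -> : P = Q by apply: hQ.
apply/eqP; rewrite -subr_eq0; apply/eqP/tx; last by rewrite hornerD hornerN QE subrr.
by move=> i; rewrite coefB; apply: subalgB => //; apply: lincomb_in_alg (hQ i).
Qed.

(** Multiples of the generator x absorb all coefficients except the constant one. *)
Lemma lincomb_poly0 x l J P : transc (alg (span_of l)) x -> J x -> 
  (forall z, J z -> z \in x :: l) -> polyIn (alg (span_of l)) P ->
  lincomb (alg (span_of (x :: l))) J P.[x] <->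
  lincomb (alg (span_of l)) (fun z => J z /\ z <> x) P`_0.
Proof.
move=> tx Jx hJ hP; set B := alg (span_of l); have sB : subalg B by apply: alg_subalg.
have sB' := alg_subalg (span_of (x :: l)).
have BB' b : B b -> alg (span_of (x :: l)) b.
  by apply: alg_mono => z; rewrite /span_of inE => ->; rewrite orbT.
have hJ' z : J z -> z <> x -> B z.
  by move=> /hJ; rewrite inE => /orP[/eqP|zl _] //; apply: alg_gen.
split=> h; last first.
  have -> : P.[x] = (\poly_(j < (size P).-1) P`_j.+1).[x] * x + P`_0.
    rewrite horner_coef horner_poly; case sP: (size P) => [|n].
      by rewrite !big_ord0 mul0r add0r nth_default // sP.
    rewrite big_ord_recl expr0 mulr1 addrC; congr (_ + _).
    by rewrite mulr_suml; apply: eq_bigr => j _; rewrite lift0 exprSr mulrA.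
  apply: lincombD => //; last by apply: lincomb_mono h => // z [].
  apply/alg_span_cons; exists (\poly_(j < (size P).-1) P`_j.+1) => // j.
  by rewrite coef_poly; case: ifP => _; [apply: hP | apply: subalg0].
have [Q [hQ hQ0] QE] : exists2 Q : {poly R}, polyIn B Q /\ lincomb B (fun z => J z /\ z <> x) Q`_0 & P.[x] = Q.[x].
  elim: h => [|b z f Bb Jz _ [Q [hQ hQ0] ->]].
    exists 0; rewrite ?horner0 //; split=> [i|]; rewrite coef0; [exact: subalg0 | exact: lincomb0].
  have [b' hb' ->] := (alg_span_cons x l b).1 Bb.
  case: (pselect (z = x)) => [->|zx].
    exists (b' * 'X + Q); last by rewrite hornerD hornerMX.
    split=> [i|]; rewrite coefD coefMX ?add0r //.
    by apply: (subalg_add sB) => //; case: eqP => _; [apply: subalg0 | apply: hb'].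
  exists (b' * z%:P + Q); last by rewrite hornerD hornerM hornerC.
  split=> [i|]; rewrite coefD coefMC; last by apply: lincombD.
  by apply: (subalg_add sB) => //; apply: (subalg_mul sB) => //; apply: hJ'.
suff -> : P = Q by [].
apply/eqP; rewrite -subr_eq0; apply/eqP/tx; last by rewrite hornerD hornerN QE subrr.
by move=> i; rewrite coefB; apply: subalgB; [|apply: hP|apply: hQ].
Qed.

(** This is the case of variables in a polynomial ring.  Membership in the ideal is
    read off from the coefficients in the top element of the tower, where the
    induction hypothesis applies. *)
Lemma tower_regular l J t h : tower l -> (forall z, J z -> z \in l) -> t \in l -> ~ J t ->
  alg (span_of l) h -> lincomb (alg (span_of l)) J (h * t) -> lincomb (alg (span_of l)) J h.
Proof.
elim: l J t h => [//|x l IH] J t h [tl tx] hJ tx_l Jt /alg_span_cons [P hP ->] ht.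
set B := alg (span_of l); have sB : subalg B by apply: alg_subalg.
have Bl z : z \in l -> B z by move=> zl; apply: alg_gen.
case: (pselect (J x)) => Jx.
  have tx' : t <> x by move=> e; apply: Jt; rewrite e.
  have tl' : t \in l by move: tx_l; rewrite inE => /orP[/eqP|].
  apply/(lincomb_poly0 tx Jx hJ hP); apply: (IH _ t) => //.
  - by move=> z [/hJ]; rewrite inE => /orP[/eqP|].
  - by case.
  rewrite (_ : P`_0 * t = (P * t%:P)`_0); last by rewrite coefMC.
  apply/(lincomb_poly0 tx Jx hJ).
    by apply: polyInM => //; apply: polyInC => //; apply: Bl.
  by rewrite hornerM hornerC.
have hJl z : J z -> z \in l.
  by move=> Jz; have := hJ z Jz; rewrite inE => /orP[/eqP zx|//]; rewrite zx in Jz.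
have hJB z : J z -> B z by move=> /hJl /Bl.
apply/(lincomb_poly tx hJB hP) => j; case: (pselect (t = x)) => [e|tx'].
  have -> : P`_j = (P * 'X)`_j.+1 by rewrite coefMX.
  have hPX : polyIn B (P * 'X) by apply: polyInM => //; apply: polyInX.
  by move: ht; rewrite e -hornerMX => /(lincomb_poly tx hJB hPX) ht; apply: ht.
have tl' : t \in l by move: tx_l; rewrite inE => /orP[/eqP|].
apply: (IH _ t) => //; rewrite (_ : P`_j * t = (P * t%:P)`_j); last by rewrite coefMC.
have hPt : polyIn B (P * t%:P) by apply: polyInM => //; apply: polyInC => //; apply: Bl.
by move: j; apply/(lincomb_poly tx hJB hPt); rewrite hornerM hornerC.
Qed.

Definition ideal_of l := lincomb (fun=> True) (span_of l).

(** A relation h x in (l2) has coefficients in the whole ring.  The family can be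
    enlarged until these coefficients and h are polynomials in a tower that still
    contains the given generators; there the claim is tower_regular. *)
Theorem good_family_regular e n l1 x l2 h : good_family e -> flat e n = l1 ++ x :: l2 ->
  ideal_of l2 (h * x) -> ideal_of l2 h.
Proof.
move=> he fe hx.
have tw := flat_tower n he; rewrite fe in tw.
have xl2 : ~ x \in l2.
  have : tower (x :: l2) by elim: l1 tw {fe} => // y l IH [/IH].
  case=> _ tx xl; have P0 : ('X - x%:P : {poly R}) = 0.
    apply: tx; last by rewrite !hornerE subrr.
    move=> j; rewrite coefB; apply: subalgB; first exact: alg_subalg.
      by apply: polyInX; apply: alg_subalg.
    by apply: polyInC; [apply: alg_subalg | apply: alg_gen].
  by have := size_XsubC x; rewrite P0 size_poly0.
(* cs collects the finitely many coefficients in a relation for h x *)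
have [cs hcs] : exists cs : seq R, forall B, (forall b, b \in cs -> B b) -> lincomb B (span_of l2) (h * x).
  elim: hx => [|b z f _ Jz _ [cs hcs]]; first by exists [::] => B _; apply: lincomb0.
  exists (b :: cs) => B hB; apply: lincombD => //; first by apply: hB; rewrite inE eqxx.
  by apply: hcs => c ccs; apply: hB; rewrite inE ccs orbT.
have [e' he' [ee' acs]] := seq_family (h :: cs) he.
have [n' nn' hn'] := alg_flat he' acs n.
have sub z : z \in flat e n -> z \in flat e' n'.
  move=> /mem_flat [d /andP[d0 dn] /ee' zd]; apply/mem_flat; exists d => //.
  by rewrite d0 (leq_trans dn).
have := @tower_regular (flat e' n') (span_of l2) x h (flat_tower n' he').
move=> /(_ _ _ xl2 _ _) H.
apply: lincomb_mono (H _ _ _ _) => //.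
- by move=> z zl; apply: sub; rewrite fe mem_cat inE (_ : z \in l2) ?orbT.
- by apply: sub; rewrite fe mem_cat inE eqxx orbT.
- by apply: hn'; rewrite inE eqxx.
- by apply: hcs => b bcs; apply: hn'; rewrite inE bcs orbT.
Qed.
End Towers.

(** * Quotients as retracts of finite free modules *)
Section Retractions.
Import Pdiv.Ring.
Variable R : comNzRingType.
Implicit Types (r s g h : R) (J N : R -> Prop).

Record isIdeal (T : comNzRingType) (J : T -> Prop) : Prop := IsIdeal {
  isIdeal0 : J 0;
  isIdealD : forall r s : T, J r -> J s -> J (r + s);
  isIdealM : forall a r : T, J r -> J (a * r) }.

Lemma isIdealN (T : comNzRingType) (J : T -> Prop) (r : T) : isIdeal J -> J r -> J (- r).
Proof. by move=> hJ Jr; rewrite -mulN1r; apply: isIdealM. Qed.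

Lemma isIdealB (T : comNzRingType) (J : T -> Prop) (r s : T) : isIdeal J -> J r -> J s -> J (r - s).
Proof. by move=> hJ Jr Js; apply: isIdealD => //; apply: isIdealN. Qed.

Lemma isIdeal_sum (T : comNzRingType) (J : T -> Prop) I q (p : pred I) (F : I -> T) :
  isIdeal J -> (forall u, p u -> J (F u)) -> J (\sum_(u <- q | p u) F u).
Proof. by move=> hJ h; elim/big_ind: _ => //; [apply: isIdeal0 | apply: isIdealD]. Qed.

Definition ideal_sum J N r : Prop := exists2 j, J j & N (r - j).

Definition ideal_adjoin J g r : Prop := exists a, J (r - a * g).

Lemma ideal_adjoin_ideal J g : isIdeal J -> isIdeal (ideal_adjoin J g).
Proof.
move=> hJ; split=> [|r s [a ha] [b hb]|a r [b hb]].
- by exists 0; rewrite mul0r subrr; apply: isIdeal0.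
- exists (a + b); rewrite mulrDl opprD addrACA; exact: isIdealD.
- by exists (a * b); rewrite -mulrA -mulrBr; apply: isIdealM.
Qed.

(** R / J is a direct summand, as a module over P, of a free module of rank k.
    A summand suffices for determinants and, unlike freeness, it is easily
    preserved when J grows by one element. *)
Record retraction (P : comNzRingType) (phi : {rmorphism P -> R}) J k
    (iota : R -> 'rV[P]_k) (sigma : 'rV[P]_k -> R) : Prop := Retraction {
  iotaD : forall r s, iota (r + s) = iota r + iota s;
  iotaZ : forall a r, iota (phi a * r) = a *: iota r;
  sigmaD : forall u v, sigma (u + v) = sigma u + sigma v;
  sigmaZ : forall a u, sigma (a *: u) = phi a * sigma u;
  iota0 : forall r, J r -> iota r = 0;
  sigma_iota : forall r, J (sigma (iota r) - r) }.

(** Compatibility with quotients: iota and phi pass to R / N and P / M.  It will be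
    used with N and M the series that vanish when all but finitely many variables
    are set to zero. *)
Definition continuous_retr (P : comNzRingType) (phi : P -> R) k (iota : R -> 'rV[P]_k)
    N (M : P -> Prop) : Prop :=
  (forall r, N r -> forall i, M (iota r 0 i)) /\ (forall a, M a -> N (phi a)).

Section Fixed.
Variables (P : comNzRingType) (phi : {rmorphism P -> R}) (J : R -> Prop) (k : nat).
Variables (iota : R -> 'rV[P]_k) (sigma : 'rV[P]_k -> R).
Hypotheses (hJ : isIdeal J) (hr : retraction phi J iota sigma).

Lemma iotaN r : iota (- r) = - iota r.
Proof. by rewrite -mulN1r -(rmorphN1 phi) (iotaZ hr) scaleN1r. Qed.

Lemma iotaB r s : iota (r - s) = iota r - iota s.
Proof. by rewrite (iotaD hr) iotaN. Qed.

Lemma iota_congr r s : J (r - s) -> iota r = iota s.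
Proof. by move=> /(iota0 hr) /eqP; rewrite iotaB subr_eq0 => /eqP. Qed.

Lemma iota_sigma_iota r : iota (sigma (iota r)) = iota r.
Proof. by apply: iota_congr; apply: (sigma_iota hr). Qed.

Lemma sigma0 : sigma 0 = 0.
Proof. by rewrite -[0 in LHS](scale0r 0) (sigmaZ hr) rmorph0 mul0r. Qed.

Lemma sigmaN u : sigma (- u) = - sigma u.
Proof. by rewrite -scaleN1r (sigmaZ hr) rmorphN1 mulN1r. Qed.

Lemma sigma_sum I q (p : pred I) (F : I -> 'rV[P]_k) :
  sigma (\sum_(u <- q | p u) F u) = \sum_(u <- q | p u) sigma (F u).
Proof.
elim/big_rec2: _ => [|i y x _ <-]; [exact: sigma0 | exact: (sigmaD hr)].
Qed.

(** The endomorphism iota \o sigma of the free module is idempotent.  Multiplication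
    by g on its image, which is R / J, is extended by the identity on the
    complement. *)
Definition extmul g (u : 'rV[P]_k) := iota (g * sigma u) + u - iota (sigma u).

Lemma extmulD g u v : extmul g (u + v) = extmul g u + extmul g v.
Proof.
rewrite /extmul (sigmaD hr) mulrDr !(iotaD hr).
by rewrite opprD [_ + (u + v)]addrACA [RHS]addrACA.
Qed.

Lemma extmulZ g a u : extmul g (a *: u) = a *: extmul g u.
Proof. by rewrite /extmul (sigmaZ hr) mulrCA !(iotaZ hr) scalerBr scalerDr. Qed.

Lemma extmul_mx g : exists G : 'M[P]_k, forall u, u *m G = extmul g u.
Proof.
exists (\matrix_(i < k) extmul g (delta_mx 0 i)) => u.
rewrite mulmx_sum_row {2}(row_sum_delta u).
have ext0 : extmul g 0 = 0 by rewrite -(scale0r 0) extmulZ !scale0r.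
under eq_bigr => i _ do rewrite rowK.
elim/big_rec2: _ => [//|i y x _ ->]; by rewrite extmulD extmulZ.
Qed.

Lemma extmul_iota g h : extmul g (iota h) = iota (g * h).
Proof.
rewrite /extmul iota_sigma_iota addrK; apply: iota_congr.
by rewrite -mulrBr; apply: (isIdealM hJ); apply: (sigma_iota hr).
Qed.

Lemma sigma_extmul g u : ideal_adjoin J g (sigma (extmul g u)).
Proof.
exists (sigma u); rewrite /extmul !(sigmaD hr) sigmaN.
have h1 := sigma_iota hr (g * sigma u); have h2 := isIdealN hJ (sigma_iota hr (sigma u)).
have := isIdealD hJ h1 h2; rewrite opprB [sigma u * g]mulrC.
by congr J; ring.
Qed.

(** The identity on the complement has no kernel, so a kernel vector comes from a
    class in R / J killed by g.  Hence the determinant is nonzero when g is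
    regular modulo J and P is a domain. *)
Lemma extmul_kernel g u : u != 0 -> extmul g u = 0 ->
  exists2 h, J (h * g) & ~ J h.
Proof.
move=> u0 eu.
have uE : u = iota (sigma u).
  have := congr1 (fun v => iota (sigma v)) eu.
  rewrite /extmul !(sigmaD hr) sigmaN !(iotaD hr) iotaN !iota_sigma_iota sigma0.
  rewrite (iota0 hr (isIdeal0 hJ)) addrK => e; move: eu.
  by rewrite /extmul e add0r => /eqP; rewrite subr_eq0 => /eqP.
exists (sigma u); last by move=> /(iota0 hr) e; rewrite uE e eqxx in u0.
have e : iota (g * sigma u) = 0 by rewrite -extmul_iota -uE.
have := isIdealN hJ (sigma_iota hr (g * sigma u)).
by rewrite e sigma0 sub0r opprK mulrC.
Qed.

(** Multiply by the adjugate: if g kills the class of h modulo J and N, then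
    det G kills iota h modulo M, and M is a prime that does not contain det G. *)
Lemma extmul_regular g G N M : (forall u, u *m G = extmul g u) ->
  isIdeal N -> isIdeal M -> (forall a b, M (a * b) -> M a \/ M b) -> ~ M (\det G) ->
  continuous_retr phi iota N M ->
  forall h, ideal_sum J N (h * g) -> ideal_sum J N h.
Proof.
move=> hG hN hM pM detM [cI cP] h [j Jj Nj].
have Mu i : M ((iota h *m G) 0 i).
  have e : iota (g * h) = iota (h * g - j).
    by apply: iota_congr; rewrite [g * h]mulrC opprB addrC subrK.
  by rewrite hG extmul_iota e; apply: cI.
have Mi i : M (iota h 0 i).
  have : M ((iota h *m (G *m \adj G)) 0 i).
    rewrite mulmxA mxE; apply: isIdeal_sum => // l _; rewrite mulrC; exact: isIdealM.
  by rewrite mul_mx_adj mul_mx_scalar mxE => /pM [].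
exists (h - sigma (iota h)).
  by rewrite -opprB; apply: isIdealN => //; apply: (sigma_iota hr).
rewrite opprB addrC subrK (row_sum_delta (iota h)) sigma_sum.
apply: isIdeal_sum => // i _; rewrite (sigmaZ hr) mulrC; apply: isIdealM => //.
exact: cP.
Qed.

End Fixed.

(** * Division by a monic polynomial *)
Section MonicDivision.
Variables (Q : comNzRingType) (d : {poly Q}).
Hypothesis mond : d \is monic.
Implicit Types (p q : {poly Q}).

Lemma rdivpD p q : rdivp (p + q) d = rdivp p d + rdivp q d.
Proof.
rewrite [p in LHS](Pdiv.RingMonic.rdivp_eq mond) [q in LHS](Pdiv.RingMonic.rdivp_eq mond).
rewrite addrACA -mulrDl Pdiv.RingMonic.rdivp_addl_mul_small //.
by apply: leq_ltn_trans (size_polyD _ _) _; rewrite gtn_max !ltn_rmodpN0 ?monic_neq0.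
Qed.

Lemma rdivpZ a p : rdivp (a *: p) d = a *: rdivp p d.
Proof.
rewrite [p in LHS](Pdiv.RingMonic.rdivp_eq mond) scalerDr scalerAl.
rewrite Pdiv.RingMonic.rdivp_addl_mul_small //.
by apply: leq_ltn_trans (size_scale_leq _ _) _; rewrite ltn_rmodpN0 ?monic_neq0.
Qed.

Definition coefwise (M : Q -> Prop) p : Prop := forall j, M p`_j.

Lemma coefwise_ideal M : isIdeal M -> isIdeal (coefwise M).
Proof.
move=> hM; split=> [j|p q hp hq j|a p hp j].
- by rewrite coef0; apply: isIdeal0.
- by rewrite coefD; apply: isIdealD.
- by rewrite coefM; apply: isIdeal_sum => // i _; apply: isIdealM.
Qed.

Lemma rdivp_coefwise M p : isIdeal M -> coefwise M p -> coefwise M (rdivp p d).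
Proof.
move=> hM hp; rewrite -(coefK p) poly_def.
have -> : rdivp (\sum_(i < size p) p`_i *: 'X^i) d = \sum_(i < size p) p`_i *: rdivp 'X^i d.
  elim/big_rec2: _ => [|i y x _ <-]; first exact: rdiv0p.
  by rewrite rdivpD rdivpZ.
move=> j; rewrite coef_sum; apply: isIdeal_sum => // i _.
by rewrite coefZ mulrC; apply: isIdealM.
Qed.

Lemma rmodp_coefwise M p : isIdeal M -> coefwise M p -> coefwise M (rmodp p d).
Proof.
move=> hM hp; have hc := coefwise_ideal hM.
have -> : rmodp p d = p - d * rdivp p d.
  by rewrite {2}(Pdiv.RingMonic.rdivp_eq mond p) mulrC addrAC subrr add0r.
by apply: (isIdealB hc hp); apply: (isIdealM hc); apply: rdivp_coefwise.
Qed.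
End MonicDivision.

(** * From polynomials to coefficients *)
Section PolyStep.
Variables (Q : comNzRingType) (phi : {rmorphism {poly Q} -> R}) (J : R -> Prop) (k : nat).
Variables (iota : R -> 'rV[{poly Q}]_k) (sigma : 'rV[{poly Q}]_k -> R) (g : R).
Hypotheses (hJ : isIdeal J) (hr : retraction phi J iota sigma).
Variables (G : 'M[{poly Q}]_k) (c : Q) (d : {poly Q}).
Hypotheses (hG : forall u, u *m G = extmul iota sigma g u).
Hypotheses (hd : c%:P * \det G = d) (mond : d \is monic).

(* rho is a left inverse of u |-> u G that is linear over Q, but not over Q[X]:
   it multiplies by the adjugate and divides by d, discarding remainders.
   So proj = id - rho G has kernel exactly the image of G; what proj leaves is
   reduced modulo d, which changes it only by a further element of that image,
   and is then described by finitely many coefficients in Q. *)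
Let W : 'M[{poly Q}]_k := c%:P *: \adj G.
Let rho (u : 'rV[{poly Q}]_k) : 'rV[{poly Q}]_k := map_mx (fun f => rdivp f d) (u *m W).
Let proj u := u - rho u *m G.
Let n := (size d).-1.
Let E (u : 'rV[{poly Q}]_k) : 'M[Q]_(k, n) := \matrix_(i < k) poly_rV (rmodp (proj u 0 i) d).

Lemma GW : G *m W = d%:M.
Proof. by rewrite -scalemxAr mul_mx_adj scale_scalar_mx hd. Qed.

Lemma rho_mulG w : rho (w *m G) = w.
Proof.
apply/rowP => i; rewrite mxE -mulmxA GW mul_mx_scalar mxE mulrC.
exact: Pdiv.RingMonic.rdivp_mull.
Qed.

Lemma rhoD u v : rho (u + v) = rho u + rho v.
Proof. by apply/rowP => i; rewrite /rho mulmxDl !mxE rdivpD. Qed.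

Lemma rhoZ a u : rho (a%:P *: u) = a%:P *: rho u.
Proof.
apply/rowP => i; rewrite /rho -scalemxAl [LHS]mxE [RHS]mxE [in LHS]mxE [in RHS]mxE.
by rewrite !mul_polyC rdivpZ.
Qed.

Lemma projD u v : proj (u + v) = proj u + proj v.
Proof. by rewrite /proj rhoD mulmxDl opprD addrACA. Qed.

Lemma projZ a u : proj (a%:P *: u) = a%:P *: proj u.
Proof. by rewrite /proj rhoZ -scalemxAl scalerBr. Qed.

Lemma proj_mulG w : proj (w *m G) = 0.
Proof. by rewrite /proj rho_mulG subrr. Qed.

Lemma ED u v : E (u + v) = E u + E v.
Proof.
apply/row_matrixP => i; rewrite raddfD /= !rowK projD mxE.
by rewrite Pdiv.RingMonic.rmodpD // raddfD.
Qed.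

Lemma EZ a u : E (a%:P *: u) = a *: E u.
Proof.
apply/row_matrixP => i; rewrite linearZ /= !rowK projZ mxE mul_polyC.
by rewrite Pdiv.RingMonic.rmodpZ // linearZ.
Qed.

Lemma E_mulG w : E (w *m G) = 0.
Proof.
apply/row_matrixP => i; rewrite rowK proj_mulG mxE rmod0p raddf0.
by rewrite raddf0.
Qed.

Definition poly_iota r : 'rV[Q]_(k * n) := mxvec (E (iota r)).
Definition poly_sigma (w : 'rV[Q]_(k * n)) : R :=
  sigma (\row_i rVpoly (row i (vec_mx w))).

Lemma rowE_back u : exists w, \row_i rVpoly (row i (E u)) = u + w *m G.
Proof.
exists (- rho u - map_mx (fun f => rdivp f d) (proj u) *m W).
have -> : u + (- rho u - map_mx (fun f => rdivp f d) (proj u) *m W) *m G =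
    proj u - d *: map_mx (fun f => rdivp f d) (proj u).
  rewrite mulmxDl !mulNmx addrA -mulmxA.
  have -> : W *m G = d%:M by rewrite -scalemxAl mul_adj_mx scale_scalar_mx hd.
  by rewrite mul_mx_scalar.
apply/rowP => i; rewrite [LHS]mxE rowK; move: (proj u) => v.
rewrite poly_rV_K; last first.
  by have := ltn_rmodpN0 (v 0 i) (monic_neq0 mond); rewrite /n; case: (size d).
by rewrite !mxE {2}(Pdiv.RingMonic.rdivp_eq mond (v 0 i)) mulrC addrAC subrr add0r.
Qed.

(** The cokernel of G is R / (J, g), because G is the identity on the complement of
    R / J.  It is killed by d, so it is a quotient of the remainders modulo d,
    which form a free module of rank k n over Q; the projector proj splits this
    quotient map. *)
Lemma poly_step : retraction (phi \o polyC : {rmorphism Q -> R}) (ideal_adjoin J g) poly_iota poly_sigma.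
Proof.
split.
- by move=> r s; rewrite /poly_iota (iotaD hr) ED raddfD.
- by move=> a r; rewrite /poly_iota /= (iotaZ hr) EZ linearZ.
- move=> u v; rewrite /poly_sigma -(sigmaD hr); congr sigma.
  by apply/rowP => i; rewrite !mxE !raddfD.
- move=> a u; rewrite /poly_sigma /= -(sigmaZ hr); congr sigma.
  by apply/rowP => i; rewrite !mxE mul_polyC !linearZ.
- move=> r [a ha]; rewrite /poly_iota (iota_congr hr ha) -[a * g]mulrC.
  by rewrite -(extmul_iota hJ hr) -hG E_mulG raddf0.
- move=> r; rewrite /poly_iota /poly_sigma mxvecK; have [w ->] := rowE_back (iota r).
  rewrite (sigmaD hr) hG addrAC; apply: isIdealD; first exact: ideal_adjoin_ideal.
    by exists 0; rewrite mul0r subr0; apply: (sigma_iota hr).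
  exact: (sigma_extmul hJ hr).
Qed.

Lemma poly_step_continuous N M : isIdeal M ->
  continuous_retr phi iota N (coefwise M) ->
  continuous_retr (phi \o polyC) poly_iota N M.
Proof.
move=> hM [cI cP]; have hcM := coefwise_ideal hM; split=> [r Nr i|a Ma]; last first.
  apply: cP => -[|j]; rewrite coefC //=; exact: isIdeal0.
have Mio l : coefwise M (iota r 0 l) by apply: cI.
have Mprod (u : 'rV[{poly Q}]_k) (B : 'M[{poly Q}]_k) l :
    (forall l', coefwise M (u 0 l')) -> coefwise M ((u *m B) 0 l).
  move=> hu; rewrite mxE; refine (isIdeal_sum _ hcM _) => l' _.
  by rewrite mulrC; exact: (isIdealM hcM _ (hu l')).
have Mproj l : coefwise M (proj (iota r) 0 l).
  rewrite /proj; move: (Mio l) => hl; rewrite mxE [X in _ + X]mxE.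
  refine (isIdealB hcM hl _).
  apply: (Mprod) => l'; rewrite /rho mxE.
  by apply: rdivp_coefwise => //; apply: Mprod.
rewrite /poly_iota; case/mxvec_indexP: i => i j; rewrite mxvecE mxE mxE.
exact: rmodp_coefwise.
Qed.
End PolyStep.

(** * Transport along an isomorphism *)
Section Transport.
Variables (P P' : comNzRingType) (psi : {rmorphism P' -> P}) (psi' : {rmorphism P -> P'}).
Hypotheses (psiK : cancel psi psi') (psiK' : cancel psi' psi).
Variables (phi : {rmorphism P -> R}) (J : R -> Prop) (k : nat).
Variables (iota : R -> 'rV[P]_k) (sigma : 'rV[P]_k -> R).
Hypothesis (hr : retraction phi J iota sigma).

Definition iso_iota r : 'rV[P']_k := map_mx psi' (iota r).
Definition iso_sigma (u : 'rV[P']_k) : R := sigma (map_mx psi u).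

Let mapK (u : 'rV[P']_k) : map_mx psi' (map_mx psi u) = u.
Proof. by apply/rowP => i; rewrite !mxE psiK. Qed.
Let mapK' (u : 'rV[P]_k) : map_mx psi (map_mx psi' u) = u.
Proof. by apply/rowP => i; rewrite !mxE psiK'. Qed.

Lemma transport : retraction (phi \o psi : {rmorphism P' -> R}) J iso_iota iso_sigma.
Proof.
split.
- by move=> r s; rewrite /iso_iota (iotaD hr) map_mxD.
- by move=> a r; rewrite /iso_iota /= (iotaZ hr) map_mxZ psiK.
- by move=> u v; rewrite /iso_sigma map_mxD (sigmaD hr).
- by move=> a u; rewrite /iso_sigma map_mxZ (sigmaZ hr).
- by move=> r /(iota0 hr) e; rewrite /iso_iota e raddf0.
- by move=> r; rewrite /iso_sigma /iso_iota mapK'; apply: (sigma_iota hr).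
Qed.

Lemma transport_extmul g G : (forall u, u *m G = extmul iota sigma g u) ->
  forall u, u *m map_mx psi' G = extmul iso_iota iso_sigma g u.
Proof.
move=> hG u; rewrite -[u in LHS]mapK -map_mxM hG /extmul /iso_iota /iso_sigma.
by rewrite map_mxB map_mxD mapK.
Qed.

Lemma transport_continuous N M M' : (forall a, M a -> M' (psi' a)) ->
  (forall a, M' a -> M (psi a)) -> continuous_retr phi iota N M ->
  continuous_retr (phi \o psi) iso_iota N M'.
Proof.
move=> hM hM' [cI cP]; split=> [r Nr i|a Ma /=].
  by rewrite mxE; apply: hM; apply: cI.
by apply: cP; apply: hM'.
Qed.
End Transport.
End Retractions.

(** * Linear changes of coordinates *)
Section Coordinates.
Variable K : fieldType.
Local Notation R := (bdseries K).
Local Notation hom := (@homogeneous_of_degree K).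
Implicit Types (f g c : R) (m : mon) (n d i j k : nat).

(** The ideal of the series that become zero when x_n, x_{n+1}, ... are set to zero;
    the quotient is the polynomial ring in x_0, ..., x_{n-1}.  It is not the ideal
    generated by the later variables, since infinite sums occur. *)
Definition vanish n f : Prop := forall m, supp_lt n m -> f m = 0.

Lemma vanishP n f : vanish n f <-> trunc n f = 0.
Proof.
split=> [h|h m hm]; first by apply: serP => m; rewrite truncE; case: asboolP => // /h.
by have := congr1 (fun g : R => g m) h; rewrite /= truncE asboolT.
Qed.

Lemma vanish_ideal n : isIdeal (vanish n).
Proof.
split=> [//|f g /vanishP hf /vanishP hg|a f /vanishP hf].
  by apply/vanishP; rewrite rmorphD /= hf hg addr0.
by apply/vanishP; rewrite rmorphM /= hf mulr0.
Qed.

Lemma vanish_prime n f g : vanish n (f * g) -> vanish n f \/ vanish n g.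
Proof.
move=> /vanishP /eqP; rewrite rmorphM mulf_eq0 => /orP[/eqP|/eqP] h; [left|right];
  exact/vanishP.
Qed.

Lemma vanish_neq0 f : f <> 0 -> exists N, forall n, (N <= n)%N -> ~ vanish n f.
Proof.
move=> f0; have [m fm] : exists m, f m <> 0.
  apply: contrapT => h; apply: f0; apply: serP => m; apply: contrapT => fm.
  by apply: h; exists m.
have [N hN] := supp_lt_ex m; exists N => n Nn hn; apply: fm; apply: hn.
exact: supp_lt_le hN.
Qed.

Lemma xpoly_xfree k c : xfree k c -> xpoly k c = c%:P.
Proof.
move=> h; apply: (@xfree_horner_inj K k); first exact: xpoly_free.
  by move=> j m mk; rewrite coefC; case: ifP => _ //; apply: h.
by rewrite xpolyK hornerC.
Qed.

Lemma xpoly_xvar k : xpoly k (xvar K k : R) = 'X :> {poly R}.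
Proof.
apply: (@xfree_horner_inj K k); first exact: xpoly_free.
  move=> j m mk; rewrite coefX; case: eqP => // _; rewrite ser1E.
  by case: eqP => // m1; rewrite m1 cm1 in mk.
by rewrite xpolyK hornerX.
Qed.

Lemma xfree_xvar k i : k <> i -> xfree k (xvar K i : R).
Proof.
move=> ki m mk; rewrite xmonE; case: eqP => // e; move: mk; rewrite e mpowE.
by case: eqP => // /ki.
Qed.

(** The substitution of x_k + a x_0 for x_k, which is the identity on series
    without x_k. *)
Definition shear k (a : K) f : R := (xpoly k f).[xvar K k + a *: xvar K 0].

HB.instance Definition _ k a := GRing.RMorphism.copy (shear k a)
  (horner_eval (xvar K k + a *: xvar K 0) \o xpoly k).

Lemma shear_free k a c : xfree k c -> shear k a c = c.
Proof. by move=> h; rewrite /shear xpoly_xfree // hornerC. Qed.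

Lemma shear_xvar k a : shear k a (xvar K k) = xvar K k + a *: xvar K 0.
Proof. by rewrite /shear xpoly_xvar hornerX. Qed.

Lemma shear_comp k a f (h : {rmorphism R -> R}) :
  (forall c, xfree k c -> h c = c) ->
  h (shear k a f) = (xpoly k f).[h (xvar K k + a *: xvar K 0)].
Proof.
move=> hc; rewrite /shear -horner_map; congr (_.[_]).
by apply/polyP => j; rewrite coef_map /= hc //; apply: xpoly_free.
Qed.

Lemma xfreeZ k a f : xfree k f -> xfree k (a *: f).
Proof. by move=> h m mk; rewrite serZE h ?mulr0. Qed.

Lemma shearK k a : (0 < k)%N -> cancel (shear k a) (shear k (- a)).
Proof.
move=> k0 f; rewrite (shear_comp a f (h := shear k (- a))); last exact: shear_free.
rewrite /= rmorphD /= shear_xvar shear_free.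
  by rewrite scaleNr subrK xpolyK.
by apply: xfreeZ; apply: xfree_xvar => e; rewrite e in k0.
Qed.

Lemma shear_dle k a d f : dle d f -> dle d (shear k a f).
Proof.
move=> hf m dm; rewrite /shear horner_coef ser_sumE big1 // => j _.
have hj : hom j ((xvar K k + a *: xvar K 0) ^+ j).
  by rewrite -[j in hom j _]muln1; apply: homX; apply: homD; [|apply: homZ]; apply: hom_xvar.
rewrite xpoly_coef; case: (leqP j d) => jd; last first.
  rewrite [slice k j f](_ : _ = 0) ?mul0r //; apply: serP => b; rewrite sliceE.
  case: eqP => // _; rewrite hf // mdegM mdeg_mpow; apply: leq_trans jd _.
  exact: leq_addr.
have hs : dle (d - j) (slice k j f).
  move=> b db; rewrite sliceE; case: eqP => // _; rewrite hf // mdegM mdeg_mpow.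
  by rewrite -ltn_subLR.
apply: (dleM hs (hom_dle hj)); by rewrite subnK.
Qed.

Lemma xvar_trunc n k : (k < n)%N -> trunc n (xvar K k) = xvar K k.
Proof.
move=> kn; apply: serP => m; rewrite truncE; case: asboolP => // h; rewrite xmonE.
case: eqP => // e; case: h => i ni; rewrite e mpowE; case: eqP => // ik.
by move: kn; rewrite -ik ltnNge ni.
Qed.

Lemma truncZ n (a : K) f : trunc n (a *: f) = a *: trunc n f.
Proof. by apply: serP => m; rewrite serZE !truncE serZE; case: ifP; rewrite ?mulr0. Qed.

Lemma shear_trunc n k a f : (k < n)%N -> trunc n (shear k a f) = shear k a (trunc n f).
Proof.
move=> kn; rewrite /shear -horner_map /=.
have -> : map_poly (trunc n) (xpoly k f) = xpoly k (trunc n f).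
  apply/polyP => j; rewrite coef_map /= !xpoly_coef; apply: serP => m.
  rewrite truncE !sliceE truncE; case: eqP => mk; last by rewrite if_same.
  have -> : supp_lt n (mmul (mpow k j) m) = supp_lt n m; last by [].
  apply/propext; split=> [/supp_ltM [] //|h]; apply/supp_ltM; split => // i ni.
  by rewrite mpowE; case: eqP => // ik; move: kn; rewrite -ik ltnNge ni.
by rewrite rmorphD /= truncZ !xvar_trunc //; apply: leq_ltn_trans kn.
Qed.

(** On monomials without x_k, a coefficient of the sheared series is a polynomial in
    the parameter a; if this polynomial is nonzero, some a in an infinite field
    makes the coefficient nonzero. *)
Lemma shear_coef k a f m : (0 < k)%N -> m k = 0%N ->
  shear k a f m = (\poly_(j < size (xpoly k f)) (xvar K 0 ^+ j * slice k j f) m).[a].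
Proof.
move=> k0 mk; pose z f := (xpoly k f)`_0.
have zE g : z g m = g m by rewrite /z xpoly_coef sliceE mk eqxx mpow0 mul1m.
have zfree c : xfree k c -> z c = c by move=> h; rewrite /z xpoly_xfree // coefC.
rewrite -zE.
have -> : z (shear k a f) = (xpoly k f).[a *: xvar K 0].
  have -> : z (shear k a f) = (coefp 0 \o xpoly k) (shear k a f) by [].
  rewrite (shear_comp a f (h := (coefp 0 \o xpoly k : {rmorphism R -> R}))); last exact: zfree.
  congr (_.[_]); rewrite rmorphD /= -/(z (xvar K k)) -/(z (a *: xvar K 0)).
  rewrite (zfree (a *: xvar K 0)); last by apply: xfreeZ; apply: xfree_xvar => e; rewrite e in k0.
  by rewrite /z xpoly_xvar coefX add0r.
rewrite horner_coef ser_sumE horner_poly; apply: eq_bigr => j _.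
by rewrite exprZn -scalerAr serZE mulrC [_ * slice _ _ _]mulrC xpoly_coef.
Qed.

Hypothesis infK : forall P : {poly K}, P != 0 -> exists a, P.[a] != 0.

(** Noether normalization.  Starting from a monomial of top degree in x_0, ..., x_k,
    one shear per variable moves its exponents to x_0.  Only finitely many
    variables are involved, so truncations far enough out are respected. *)
Lemma monic_coordinates d f m : dle d f -> mdeg m = d -> f m != 0 ->
  exists (theta theta' : {rmorphism R -> R}) N,
    [/\ cancel theta theta', cancel theta' theta,
        forall n g, (N <= n)%N -> vanish n g -> vanish n (theta g) /\ vanish n (theta' g) &
        dle d (theta f) /\ theta f (mpow 0 d) != 0].
Proof.
move=> hf dm fm; have [k hk] := supp_lt_ex m.
elim: k f m hf dm fm {hk}(supp_lt_le (leqnSn k) hk) => [|k IH] f m hf dm fm hk.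
  exists idfun, idfun, 0%N; split=> //; split=> //=.
  suff <- : m = mpow 0 d by [].
  apply: monP => -[|i]; rewrite mpowE /=; last by rewrite hk.
  have := mdeg_mdelete 0 m; rewrite dm => ->.
  suff -> : mdelete 0 m = mone by rewrite mdeg1 addn0.
  by apply: monP => -[|i]; rewrite mdeleteE cm1 //= hk.
pose m' := mmul (mpow 0 (m k.+1)) (mdelete k.+1 m).
have dm' : mdeg m' = d by rewrite mdegM mdeg_mpow -mdeg_mdelete.
have mk' : m' k.+1 = 0%N by rewrite cmM mpowE mdeleteE eqxx.
pose Q := \poly_(j < size (xpoly k.+1 f)) (xvar K 0 ^+ j * slice k.+1 j f) m'.
have sm : slice k.+1 (m k.+1) f (mdelete k.+1 m) = f m.
  by rewrite sliceE mdeleteE eqxx mdeleteK.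
have Q0 : Q != 0.
  apply/eqP => e; have := congr1 (fun P : {poly K} => P`_(m k.+1)) e.
  rewrite /= coef_poly coef0 xvarX xmonM_coef sm; case: ltnP => [_ fm0|h _].
    by rewrite fm0 eqxx in fm.
  move: fm; rewrite -sm -xpoly_coef nth_default // ; by rewrite ser0E eqxx.
have [a Qa] := infK Q0.
have [||||th [th' [N [c1 c2 hN [h1 h2]]]]] := IH (shear k.+1 a f) m'.
- exact: shear_dle.
- exact: dm'.
- by rewrite shear_coef.
- move=> i ki; case: (ltngtP i k.+1) ki => // [ki _|-> _]; last first.
    exact: mk'.
  have [i0 ik] : (i == 0%N) = false /\ (i == k.+1) = false by lia.
  by rewrite cmM mpowE mdeleteE i0 ik hk; lia.
exists (th \o shear k.+1 a : {rmorphism R -> R}).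
exists (shear k.+1 (- a) \o th' : {rmorphism R -> R}), (maxn N k.+2); split.
- by move=> g /=; rewrite c1 shearK.
- by move=> g /=; rewrite -{1}(opprK a) shearK.
- move=> n g; rewrite geq_max => /andP[Nn kn] gn.
  have vs b g' : vanish n g' -> vanish n (shear k.+1 b g').
    by move=> /vanishP e; apply/vanishP; rewrite shear_trunc // e rmorph0.
  split=> /=; first by case: (hN n _ Nn (vs a g gn)).
  by apply: (vs); case: (hN n _ Nn gn).
- by split.
Qed.

(** No monomial of f other than x_0 ^ d contains x_0 ^ d, because of the degree
    bound; so the top coefficient of f as a polynomial in x_0 is a scalar. *)
Lemma unroll_monic d f : dle d f -> f (mpow 0 d) != 0 ->
  ((f (mpow 0 d))^-1 %:A)%:P * unroll f \is monic.
Proof.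
move=> hf f0; set c := f (mpow 0 d).
have cf j : (((c^-1) %:A)%:P * unroll f)`_j = c^-1 *: (unroll f)`_j.
  by rewrite coefCM mulr_algl.
have top : (unroll f)`_d = c%:A.
  apply: serP => m; rewrite unroll_coef serCE; case: (eqVneq m mone) => [->|/eqP m1].
    by rewrite mshift1 mulm1.
  rewrite hf // mdegM mdeg_mpow mdeg_mshift -[X in (X < _)%N]addn0 ltn_add2l.
  by have [i mi] := mdeg_neq0P m1; apply: mdeg_gt0 mi.
have high j : (d < j)%N -> (unroll f)`_j = 0.
  move=> dj; apply: serP => m; rewrite unroll_coef hf // mdegM mdeg_mpow.
  by apply: leq_trans dj _; apply: leq_addr.
have sz : size (((c^-1) %:A)%:P * unroll f) = d.+1.
  apply/eqP; rewrite eqn_leq; apply/andP; split.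
    by apply/leq_sizeP => j dj; rewrite cf high // scaler0.
  rewrite ltnNge; apply/negP => /leq_sizeP /(_ d (leqnn d)) /eqP.
  by rewrite cf top scalerA mulVf // scale1r oner_eq0.
by rewrite monicE lead_coefE sz cf top scalerA mulVf // scale1r.
Qed.

Lemma unroll_vanish n f : vanish n.+1 f -> coefwise (vanish n) (unroll f).
Proof.
move=> h j m hm; rewrite unroll_coef h //; apply/supp_ltM; split=> -[//|i] ni.
  by rewrite mpowE.
by rewrite mshiftE hm.
Qed.

Lemma roll_vanish n (p : {poly R}) : coefwise (vanish n) p -> vanish n.+1 (roll p).
Proof.
move=> h m hm; have := unroll_coef (roll p) (m 0%N) (munshift m).
rewrite rollK munshiftK mdeleteK => <-; apply: h => i ni; by rewrite munshiftE hm.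
Qed.
End Coordinates.

(** * Truncations of regular sequences *)
Section Assembly.
Variable K : fieldType.
Local Notation R := (bdseries K).
Implicit Types (f g h x z : R) (m : mon) (n d i j k : nat) (l : seq R).

Lemma ideal_of_ideal l : isIdeal (ideal_of l).
Proof.
split=> [|f g|a f]; [exact: lincomb0 | exact: lincomb_add |].
by apply: lincomb_mul => //; split.
Qed.

Lemma ideal_of_nil f : ideal_of [::] f <-> f = 0.
Proof. by split=> [[//|b z g _]|->]; [rewrite /span_of in_nil | apply: lincomb0]. Qed.

Lemma ideal_of_cons x l f : ideal_of (x :: l) f <-> ideal_adjoin (ideal_of l) x f.
Proof.
split.
  have hA := ideal_adjoin_ideal x (ideal_of_ideal l).
  elim=> [|b z g _ zl _ IH]; first exact: (isIdeal0 hA).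
  apply: (isIdealD hA) IH; apply: (isIdealM hA); move: zl; rewrite /span_of inE.
  case/orP => [/eqP ->|zl]; first by exists 1; rewrite mul1r subrr; apply: lincomb0.
  by exists 0; rewrite mul0r subr0 -[z]mul1r; apply: lincomb_gen.
case=> a ha; rewrite -(subrK (a * x) f); apply: lincomb_add.
  by apply: lincomb_mono ha => // z zl; rewrite /span_of inE; apply/orP; right.
by apply: lincomb_gen => //; rewrite /span_of inE eqxx.
Qed.

(** Here phi embeds the series in all but size l of the coordinates, after a linear
    change of coordinates; they form a ring isomorphic to the original one. *)
Definition retract_state l : Prop :=
  exists k (phi : {rmorphism R -> R}) (iota : R -> 'rV[R]_k) sigma N,
    retraction phi (ideal_of l) iota sigma /\
    forall n, (N <= n)%N -> continuous_retr phi iota (vanish (size l + n)) (vanish n).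

Lemma retract_nil : retract_state [::].
Proof.
exists 1%N, idfun, (fun r => \row_(j < 1) r), (fun u => u 0 0), 0%N; split.
  split=> [r s|a r|u v|a u|r|r].
  - by apply/rowP => i; rewrite !mxE.
  - by apply/rowP => i; rewrite !mxE.
  - by rewrite mxE.
  - by rewrite mxE.
  - by move=> /ideal_of_nil ->; apply/rowP => i; rewrite !mxE.
  - by rewrite mxE subrr; apply: lincomb0.
by move=> n _; split=> // r hr i; rewrite mxE.
Qed.

Definition regular_mod l x n : Prop := forall h,
  ideal_sum (ideal_of l) (vanish n) (h * x) -> ideal_sum (ideal_of l) (vanish n) h.

Lemma retraction_ext (P : comNzRingType) (phi : {rmorphism P -> R}) (J J' : R -> Prop) k
    (iota : R -> 'rV[P]_k) sigma :
  (forall r, J r <-> J' r) -> retraction phi J iota sigma -> retraction phi J' iota sigma.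
Proof.
move=> e [h1 h2 h3 h4 h5 h6]; split=> //; first by move=> r /e; apply: h5.
by move=> r; apply/e.
Qed.

Hypothesis infK : forall P : {poly K}, P != 0 -> exists a, P.[a] != 0.

(** Since x is regular modulo l, the extension of its multiplication has a nonzero
    determinant, whose truncations are nonzero from some point on: this gives
    regularity after truncation.  Making the determinant monic in one coordinate
    and removing this coordinate gives the next retraction. *)
Lemma retract_cons x l : retract_state l ->
  (forall h, ideal_of l (h * x) -> ideal_of l h) ->
  retract_state (x :: l) /\ exists N, forall n, (N <= n)%N -> regular_mod l x n.
Proof.
move=> [k [phi [iota [sigma [N [hr hc]]]]]] hx.
have hJ := ideal_of_ideal l.
have [G hG] := extmul_mx hr x.
have D0 : \det G <> 0.
  move=> /eqP /det0P [v v0 vG]; have := hG v; rewrite vG => /esym e.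
  by case: (extmul_kernel hJ hr v0 e) => h /hx.
have [N1 hN1] := vanish_neq0 D0.
split; last first.
  exists (size l + maxn N N1)%N => n nN.
  have ln : (size l <= n)%N by apply: leq_trans nN; apply: leq_addr.
  move: nN; rewrite -(subnKC ln) leq_add2l geq_max => /andP[Nn N1n].
  have hp := @vanish_prime K (n - size l).
  exact: (extmul_regular hJ hr hG (@vanish_ideal K _) (@vanish_ideal K _) hp
    (hN1 _ N1n) (hc _ Nn)).
have [m [Dm mmax]] : exists m, is_lm (\det G) m.
  by exists (lm (\det G)); apply: lmP; apply/eqP.
have Dd : dle (mdeg m) (\det G).
  move=> b mb; apply/eqP; apply: contrapT => /negP /mmax [e|[e|[e _]]].
  - by move: mb; rewrite e ltnn.
  - by move: mb; rewrite ltnNge ltnW.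
  - by move: mb; rewrite e ltnn.
have [th [th' [N2 [c1 c2 hN2 [Dd' Dt]]]]] := monic_coordinates infK Dd erefl Dm.
pose psi : {rmorphism {poly R} -> R} := th' \o @roll K.
pose psi' : {rmorphism R -> {poly R}} := @unroll K \o th.
have psiK : cancel psi psi' by move=> p; rewrite /psi /psi' /= c2 rollK.
have psiK' : cancel psi' psi by move=> f; rewrite /psi /psi' /= unrollK c1.
have hr' := transport psiK psiK' hr.
have hG' := transport_extmul psiK hG.
have hd : ((th (\det G) (mpow 0 (mdeg m)))^-1%:A)%:P * \det (map_mx psi' G) =
    ((th (\det G) (mpow 0 (mdeg m)))^-1%:A)%:P * unroll (th (\det G)).
  by rewrite det_map_mx.
have mond := unroll_monic Dd' Dt; rewrite -hd in mond.
have hr2 := poly_step hJ hr' hG' erefl mond.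
do 4![eexists]; exists (maxn N N2); split.
  by apply: retraction_ext hr2 => r; rewrite ideal_of_cons.
move=> n; rewrite geq_max => /andP[Nn N2n].
apply: poly_step_continuous => //; first exact: vanish_ideal.
have cn : continuous_retr phi iota (vanish (size l + n.+1)) (vanish n.+1).
  by apply: hc; apply: leqW.
rewrite /= addSnnS; apply: transport_continuous cn => [f hf|p hp].
  by apply: unroll_vanish; case: (hN2 _ _ (leqW N2n) hf).
by case: (hN2 _ _ (leqW N2n) (roll_vanish hp)).
Qed.

Fixpoint regular_chain n l : Prop :=
  if l is x :: l' then regular_chain n l' /\ regular_mod l' x n else True.

(** The induction carries the retraction along with the regularity: each step uses
    the retraction for the sequence so far and provides the next one. *)
Lemma eventually_regular l :
  (forall l1 x l2, l = l1 ++ x :: l2 -> forall h, ideal_of l2 (h * x) -> ideal_of l2 h) ->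
  exists N, forall n, (N <= n)%N -> regular_chain n l.
Proof.
move=> hl; suff [] : retract_state l /\ exists N, forall n, (N <= n)%N -> regular_chain n l by [].
elim: l hl => [|x l IH] hl; first by split; [exact: retract_nil | exists 0%N].
have [|st [N hN]] := IH.
  by move=> l1 y l2 e; apply: (hl (x :: l1)); rewrite e.
have [st' [N' hN']] := retract_cons st (hl [::] x l erefl).
split=> //; exists (maxn N N') => n; rewrite geq_max => /andP[Nn N'n].
by split; [apply: hN | apply: hN'].
Qed.
End Assembly.

(** * Independence over a regular sequence *)
Section Flatness.
Variable K : fieldType.
Local Notation R := (bdseries K).
Local Notation hom := (@homogeneous_of_degree K).
Implicit Types (f g h r x z : R) (m : mon) (d i j k : nat) (l t : seq R) (b F : nat -> R).

Lemma ideal_sum_ideal (J N : R -> Prop) : isIdeal J -> isIdeal N -> isIdeal (ideal_sum J N).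
Proof.
move=> hJ hN; split=> [|r s [a Ja Na] [c Jc Nc]|a r [c Jc Nc]].
- by exists 0; [apply: (isIdeal0 hJ) | rewrite subrr; apply: (isIdeal0 hN)].
- exists (a + c); first exact: (isIdealD hJ).
  by rewrite opprD addrACA; apply: (isIdealD hN).
- exists (a * c); first exact: (isIdealM hJ).
  by rewrite -mulrBr; apply: (isIdealM hN).
Qed.

Lemma isIdealZ (J : R -> Prop) c r : isIdeal J -> J r -> J (c *: r).
Proof. by move=> hJ Jr; rewrite -mulr_algl; apply: (isIdealM hJ). Qed.

Variable n : nat.

Let V l := ideal_sum (ideal_of l) (@vanish K n).

Lemma V_ideal l : isIdeal (V l).
Proof. by apply: ideal_sum_ideal; [apply: ideal_of_ideal | apply: vanish_ideal]. Qed.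

Definition indep_mod (W : R -> Prop) k b : Prop :=
  forall c : nat -> K, W (\sum_(i < k) c i *: b i) -> forall i, (i < k)%N -> c i = 0.

Lemma regular_chain_catrev t l : regular_chain n (catrev t l) -> regular_chain n l.
Proof. by elim: t l => // x t IH l /IH []. Qed.

(** Write the coefficients of a relation as polynomials in the first element x of t:
    modulo x the constant terms vanish by induction, and then x, being regular,
    can be divided out.  The elements of t, which generate the subalgebra, move
    one at a time to l, whose ideal is factored out. *)
Lemma regular_indep k b t l : regular_chain n (catrev t l) ->
  indep_mod (V (catrev t l)) k b ->
  forall F, (forall i, alg (span_of t) (F i)) -> V l (\sum_(i < k) b i * F i) ->
  forall i, (i < k)%N -> F i = 0.
Proof.
elim: t l => [|x t IH] l rc ind F hF.
  have hconst i : exists c, F i = c%:A.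
    elim: (hF i) => [c|z //|f g _ [c ->] _ [c' ->]|f g _ [c ->] _ [c' ->]].
    - by exists c.
    - by exists (c + c'); rewrite scalerDl.
    - by exists (c * c'); rewrite -scalerAl mul1r scalerA.
  pose c i := sval (cid (hconst i)); have cE i : F i = (c i)%:A by rewrite /c; case: cid.
  have -> : \sum_(i < k) b i * F i = \sum_(i < k) c i *: b i.
    by apply: eq_bigr => i _; rewrite cE mulr_algr.
  by move=> /ind h i ik; rewrite cE h // scale0r.
have [_ rx] : regular_chain n (x :: l) := @regular_chain_catrev t (x :: l) rc.
have hP i : exists P : {poly R}, polyIn (alg (span_of t)) P /\ F i = P.[x].
  by have [P hP e] := (alg_span_cons x t (F i)).1 (hF i); exists P.
pose P i := sval (cid (hP i)).
have PE i : polyIn (alg (span_of t)) (P i) /\ F i = (P i).[x] by rewrite /P; case: cid.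
have [s Ps] : exists s, forall i, (i < k)%N -> (size (P i) <= s)%N.
  by exists (\max_(i < k) size (P i))%N => i ik; apply: (leq_bigmax (Ordinal ik)).
have PB i := (PE i).1; have {}PE i := (PE i).2.
move: {hP} P PB PE Ps => P PB PE Ps.
(* induction on a common bound for the degrees in x *)
elim: s P F PB PE Ps {hF} => [|s IHs] P F PB PE Ps hV i ik.
  by have := Ps i ik; rewrite leqn0 size_poly_eq0 PE => /eqP ->; rewrite horner0.
pose P' i := drop_poly 1 (P i).
have PE' j : (P j).[x] = (P' j).[x] * x + (P j)`_0.
  rewrite -[P j in LHS](poly_take_drop 1) hornerD hornerM hornerXn addrC; congr (_ + _).
  by rewrite -[take_poly 1 (P j)]/(\poly_(i < 1) _) horner_poly big_ord1 mulr1.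
have PB' j : polyIn (alg (span_of t)) (P' j) by move=> e; rewrite coef_drop_poly; apply: PB.
have splitV : \sum_(i < k) b i * F i =
    (\sum_(i < k) b i * (P' i).[x]) * x + \sum_(i < k) b i * (P i)`_0.
  by rewrite mulr_suml -big_split; apply: eq_bigr => j _; rewrite PE PE' mulrDr mulrA.
have c0 : forall i, (i < k)%N -> (P i)`_0 = 0.
  apply: (IH (x :: l) rc ind (fun i => (P i)`_0)) => [j|]; first exact: PB.
  move: hV; rewrite splitV => -[a Ja Na].
  exists (a - (\sum_(i < k) b i * (P' i).[x]) * x); last by rewrite opprB addrA [X in X - a]addrC.
  apply: (isIdealB (ideal_of_ideal _)).
    by apply: lincomb_mono Ja => // z zl; rewrite /span_of inE; apply/orP; right.
  by apply: lincomb_gen => //; rewrite /span_of inE eqxx.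
have c0' : \sum_(i < k) b i * (P i)`_0 = 0.
  by rewrite big1 // => j _; rewrite c0 ?mulr0.
rewrite splitV c0' addr0 in hV.
rewrite PE PE' c0 // addr0 (IHs P' (fun i => (P' i).[x])) ?mul0r //.
  by move=> j jk; rewrite size_drop_poly leq_subLR add1n; apply: Ps.
exact: rx.
Qed.

(** * Expansions over the subalgebra of a regular sequence *)
Variable l : seq R.
Hypothesis hl : forall z, z \in l -> exists2 e, (0 < e)%N & hom e z.

Definition expansion k b r : Prop := exists2 F,
  (forall i, alg (span_of l) (F i)) & vanish n (r - \sum_(i < k) b i * F i).

Definition frame k b : Prop :=
  indep_mod (V l) k b /\ forall i, (i < k)%N -> exists d, hom d (b i).

Definition extends k b k' b' : Prop := (k <= k')%N /\ forall i, (i < k)%N -> b' i = b i.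

Lemma extends_trans k1 b1 k2 b2 k3 b3 :
  extends k1 b1 k2 b2 -> extends k2 b2 k3 b3 -> extends k1 b1 k3 b3.
Proof.
move=> [k12 b12] [k23 b23]; split; first exact: leq_trans k12 k23.
by move=> i ik; rewrite b23 ?b12 //; apply: leq_trans k12.
Qed.

Lemma expansion_extends k b k' b' r : extends k b k' b' -> expansion k b r -> expansion k' b' r.
Proof.
move=> [kk' bb'] [F hF hr]; exists (fun i => if (i < k)%N then F i else 0).
  by move=> i; case: ifP => _ //; apply: subalg0; apply: alg_subalg.
suff -> : \sum_(i < k') b' i * (if (i < k)%N then F i else 0) = \sum_(i < k) b i * F i by [].
rewrite (big_ord_widen k' (fun i => b i * F i) kk') [RHS]big_mkcond; apply: eq_bigr => i _.
by case: ifP => ik; rewrite ?mulr0 // bb'.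
Qed.

Lemma expansion0 k b : expansion k b 0.
Proof.
exists (fun=> 0); first by move=> i; apply: subalg0; apply: alg_subalg.
by rewrite big1 ?subrr // => i _; rewrite mulr0.
Qed.

Lemma expansionD k b r s : expansion k b r -> expansion k b s -> expansion k b (r + s).
Proof.
move=> [F hF hr] [G hG hs]; exists (fun i => F i + G i); first by move=> i; apply: alg_add.
have -> : r + s - \sum_(i < k) b i * (F i + G i) =
    (r - \sum_(i < k) b i * F i) + (s - \sum_(i < k) b i * G i).
  under eq_bigr => i _ do rewrite mulrDr.
  by rewrite big_split /= opprD addrACA.
exact: (isIdealD (@vanish_ideal K n)).
Qed.

Lemma expansionM k b r a : alg (span_of l) a -> expansion k b r -> expansion k b (r * a).
Proof.
move=> ha [F hF hr]; exists (fun i => F i * a); first by move=> i; apply: alg_mul.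
have -> : r * a - \sum_(i < k) b i * (F i * a) = a * (r - \sum_(i < k) b i * F i).
  rewrite mulrBr [a * r]mulrC mulr_sumr; congr (_ - _); apply: eq_bigr => i _.
  by rewrite mulrA [RHS]mulrC.
exact: (isIdealM (@vanish_ideal K n)).
Qed.

Lemma expansion_basis k b i : (i < k)%N -> expansion k b (b i).
Proof.
move=> ik; exists (fun j => (j == i)%:R).
  by move=> j; case: eqP => _; [apply: subalg1 | apply: subalg0]; apply: alg_subalg.
rewrite (bigD1 (Ordinal ik)) //= eqxx mulr1 big1 ?addr0 ?subrr // => j.
by rewrite -val_eqE /= => /negbTE ->; rewrite mulr0.
Qed.

Lemma expansion_vanish k b r s : vanish n (r - s) -> expansion k b s -> expansion k b r.
Proof.
move=> rs [F hF hs]; exists F => //.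
have -> : r - \sum_(i < k) b i * F i = (r - s) + (s - \sum_(i < k) b i * F i) by rewrite addrA subrK.
exact: (isIdealD (@vanish_ideal K n)).
Qed.

Lemma vanish_hcomp d r : vanish n r -> vanish n (hcomp d r).
Proof. by move=> h m hm; rewrite hcompE h ?if_same. Qed.

(** Expansions are found one element at a time, so an independent family must be
    allowed to grow. *)
Definition expandable r : Prop := forall k b, frame k b ->
  exists k' b', [/\ frame k' b', extends k b k' b' & expansion k' b' r].

Lemma expandable0 : expandable 0.
Proof. by move=> k b fb; exists k, b; split=> //; apply: expansion0. Qed.

Lemma expandableD r s : expandable r -> expandable s -> expandable (r + s).
Proof.
move=> hr hs k b /hr [k1 [b1 [f1 e1 x1]]]; have [k2 [b2 [f2 e2 x2]]] := hs _ _ f1.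
exists k2, b2; split=> //; first exact: extends_trans e1 e2.
by apply: expansionD => //; apply: expansion_extends x1.
Qed.

Lemma expandableM r a : alg (span_of l) a -> expandable r -> expandable (r * a).
Proof.
move=> ha hr k b /hr [k1 [b1 [f1 e1 x1]]]; exists k1, b1; split=> //.
exact: expansionM.
Qed.

(** Graded Nakayama argument: if r is a combination of the family modulo l, the
    difference is a combination of elements of l, whose cofactors have smaller
    degree and are expandable by induction; otherwise r is added to the family. *)
Lemma expandable_hom d r : hom d r -> expandable r.
Proof.
elim/ltn_ind: d r => d IH r hr k b fb.
case: (pselect (exists c : nat -> K, V l (r - \sum_(i < k) c i *: b i))) => [[c [j Jj Nj]]|nspan].
  have /(_ k b fb) [k' [b' [f' e' x']]] : expandable (hcomp d j).
    elim: Jj {Nj} => [|a z f _ zl _ IHf]; first by rewrite raddf0; apply: expandable0.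
    rewrite raddfD; apply: expandableD IHf => /=.
    have [e e0 hz] := hl zl; case: (leqP e d) => ed; last first.
      by rewrite (hcomp_homM_lt _ hz) //; apply: expandable0.
    rewrite -(subnK ed) hcomp_homM //; apply: expandableM; first exact: alg_gen.
    apply: (IH (d - e)%N); last exact: hom_hcomp.
    by rewrite ltn_subrL e0 (leq_trans e0).
  exists k', b'; split=> //.
  apply: (@expansion_vanish _ _ _ (\sum_(i < k) c i *: hcomp d (b i) + hcomp d j)).
    have := vanish_hcomp d Nj; rewrite !raddfB /= (hcomp_id hr) raddf_sum opprD addrA.
    suff -> : \sum_(i < k) hcomp d (c i *: b i) = \sum_(i < k) c i *: hcomp d (b i) by [].
    by apply: eq_bigr => i _; rewrite hcompZ.
  apply: expansionD => //; elim/big_ind: _ => [||i _]; [exact: expansion0 | exact: expansionD |].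
  have [e he] := fb.2 i (ltn_ord i); rewrite -mulr_algr.
  case: (eqVneq d e) => [->|/eqP de]; last first.
    by rewrite (hcomp_other he de) mul0r; apply: expansion0.
  rewrite (hcomp_id he); apply: expansionM; first exact: alg_const.
  by apply: expansion_extends e' _; apply: expansion_basis.
pose b' i := if i == k then r else b i.
have bb' (i : 'I_k) : b' i = b i by rewrite /b' ltn_eqF.
have b'k : b' k = r by rewrite /b' eqxx.
have hV := V_ideal l.
exists k.+1, b'; split; last by rewrite -b'k; apply: expansion_basis.
  split=> [c|i]; last first.
    rewrite ltnS leq_eqVlt => /orP[/eqP ->|ik]; first by exists d; rewrite b'k.
    by rewrite /b' ltn_eqF //; apply: fb.2.
  rewrite big_ord_recr /= b'k.
  have -> : \sum_(i < k) c i *: b' i = \sum_(i < k) c i *: b i.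
    by apply: eq_bigr => i _; rewrite bb'.
  move=> hsum; have ck : c k = 0.
    apply/eqP; apply: contrapT => /negP ck; apply: nspan.
    exists (fun i => - ((c k)^-1 * c i)).
    have := isIdealZ (c k)^-1 hV hsum; rewrite scalerDr scalerA mulVf // scale1r addrC.
    congr (V l (_ + _)); rewrite -sumrN scaler_sumr; apply: eq_bigr => i _.
    by rewrite scaleNr opprK scalerA.
  rewrite ck scale0r addr0 in hsum.
  move=> i; rewrite ltnS leq_eqVlt => /orP[/eqP -> //|ik].
  exact: fb.1 hsum i ik.
split=> [|i ik]; first exact: leqnSn.
by rewrite /b' ltn_eqF.
Qed.

Lemma expandable_all r : expandable r.
Proof.
have [d hd] := dle_ex r; rewrite (hcomp_sum hd).
elim/big_ind: _ => [||i _]; [exact: expandable0 | exact: expandableD |].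
exact: (expandable_hom (@hom_hcomp _ i r)).
Qed.

Lemma expandable_family k0 (h : nat -> R) :
  exists k b, frame k b /\ forall j, (j < k0)%N -> expansion k b (h j).
Proof.
elim: k0 => [|k0 [k [b [fb hb]]]].
  by exists 0%N, (fun=> 0); split=> //; split.
have [k' [b' [f' e' x']]] := expandable_all (h k0) fb.
exists k', b'; split=> // j; rewrite ltnS leq_eqVlt => /orP[/eqP ->//|jk].
exact: expansion_extends e' (hb j jk).
Qed.

(** * Flatness *)
Hypothesis hreg : regular_chain n l.

(** Flatness of the truncated ring over the subalgebra generated by l, in terms of
    relations.  Expand the h_j in a basis; the coordinates of the relation are
    relations over the subalgebra, and these hold exactly, not only modulo the
    truncation. *)
Lemma regular_flat k0 (h f : nat -> R) :
  (forall j, (j < k0)%N -> alg (span_of l) (f j)) ->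
  vanish n (\sum_(j < k0) h j * f j) ->
  exists h' : nat -> R, \sum_(j < k0) h' j * f j = 0 /\
    forall j, (j < k0)%N -> vanish n (h j - h' j).
Proof.
move=> hf hv; have [k [b [[ind _] hx]]] := expandable_family k0 h.
have hF j : exists F, (forall i, alg (span_of l) (F i)) /\
    ((j < k0)%N -> vanish n (h j - \sum_(i < k) b i * F i)).
  case: (ltnP j k0) => jk; first by have [F hF hv'] := hx j jk; exists F.
  by exists (fun=> 0); split=> // i; apply: subalg0; apply: alg_subalg.
pose F j := sval (cid (hF j)).
have FE j : (forall i, alg (span_of l) (F j i)) /\
    ((j < k0)%N -> vanish n (h j - \sum_(i < k) b i * F j i)) by rewrite /F; case: cid.
have swap : \sum_(j < k0) (\sum_(i < k) b i * F j i) * f j =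
    \sum_(i < k) b i * (\sum_(j < k0) F j i * f j).
  under eq_bigr => j _ do rewrite mulr_suml.
  rewrite exchange_big /=; apply: eq_bigr => i _; rewrite mulr_sumr.
  by apply: eq_bigr => j _; rewrite mulrA.
exists (fun j => \sum_(i < k) b i * F j i); split; last by move=> j jk; apply: (FE j).2.
rewrite swap big1 // => i _.
have rev_l : catrev (rev l) [::] = l by rewrite catrevE cats0 revK.
rewrite (@regular_indep k b (rev l) [::] _ _ (fun i => \sum_(j < k0) F j i * f j)) ?mulr0 //.
- by rewrite rev_l.
- by rewrite rev_l.
- move=> i'; apply: subalg_sum; first exact: alg_subalg.
  move=> j _; apply: alg_mono (_ : alg (span_of l) _).
    by move=> z; rewrite /span_of mem_rev.
  by apply: alg_mul; [apply: (FE j).1 | apply: hf].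
exists 0; first exact: lincomb0.
rewrite subr0 -swap.
have -> : \sum_(j < k0) (\sum_(i < k) b i * F j i) * f j = \sum_(j < k0) h j * f j -
    \sum_(j < k0) f j * (h j - \sum_(i < k) b i * F j i).
  by rewrite -sumrB; apply: eq_bigr => j _; rewrite mulrBr opprB addrC mulrC [f j * h j]mulrC subrK.
apply: (isIdealB (@vanish_ideal K n)) => //; apply: (isIdeal_sum _ (@vanish_ideal K n)) => j _.
by apply: (isIdealM (@vanish_ideal K n)); apply: (FE j).2.
Qed.

End Flatness.

(** * Regularity of the last variable *)
Section VariableRegular.
Variable K : fieldType.
Local Notation R := (bdseries K).
Local Notation hom := (@homogeneous_of_degree K).
Implicit Types (f g h r x z : R) (m : mon) (d i j k n : nat) (l fs : seq R).

Lemma vanish_xvar n : vanish n (xvar K n).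
Proof.
move=> m hm; rewrite xmonE; case: eqP => // e; have := hm n (leqnn n).
by rewrite e mpowE eqxx.
Qed.

Lemma vanishS n f : vanish n.+1 f -> vanish n f.
Proof. by move=> h m hm; apply: h; apply: supp_lt_le hm. Qed.

Lemma vanish_split n f : vanish n f -> exists g, vanish n.+1 (f - xvar K n * g).
Proof.
move=> hf; exists (drop_poly 1 (xpoly n f)).[xvar K n].
have -> : f - xvar K n * (drop_poly 1 (xpoly n f)).[xvar K n] = (xpoly n f)`_0.
  rewrite -[f in f - _](xpolyK n) -[in X in X - _](poly_take_drop 1 (xpoly n f)).
  rewrite hornerD hornerM hornerXn [_ * xvar K n]mulrC addrK.
  by rewrite -[take_poly 1 _]/(\poly_(i < 1) _) horner_poly big_ord1 mulr1.
move=> m hm; rewrite xpoly_coef sliceE mpow0 mul1m; case: eqP => // mn.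
apply: hf => i; rewrite leq_eqVlt => /orP[/eqP <- //|]; exact: hm.
Qed.

Lemma ideal_of_sum fs f : ideal_of fs f <->
  exists h : nat -> R, f = \sum_(j < size fs) h j * fs`_j.
Proof.
split=> [|[h ->]]; last first.
  by apply: lincomb_sum => j _; apply: lincomb_gen => //; apply: mem_nth.
elim=> [|a z g _ zfs _ [h ->]].
  by exists (fun=> 0); rewrite big1 // => j _; rewrite mul0r.
exists (fun j => h j + (if j == index z fs then a else 0)).
under [RHS]eq_bigr => j _ do rewrite mulrDl.
rewrite big_split /= addrC; congr (_ + _).
have iz : (index z fs < size fs)%N by rewrite index_mem.
rewrite (bigD1 (Ordinal iz)) //= eqxx nth_index // big1 ?addr0 // => j.
by rewrite -val_eqE /= => /negbTE ->; rewrite mul0r.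
Qed.

(** If x_n r = \sum_j h_j f_j in the variables up to x_n, then the right hand side
    vanishes for x_n = 0.  By flatness the h_j agree for x_n = 0 with an exact
    relation h'_j, so h_j = h'_j + x_n g_j, and x_n can be cancelled in
    x_n r = x_n \sum_j g_j f_j. *)
Theorem xvar_regular n l fs r :
  (forall z, z \in l -> exists2 e, (0 < e)%N & hom e z) -> regular_chain n l ->
  (forall f, f \in fs -> alg (span_of l) f) ->
  ideal_sum (ideal_of fs) (vanish n.+1) (xvar K n * r) -> ideal_sum (ideal_of fs) (vanish n.+1) r.
Proof.
move=> hl hreg hfs [s /ideal_of_sum [h ->] hv].
have vn : vanish n (\sum_(j < size fs) h j * fs`_j).
  rewrite -(subKr (xvar K n * r) (\sum_(j < size fs) _)).
  apply: (isIdealB (@vanish_ideal K n)); last exact: vanishS.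
  by rewrite mulrC; apply: (isIdealM (@vanish_ideal K n)); apply: vanish_xvar.
have [|h' [h'0 hh']] := regular_flat hl hreg _ vn.
  by move=> j jfs; apply: hfs; apply: mem_nth.
have hg j : exists g, (j < size fs)%N -> vanish n.+1 (h j - h' j - xvar K n * g).
  case: (ltnP j (size fs)) => jfs; last by exists 0.
  by have [g hg] := vanish_split (hh' j jfs); exists g.
pose g j := sval (cid (hg j)).
have gE j : (j < size fs)%N -> vanish n.+1 (h j - h' j - xvar K n * g j) by rewrite /g; case: cid.
exists (\sum_(j < size fs) g j * fs`_j); first by apply/ideal_of_sum; exists g.
have key : vanish n.+1 (xvar K n * (r - \sum_(j < size fs) g j * fs`_j)).
  have -> : xvar K n * (r - \sum_(j < size fs) g j * fs`_j) =
      (xvar K n * r - \sum_(j < size fs) h j * fs`_j) +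
      \sum_(j < size fs) fs`_j * (h j - h' j - xvar K n * g j).
    have -> : \sum_(j < size fs) fs`_j * (h j - h' j - xvar K n * g j) =
        \sum_(j < size fs) h j * fs`_j - xvar K n * \sum_(j < size fs) g j * fs`_j.
      have e : \sum_(j < size fs) h j * fs`_j =
          \sum_(j < size fs) h j * fs`_j - \sum_(j < size fs) h' j * fs`_j.
        by rewrite h'0 subr0.
      rewrite e mulr_sumr -!sumrB.
      by apply: eq_bigr => j _; ring.
    by rewrite addrA subrK mulrBr.
  apply: (isIdealD (@vanish_ideal K _)) => //.
  apply: (isIdeal_sum _ (@vanish_ideal K _)) => j _.
  by apply: (isIdealM (@vanish_ideal K _)); apply: gE.
case: (vanish_prime key) => // hx.
have hs : supp_lt n.+1 (mpow n 1).
  by move=> i ni; rewrite mpowE; case: eqP => // e; move: ni; rewrite e ltnn.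
by have /eqP := hx _ hs; rewrite xmonE eqxx oner_eq0.
Qed.
End VariableRegular.

(** * Perfect closure *)
Section PerfectClosure.
Local Open Scope quotient_scope.
Variables (F : fieldType) (p : nat).
Hypothesis pF : p \in [pchar F].
Implicit Types (x y z : nat * F) (a b : F) (n m : nat).

Let frobD n a b : (a + b) ^+ (p ^ n) = a ^+ (p ^ n) + b ^+ (p ^ n).
Proof.
elim: n => [|n IH]; first by rewrite expn0 !expr1.
rewrite expnSr !exprM IH; exact: (pFrobenius_autD_comm pF (mulrC _ _)).
Qed.

Let frobI n a b : a ^+ (p ^ n) = b ^+ (p ^ n) -> a = b.
Proof.
move=> e; apply/eqP; rewrite -subr_eq0.
have : (a - b + b) ^+ (p ^ n) = b ^+ (p ^ n) by rewrite subrK.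
rewrite frobD => /(canRL (addrK _)); rewrite subrr => /eqP.
by rewrite expf_eq0 expn_gt0 (prime_gt0 (pcharf_prime pF)).
Qed.

(** The pair (n, a) stands for the p^n-th root of a, which is unique. *)
Definition pceq x y := x.2 ^+ (p ^ y.1) == y.2 ^+ (p ^ x.1).

Fact pceq_refl : reflexive pceq. Proof. by move=> x; rewrite /pceq. Qed.
Fact pceq_sym : symmetric pceq. Proof. by move=> x y; rewrite /pceq eq_sym. Qed.
Fact pceq_trans : transitive pceq.
Proof.
move=> y x z /eqP xy /eqP yz; apply/eqP; apply: (@frobI y.1).
by rewrite -!exprM mulnC exprM xy -exprM mulnC exprM yz -!exprM mulnC.
Qed.

Definition pceq_equiv := EquivRel pceq pceq_refl pceq_sym pceq_trans.
Definition pclosure := {eq_quot pceq_equiv}%qT.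

HB.instance Definition _ := Choice.on pclosure.
HB.instance Definition _ := EqQuotient.on pclosure.

Lemma pcP x y : (\pi_pclosure x = \pi_pclosure y) <-> x.2 ^+ (p ^ y.1) = y.2 ^+ (p ^ x.1).
Proof. by split=> [/eqmodP /eqP //|e]; apply/eqmodP/eqP. Qed.

Lemma pc_repr (u : pclosure) : exists x, u = \pi_pclosure x.
Proof. by exists (repr u); rewrite reprK. Qed.

Lemma repr_eq x : (repr (\pi_pclosure x)).2 ^+ (p ^ x.1) = x.2 ^+ (p ^ (repr (\pi_pclosure x)).1).
Proof. by apply/pcP; rewrite reprK. Qed.

Definition padd x y := ((x.1 + y.1)%N, x.2 ^+ (p ^ y.1) + y.2 ^+ (p ^ x.1)).
Definition pmul x y := ((x.1 + y.1)%N, x.2 ^+ (p ^ y.1) * y.2 ^+ (p ^ x.1)).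
Definition popp x := (x.1, - x.2).
Definition pinv x := (x.1, x.2^-1).

Definition pcadd (u v : pclosure) : pclosure := \pi_pclosure (padd (repr u) (repr v)).
Definition pcmul (u v : pclosure) : pclosure := \pi_pclosure (pmul (repr u) (repr v)).
Definition pcopp (u : pclosure) : pclosure := \pi_pclosure (popp (repr u)).
Definition pcinv (u : pclosure) : pclosure := \pi_pclosure (pinv (repr u)).
Definition pcof a : pclosure := \pi_pclosure (0%N, a).

(* An operation that commutes with p-th powers does not depend on the chosen
   representatives, once both have been brought to a common exponent. *)
Let cross n1 n2 m1 m2 a1 a2 b1 b2 (op : F -> F -> F) :
  (forall n a b, op a b ^+ (p ^ n) = op (a ^+ (p ^ n)) (b ^+ (p ^ n))) ->
  a1 ^+ (p ^ m1) = b1 ^+ (p ^ n1) -> a2 ^+ (p ^ m2) = b2 ^+ (p ^ n2) ->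
  op (a1 ^+ (p ^ n2)) (a2 ^+ (p ^ n1)) ^+ (p ^ (m1 + m2)) =
  op (b1 ^+ (p ^ m2)) (b2 ^+ (p ^ m1)) ^+ (p ^ (n1 + n2)).
Proof.
move=> hop e1 e2; rewrite !hop -!exprM -!expnD; congr op.
  have -> : (n2 + (m1 + m2) = m1 + (n2 + m2))%N by lia.
  have -> : (m2 + (n1 + n2) = n1 + (n2 + m2))%N by lia.
  by rewrite !(expnD p _ (n2 + m2)) !exprM e1.
have -> : (n1 + (m1 + m2) = m2 + (n1 + m1))%N by lia.
have -> : (m1 + (n1 + n2) = n2 + (n1 + m1))%N by lia.
by rewrite !(expnD p _ (n1 + m1)) !exprM e2.
Qed.

Lemma pcaddE x y : pcadd (\pi_pclosure x) (\pi_pclosure y) = \pi_pclosure (padd x y).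
Proof. by apply/pcP; apply: (cross (op := +%R)) (repr_eq x) (repr_eq y) => n a b; apply: frobD. Qed.

Lemma pcmulE x y : pcmul (\pi_pclosure x) (\pi_pclosure y) = \pi_pclosure (pmul x y).
Proof. by apply/pcP; apply: (cross (op := *%R)) (repr_eq x) (repr_eq y) => n a b; apply: exprMn. Qed.

Lemma frobN n a : (- a) ^+ (p ^ n) = - a ^+ (p ^ n).
Proof.
apply/eqP; rewrite -addr_eq0 -frobD addNr expr0n.
by rewrite expn_eq0 gtn_eqF // (prime_gt0 (pcharf_prime pF)).
Qed.

Lemma pcoppE x : pcopp (\pi_pclosure x) = \pi_pclosure (popp x).
Proof. by apply/pcP; rewrite /popp /= !frobN repr_eq. Qed.

Lemma pcinvE x : pcinv (\pi_pclosure x) = \pi_pclosure (pinv x).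
Proof. by apply/pcP; rewrite /pinv /= !exprVn repr_eq. Qed.

Fact pcaddA : associative pcadd.
Proof.
move=> u v w; have [x ->] := pc_repr u; have [y ->] := pc_repr v; have [z ->] := pc_repr w.
rewrite !pcaddE; congr (\pi_pclosure _); rewrite /padd /= !frobD -!exprM -!expnD addnA addrA.
by rewrite [(y.1 + x.1)%N]addnC [(z.1 + x.1)%N]addnC.
Qed.
Fact pcaddC : commutative pcadd.
Proof. by move=> u v; rewrite /pcadd /padd addnC addrC. Qed.
Fact pcadd0 : left_id (pcof 0) pcadd.
Proof.
move=> u; have [[n a] ->] := pc_repr u; rewrite pcaddE; congr (\pi_pclosure _).
rewrite /padd /= add0n expn0 expr1 expr0n expn_eq0.
by rewrite gtn_eqF ?add0r // (prime_gt0 (pcharf_prime pF)).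
Qed.
Fact pcaddN : left_inverse (pcof 0) pcopp pcadd.
Proof.
move=> u; have [x ->] := pc_repr u; rewrite pcoppE pcaddE; apply/pcP.
rewrite /= frobN addNr !expr0n !expn_eq0.
by rewrite gtn_eqF // (prime_gt0 (pcharf_prime pF)).
Qed.
HB.instance Definition _ := GRing.isZmodule.Build pclosure pcaddA pcaddC pcadd0 pcaddN.

Fact pcmulA : associative pcmul.
Proof.
move=> u v w; have [x ->] := pc_repr u; have [y ->] := pc_repr v; have [z ->] := pc_repr w.
rewrite !pcmulE; congr (\pi_pclosure _); rewrite /pmul /= !exprMn -!exprM -!expnD addnA mulrA.
by rewrite [(y.1 + x.1)%N]addnC [(z.1 + x.1)%N]addnC.
Qed.
Fact pcmulC : commutative pcmul.
Proof. by move=> u v; rewrite /pcmul /pmul addnC mulrC. Qed.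
Fact pcmul1 : left_id (pcof 1) pcmul.
Proof.
move=> u; have [[n a] ->] := pc_repr u; rewrite pcmulE; congr (\pi_pclosure _).
by rewrite /pmul /= add0n expn0 expr1 expr1n mul1r.
Qed.
Fact pcmulD : left_distributive pcmul pcadd.
Proof.
move=> u v w; have [x ->] := pc_repr u; have [y ->] := pc_repr v; have [z ->] := pc_repr w.
rewrite !(pcmulE, pcaddE); apply/pcP; rewrite /padd /pmul /=.
rewrite !(frobD, exprMn, mulrDl) -!exprM -!expnD; by congr (_ ^+ (p ^ _) * _ ^+ (p ^ _) + _ ^+ (p ^ _) * _ ^+ (p ^ _)); lia.
Qed.
Fact pc_neq0 : pcof 1 != pcof 0.
Proof. by apply/eqP => /pcP /=; rewrite expn0 !expr1 => /eqP; rewrite oner_eq0. Qed.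
HB.instance Definition _ := GRing.Zmodule_isComNzRing.Build pclosure
  pcmulA pcmulC pcmul1 pcmulD pc_neq0.

Fact pcmulV (u : pclosure) : u != 0 -> pcinv u * u = 1.
Proof.
have [[n a] ->] := pc_repr u => u0.
have a0 : a != 0.
  apply: contra u0 => /eqP ->; apply/eqP/pcP => /=.
  by rewrite expn0 expr1 expr0n expn_eq0 gtn_eqF // (prime_gt0 (pcharf_prime pF)).
rewrite pcinvE -[LHS]/(pcmul _ _) pcmulE; apply/pcP.
by rewrite /= -exprMn mulVf // !expr1n.
Qed.
Fact pcinv0 : pcinv 0 = 0.
Proof. by rewrite -[0]/(pcof 0) pcinvE /pinv invr0. Qed.
HB.instance Definition _ := GRing.ComNzRing_isField.Build pclosure pcmulV pcinv0.

Fact pcof_additive : zmod_morphism pcof.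
Proof.
by move=> a b; rewrite -[RHS]/(pcadd _ (pcopp _)) pcoppE pcaddE /padd /= expn0 !expr1.
Qed.
Fact pcof_multiplicative : monoid_morphism pcof.
Proof. by split=> // a b; rewrite -[RHS]/(pcmul _ _) pcmulE /pmul /= expn0 !expr1. Qed.
HB.instance Definition _ := GRing.isZmodMorphism.Build F pclosure pcof pcof_additive.
HB.instance Definition _ := GRing.isMonoidMorphism.Build F pclosure pcof pcof_multiplicative.

Lemma pclosure_perfect (u : pclosure) : exists v, v ^+ p = u.
Proof.
have [[n a] ->] := pc_repr u; exists (\pi_pclosure (n.+1, a)).
have powE k x : (0 < k)%N -> (\pi_pclosure x) ^+ k = \pi_pclosure (x.1, x.2 ^+ k) :> pclosure.
  case: k => // k _; elim: k => [|k IH]; first by rewrite !expr1; case: x.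
  rewrite exprS IH -[LHS]/(pcmul _ _) pcmulE; apply/pcP; rewrite /pmul /=.
  by rewrite -!exprM -exprD -!exprM expnD; congr (_ ^+ _); nia.
rewrite powE ?(prime_gt0 (pcharf_prime pF)) //; apply/pcP.
by rewrite /= -exprM -expnS.
Qed.
End PerfectClosure.

(** * A perfect and infinite extension *)
Section GoodExtension.

Definition infinite_field (K : fieldType) : Prop :=
  forall P : {poly K}, P != 0 -> exists a, P.[a] != 0.

Lemma injective_infinite (K : fieldType) (u : nat -> K) : injective u -> infinite_field K.
Proof.
move=> iu P P0; apply: contrapT => h.
have := @max_poly_roots _ P [seq u i | i <- iota 0 (size P)] P0.
rewrite size_map size_iota ltnn map_inj_uniq // iota_uniq => /(_ _ isT) H.
suff /H : all (root P) [seq u i | i <- iota 0 (size P)] by [].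
apply/allP => a _; apply: contrapT => Pa; apply: h; exists a.
by apply/negP => /eqP e; apply: Pa; apply/rootP.
Qed.

(** In characteristic 0 the field itself will do.  In characteristic p, the powers
    of the variable make the rational functions infinite, and their perfect
    closure is perfect. *)
Lemma perfect_infinite_extension (L : fieldType) :
  exists (K : fieldType) (io : {rmorphism L -> K}), perfect_field K /\ infinite_field K.
Proof.
case: (pselect (exists p, p \in [pchar L])) => [[p pL]|ch0]; last first.
  have ch : [pchar L] =i pred0.
    by move=> p; apply/negP => pL; apply: ch0; exists p.
  exists L, idfun; split; first by left.
  apply: (@injective_infinite L (fun i => i%:R)) => i j; move/pcharf0P: ch => ch.
  wlog ij : i j / (i <= j)%N => [h e|e].
    by case: (leqP i j) => [/h|/ltnW /h]; [apply | move/(_ (esym e))].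
  have : ((j - i)%N%:R : L) = 0 by rewrite natrB // e subrr.
  by move/eqP; rewrite ch subn_eq0 => ji; apply/eqP; rewrite eqn_leq ij.
pose F : fieldType := {fraction {poly L}}.
have pF : p \in [pchar F].
  exact: (rmorph_pchar (@tofrac {poly L} : {rmorphism {poly L} -> F}) (rmorph_pchar polyC pL)).
exists (pclosure pF), (@pcof F p pF \o (@tofrac {poly L} \o polyC : {rmorphism L -> F}) : {rmorphism L -> _}).
split.
  right; exists p; last exact: pclosure_perfect.
  exact: (rmorph_pchar (@pcof F p pF) pF).
apply: (@injective_infinite _ (fun i => @pcof F p pF (@tofrac {poly L} 'X^i))) => i j.
move/fmorph_inj/eqP; rewrite tofrac_eq => /eqP /(congr1 (fun q : {poly L} => size q)).
by rewrite !size_polyXn => -[].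
Qed.
End GoodExtension.

(** * Regularity of the variables over a perfect infinite field *)
Section RegularPerfect.
Variable K : fieldType.
Hypotheses (perfK : perfect_field K) (infK : infinite_field K).
Local Notation R := (bdseries K).

(** The generators fs are polynomials in a tower l, which is a regular sequence; for
    large n it stays regular after truncation, and flatness applies. *)
Lemma eventually_xvar_regular_perfect (fs : seq R) :
  exists N, forall n, (N <= n)%N -> forall r : R,
    ideal_sum (ideal_of fs) (vanish n.+1) (xvar K n * r) -> ideal_sum (ideal_of fs) (vanish n.+1) r.
Proof.
have fam0 : good_family (fun=> [::] : seq R) by [].
have [e he [_ efs]] := seq_family fs fam0.
have [n0 _ hn0] := alg_flat he efs 0%N.
have [N hN] := eventually_regular infK
  (fun l1 x l2 fe h => @good_family_regular K perfK e n0 l1 x l2 h he fe).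
exists N => n Nn r; apply: (xvar_regular (l := flat e n0)) => //; last exact: hN.
move=> z /mem_flat [d /andP[d0 _] zd]; exists d => //; exact: (chain_hom (he.2 d)).
Qed.
End RegularPerfect.

(** * Descent along a field extension *)
Section Descent.
Variables (L K : fieldType) (io : {rmorphism L -> K}).
Implicit Types (f g r : bdseries L) (h : bdseries K) (m : mon) (n k i j : nat).

Definition map_ser f : bdseries K :=
  ser_of (sval (cid (dle_ex f))) (fun m => io (f m)).

Lemma map_serE f m : map_ser f m = io (f m).
Proof.
by rewrite ser_ofE; case: cid => d /= hd; case: leqP => // /hd ->; rewrite rmorph0.
Qed.

Lemma map_ser_additive : zmod_morphism map_ser.
Proof. by move=> f g; apply: serP => m; rewrite serBE !map_serE serBE rmorphB. Qed.
HB.instance Definition _ := GRing.isZmodMorphism.Build (bdseries L) (bdseries K)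
  map_ser map_ser_additive.

Lemma map_ser_multiplicative : monoid_morphism map_ser.
Proof.
split=> [|f g]; apply: serP => m; rewrite !map_serE.
  by rewrite !ser1E rmorph_nat.
rewrite !sercoefM !fsbig_finite; try exact: finite_factorizations.
by rewrite rmorph_sum; apply: eq_bigr => q _ /=; rewrite rmorphM !map_serE.
Qed.
HB.instance Definition _ := GRing.isMonoidMorphism.Build (bdseries L) (bdseries K)
  map_ser map_ser_multiplicative.

Lemma map_ser_xmon a : map_ser (xmon L a) = xmon K a.
Proof. by apply: serP => m; rewrite map_serE !xmonE rmorph_nat. Qed.

Variables (fs : seq (bdseries L)) (n : nat).
Let W := ideal_sum (ideal_of fs) (@vanish L n).

Let hW : isIdeal W.
Proof. by apply: ideal_sum_ideal; [apply: ideal_of_ideal | apply: vanish_ideal]. Qed.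

(** A series over L that is a combination with coefficients in K of elements of the
    ideal W over L lies in W.  If the last scalar lies in the L-span of 1 and the
    other scalars, it can be eliminated; otherwise the last series vanishes
    up to truncation. *)
Lemma descend k (c : nat -> K) (w : nat -> bdseries L) r :
  (forall i, (i < k)%N -> W (w i)) ->
  (forall m, supp_lt n m -> io (r m) = \sum_(i < k) c i * io (w i m)) -> W r.
Proof.
elim: k w r => [|k IH] w r hw hr.
  exists 0; first exact: lincomb0.
  move=> m hm; have := hr m hm; rewrite big_ord0 subr0 -(rmorph0 io).
  exact: fmorph_inj.
case: (pselect (exists (la : L) (mu : nat -> L), c k = io la + \sum_(i < k) io (mu i) * c i))
    => [[la [mu ck]]|nc].
  rewrite -(subrK (la *: w k) r); apply: (isIdealD hW); last first.
    by apply: isIdealZ => //; apply: hw.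
  apply: (IH (fun i => w i + mu i *: w k)) => [i ik|m hm].
    apply: (isIdealD hW); first by apply: hw; apply: leqW.
    by apply: isIdealZ => //; apply: hw.
  rewrite serBE serZE rmorphB rmorphM hr // big_ord_recr /= ck mulrDl addrA addrAC addrK.
  have term i : c i * io ((w i + mu i *: w k) m) =
      c i * io (w i m) + io (mu i) * c i * io (w k m).
    by rewrite serDE serZE rmorphD rmorphM mulrDr mulrCA mulrA.
  under [RHS]eq_bigr => i _ do rewrite term.
  by rewrite big_split mulr_suml.
apply: (IH w) => [i ik|m hm]; first by apply: hw; apply: leqW.
rewrite hr // big_ord_recr /=; case: (eqVneq (w k m) 0) => [->|wk].
  by rewrite rmorph0 mulr0 addr0.
case: nc; exists ((w k m)^-1 * r m), (fun i => - ((w k m)^-1 * w i m)).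
have iw : io (w k m) != 0 by rewrite fmorph_eq0.
rewrite rmorphM fmorphV hr // big_ord_recr /= mulrDr [c k * _]mulrC mulKf //.
rewrite addrAC mulr_sumr -big_split big1 ?add0r // => i _ /=.
by rewrite rmorphN rmorphM fmorphV; ring.
Qed.

(** The ideal over K generated by W is the K-span of W, up to truncation. *)
Definition combo h : Prop := exists k (c : nat -> K) (w : nat -> bdseries L),
  (forall i, (i < k)%N -> W (w i)) /\
  forall m, supp_lt n m -> h m = \sum_(i < k) c i * io (w i m).

Lemma combo0 : combo 0.
Proof. by exists 0%N, (fun=> 0), (fun=> 0); split=> // m _; rewrite big_ord0. Qed.

Lemma comboD h h' : combo h -> combo h' -> combo (h + h').
Proof.
move=> [k [c [w [hw hh]]]] [k' [c' [w' [hw' hh']]]].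
exists (k + k')%N, (fun i => if (i < k)%N then c i else c' (i - k)%N),
  (fun i => if (i < k)%N then w i else w' (i - k)%N); split=> [i ik|m hm].
  by case: ltnP => ki; [apply: hw | apply: hw'; lia].
rewrite serDE hh // hh' // big_split_ord /=; congr (_ + _); apply: eq_bigr => i _.
  by rewrite ltn_ord.
by rewrite ltnNge leq_addr /= addKn.
Qed.

Lemma combo_term (c : K) f : W f -> combo (c *: map_ser f).
Proof.
move=> Wf; exists 1%N, (fun=> c), (fun=> f); split=> // m hm.
by rewrite big_ord1 serZE map_serE.
Qed.

Lemma combo_vanish h h' : vanish n (h - h') -> combo h' -> combo h.
Proof.
move=> hv [k [c [w [hw hh]]]]; exists k, c, w; split=> // m hm.
by rewrite -hh //; apply/eqP; rewrite -subr_eq0 -serBE hv.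
Qed.

(** After truncation h is a finite sum of scalar multiples of monomials, and the
    monomials are defined over L. *)
Lemma combo_mul h f : W f -> combo (h * map_ser f).
Proof.
move=> Wf; have [d hd] := dle_ex h.
pose S := fset_set [set m : mon | (forall i, i \notin [fset j in iota 0 n]%fset -> m i = 0%N) /\
                            (forall i, m i <= d)%N].
have memS a : supp_lt n a -> (mdeg a <= d)%N -> a \in S.
  move=> ha da; rewrite in_fset_set; last exact: finite_mon.
  apply/mem_set; split=> i; last by apply: leq_trans da; apply: leq_mdeg.
  by rewrite !inE mem_iota add0n -leqNgt => /ha.
pose h1 : bdseries K := \sum_(a <- S) h a *: xmon K a.
have hv : vanish n (h - h1).
  move=> m hm; rewrite serBE ser_sumE.
  have term a : (h a *: xmon K a) m = if a == m then h m else 0.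
    rewrite serZE xmonE eq_sym; case: eqP => [->|_]; by rewrite ?mulr1 ?mulr0.
  under eq_bigr => a _ do rewrite term.
  case: (boolP (m \in S)) => mS.
    rewrite (big_fsetD1 m) //= eqxx big1_seq ?addr0 ?subrr // => a.
    by rewrite in_fsetD1 => /andP[_ /andP[/negbTE -> _]].
  rewrite big1_seq ?subr0 => [|a /andP[_ aS]].
    by apply: hd; rewrite ltnNge; apply/negP => /(memS _ hm) mS'; rewrite mS' in mS.
  by case: eqP => // am; rewrite -am aS in mS.
apply: (@combo_vanish _ (h1 * map_ser f)).
  by rewrite -mulrBl mulrC; apply: (isIdealM (@vanish_ideal K n)).
rewrite mulr_suml; elim/big_ind: _ => [||a _]; [exact: combo0 | exact: comboD |].
rewrite -scalerAl -map_ser_xmon -rmorphM; apply: combo_term.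
exact: (isIdealM hW).
Qed.

Lemma map_ser_vanish f : vanish n f -> vanish n (map_ser f).
Proof. by move=> hf m hm; rewrite map_serE hf ?rmorph0. Qed.

Lemma ideal_sum_descend r : ideal_sum (ideal_of (map map_ser fs)) (vanish n) (map_ser r) -> W r.
Proof.
move=> [h hI hv]; have [k [c [w [hw hh]]]] : combo (map_ser r).
  apply: combo_vanish hv _; elim: hI => [|b z g _ /mapP [f ff ->] _ IH]; first exact: combo0.
  apply: comboD IH; apply: combo_mul; exists f; last by rewrite subrr; apply: (isIdeal0 (@vanish_ideal L n)).
  by rewrite -[f]mul1r; apply: lincomb_gen.
apply: (@descend k c w) => // m hm; by rewrite -map_serE hh.
Qed.

Lemma ideal_sum_ascend r : W r -> ideal_sum (ideal_of (map map_ser fs)) (vanish n) (map_ser r).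
Proof.
move=> [g gI gv]; exists (map_ser g).
  elim: gI {gv} => [|b z f _ zf _ IH]; first by rewrite rmorph0; apply: lincomb0.
  by rewrite rmorphD rmorphM; apply: lincombD => //; apply: map_f.
by rewrite -rmorphB; apply: map_ser_vanish.
Qed.
End Descent.

(** Passing to an extension K is harmless in both directions: relations ascend, and
    membership descends. *)
Theorem eventually_xvar_regular (L : fieldType) (fs : seq (bdseries L)) :
  exists N, forall n, (N <= n)%N -> forall r : bdseries L,
    ideal_sum (ideal_of fs) (vanish n.+1) (xvar L n * r) -> ideal_sum (ideal_of fs) (vanish n.+1) r.
Proof.
have [K [io [perfK infK]]] := perfect_infinite_extension L.
have [N hN] := eventually_xvar_regular_perfect perfK infK (map (map_ser io) fs).
exists N => n Nn r hr; apply: (ideal_sum_descend (io := io)); apply: hN => //.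
have := ideal_sum_ascend io hr; rewrite rmorphM; congr (ideal_sum _ _ (_ * _)).
exact: map_ser_xmon.
Qed.

(** * Dickson's lemma *)

(** Induction on the number of variables.  Project P along the last variable: the
    finitely many generators of the projection lift to P with exponents at most J
    in the last variable, and they account for all members of P with exponent at
    least J.  Each of the finitely many exponents below J is treated separately. *)
Lemma dickson n (P : mon -> Prop) : (forall m, P m -> supp_lt n m) ->
  exists s : seq mon, (forall m, m \in s -> P m) /\
    forall m, P m -> exists2 a, a \in s & mdvd a m.
Proof.
elim: n P => [|n IH] P hP.
  case: (pselect (exists m, P m)) => [[m Pm]|nP]; last first.
    by exists [::]; split=> // m Pm; case: nP; exists m.
  exists [:: m]; split=> [a|a Pa]; first by rewrite inE => /eqP ->.
  exists m; rewrite ?inE //; apply/mdvdP => i; by rewrite (hP _ Pm).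
pose lift i (m : mon) : mon := mmul (mpow n i) m.
have [s' [sP' sd']] := IH (fun m => supp_lt n m /\ exists i, P (lift i m)) (fun m => @proj1 _ _).
have hj a : exists i, a \in s' -> P (lift i a).
  by case: (boolP (a \in s')) => [/sP' [_ [i hi]]|_]; [exists i | exists 0%N].
pose j a := sval (cid (hj a)).
have jP a : a \in s' -> P (lift (j a) a) by rewrite /j; case: cid.
have hs i : exists s : seq mon, (forall m, m \in s -> supp_lt n m /\ P (lift i m)) /\
    forall m, supp_lt n m /\ P (lift i m) -> exists2 a, a \in s & mdvd a m.
  by have [s0 [h1 h2]] := IH (fun m => supp_lt n m /\ P (lift i m)) (fun m => @proj1 _ _); exists s0.
pose s i := sval (cid (hs i)).
have [sP sd] : (forall i m, m \in s i -> supp_lt n m /\ P (lift i m)) /\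
    forall i m, supp_lt n m /\ P (lift i m) -> exists2 a, a \in s i & mdvd a m.
  by split=> i; rewrite /s; case: cid => ? [].
pose J := (\max_(a <- s') j a)%N.
have jJ a : a \in s' -> (j a <= J)%N by move=> as'; apply: leq_bigmax_seq.
exists ([seq lift (j a) a | a <- s'] ++ [seq lift i a | i <- iota 0 J, a <- s i]); split.
  move=> m; rewrite mem_cat => /orP[/mapP [a as' ->]|/allpairsPdep [i [a [_ ai ->]]]].
    exact: jP.
  exact: (sP i a ai).2.
move=> m Pm; have mE : m = lift (m n) (mdelete n m) by rewrite /lift mdeleteK.
have rm : supp_lt n (mdelete n m).
  move=> i ni; rewrite mdeleteE; case: eqP => // /eqP in_; apply: (hP m Pm).
  by rewrite ltn_neqAle eq_sym in_.
have dv k a : (k <= m n)%N -> mdvd a (mdelete n m) -> mdvd (lift k a) m.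
  move=> km /mdvdP am; apply/mdvdP => i; rewrite cmM mpowE; have := am i; rewrite mdeleteE.
  by case: eqP => [->|_]; [rewrite leqn0 => /eqP ->; rewrite addn0 | rewrite add0n].
case: (ltnP (m n) J) => mJ.
  have [|a ai am] := sd (m n) (mdelete n m); first by rewrite -mE.
  exists (lift (m n) a); last exact: dv.
  rewrite mem_cat; apply/orP; right; apply/allpairsPdep; exists (m n), a.
  by rewrite mem_iota.
have [|a as' am] := sd' (mdelete n m); first by split=> //; exists (m n); rewrite -mE.
exists (lift (j a) a); last by apply: dv => //; apply: leq_trans mJ; apply: jJ.
by rewrite mem_cat; apply/orP; left; apply/mapP; exists a.
Qed.

(** * Reduction to finitely many variables *)
Section Groebner.
Variable L : fieldType.
Local Notation R := (bdseries L).
Local Notation hom := (@homogeneous_of_degree L).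
Implicit Types (f g h : R) (I : set R) (m : mon) (n d : nat).

Lemma is_ideal_isIdeal I : is_ideal I -> isIdeal I.
Proof.
move=> [I0 hI]; split=> // [r s Ir Is|a r Ir].
  by rewrite -[r]mul1r; apply: hI.
by rewrite -[a * r]addr0; apply: hI.
Qed.

Lemma isIdeal_is_ideal (J : R -> Prop) : isIdeal J -> is_ideal (J : set R).
Proof.
move=> hJ; split; first exact: (isIdeal0 hJ).
by move=> a u v Ju Jv; apply: (isIdealD hJ) => //; apply: (isIdealM hJ).
Qed.

Lemma fin_gen_ideal_of I : fin_gen_ideal I -> exists fs, forall f, I f <-> ideal_of fs f.
Proof.
move=> [S [/finite_seqP [fs ->] ->]]; exists fs => f; split.
  apply; split; first by apply: isIdeal_is_ideal; apply: ideal_of_ideal.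
  by move=> z zfs; rewrite -[z]mul1r; apply: lincomb_gen.
elim=> [|b z g _ zfs _ IH]; first exact: (ideal_gen_is_ideal _).1.
by apply: (ideal_gen_is_ideal _).2 => //; apply: sub_ideal_gen.
Qed.

Lemma homogeneous_ideal_hcomp I : homogeneous_ideal I -> forall f, I f -> forall d, I (hcomp d f).
Proof.
move=> [S [homS ->]] f If.
pose T : set R := fun f => forall d, ideal_gen S (hcomp d f).
suff hT : is_ideal T /\ forall z, S z -> T z by exact: (If T hT).
have hI := is_ideal_isIdeal (ideal_gen_is_ideal S).
split; last first.
  move=> z Sz d; have [e he] := homS z Sz; case: (eqVneq d e) => [->|/eqP de].
    by rewrite (hcomp_id he); apply: sub_ideal_gen.
  by rewrite (hcomp_other he de); apply: (isIdeal0 hI).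
apply: (@isIdeal_is_ideal (fun f => forall d, ideal_gen S (hcomp d f))).
split=> [d|u v hu hv d|a u hu d].
- by rewrite raddf0; apply: (isIdeal0 hI).
- by rewrite raddfD; apply: (isIdealD hI); [apply: hu | apply: hv].
have [D hD] := dle_ex u; rewrite (hcomp_sum hD) mulr_sumr raddf_sum.
apply: (isIdeal_sum _ hI) => k _ /=; case: (leqP k d) => kd.
  by rewrite -{1}(subnK kd) hcomp_homM; [apply: (isIdealM hI); apply: hu | apply: hom_hcomp].
by rewrite (hcomp_homM_lt _ (@hom_hcomp _ k u)) //; apply: (isIdeal0 hI).
Qed.

Lemma lm_eq f m : is_lm f m -> lm f = m.
Proof.
move=> h; apply: (@is_lm_unique _ f) => //; apply: lmP; apply/eqP => f0.
by case: h; rewrite f0 ser0E eqxx.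
Qed.

Lemma grevlex_cancel (a b c : mon) : grevlex (mmul c a) (mmul c b) -> grevlex a b.
Proof.
case=> [|[e [i [abi abj]]]]; first by rewrite !mdegM ltn_add2l; left.
right; split; first by move: e; rewrite !mdegM => /addnI.
exists i; split; first by move: abi; rewrite !cmM ltn_add2l.
by move=> j /abj; rewrite !cmM => /addnI.
Qed.

Lemma last_variable m N : ~ supp_lt N m ->
  exists n, [/\ (N <= n)%N, (0 < m n)%N & supp_lt n.+1 m].
Proof.
move=> h; have [M hM] := supp_lt_ex m.
have ex : exists n, (N <= n)%N && (0 < m n)%N.
  apply: contrapT => nex; apply: h => i Ni; apply/eqP; rewrite -leqn0 leqNgt.
  by apply/negP => mi; apply: nex; exists i; rewrite Ni.
have ub n : (N <= n)%N && (0 < m n)%N -> (n <= M)%N.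
  by case/andP => _; apply: contraLR; rewrite -ltnNge => /ltnW /hM ->.
case: (ex_maxnP ex ub) => n /andP[Nn mn] nmax; exists n; split=> // i ni.
apply/eqP; rewrite -leqn0 leqNgt; apply/negP => mi.
by have := nmax i; rewrite mi (leq_trans Nn (ltnW ni)) => /(_ isT); rewrite leqNgt ni.
Qed.

(** The property for which grevlex is chosen.  Among monomials of the same degree in
    x_0, ..., x_n, those without x_n are larger than those with x_n; so if x_n
    divides the leading monomial, it divides all of them. *)
Lemma homogeneous_divide d h n : hom d h -> h != 0 -> (0 < lm h n)%N ->
  supp_lt n.+1 (lm h) ->
  exists r, vanish n.+1 (xvar L n * r - h) /\
    forall m, supp_lt n.+1 m -> r m = h (mmul (mpow n 1) m).
Proof.
move=> hh h0 hn hs; have [hm hmax] := lmP h0.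
exists (ser_of d (fun m => h (mmul (mpow n 1) m))).
have rE m : ser_of d (fun m => h (mmul (mpow n 1) m)) m = h (mmul (mpow n 1) m).
  rewrite ser_ofE; case: leqP => // dm; apply/esym/eqP; apply: contrapT => /negP /hh.
  by rewrite mdegM mdeg_mpow => e; move: dm; rewrite -e; rewrite add1n ltnNge leqnSn.
split=> [m ms|m _]; last exact: rE.
rewrite serBE; case: (posnP (m n)) => mn.
  rewrite xmonM_coef0; last by move=> /mdvdP /(_ n); rewrite mpowE eqxx mn.
  rewrite sub0r [h m](_ : _ = 0) ?oppr0 //; apply/eqP; apply: contrapT => /negP fm.
  have dm := hh _ fm; have dl := hh _ hm.
  case: (hmax m fm) => [e|[|[_ [i [li lj]]]]].
  - by move: hn; rewrite -e mn.
  - by rewrite dm dl ltnn.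
  - case: (ltngtP i n) => ni.
    + by move: hn; rewrite (lj n ni) mn.
    + by move: li; rewrite (ms i ni).
    + by move: li; rewrite ni mn.
have dv : mdvd (mpow n 1) m by apply/mdvdP => i; rewrite mpowE; case: eqP => // ->.
by rewrite -(mdivmK dv) xmonM_coef rE subrr.
Qed.

(** Divide the leading monomial of h by its last variable x_n as long as n is at
    least N.  Truncated after x_n, h is x_n r; since x_n is regular modulo the
    ideal, r is the truncation of some i in I.  In the component of i of the right
    degree, the terms with later variables are smaller than lm h / x_n, so this
    is its leading monomial. *)
Lemma lm_reduce I N : is_ideal I -> (forall f, I f -> forall d, I (hcomp d f)) ->
  (forall n, (N <= n)%N -> forall r,
    ideal_sum I (vanish n.+1) (xvar L n * r) -> ideal_sum I (vanish n.+1) r) ->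
  forall d h, I h -> hom d h -> h != 0 ->
  exists h', [/\ I h', h' != 0, supp_lt N (lm h') & mdvd (lm h') (lm h)].
Proof.
move=> /is_ideal_isIdeal hI hcI hreg; elim=> [|d IH] h Ih hh h0.
all: case: (pselect (supp_lt N (lm h))) => [hs|/last_variable [n [Nn hn hs]]];
  first by exists h; split=> //; apply: mdvd_refl.
  by have := hh _ (lmP h0).1; move/eqP; rewrite gtn_eqF // (mdeg_gt0 hn).
have [r [rv rE]] := homogeneous_divide hh h0 hn hs.
have [i Ii iv] : ideal_sum I (vanish n.+1) r by apply: hreg => //; exists h.
pose c := mdivm (lm h) (mpow n 1).
have lc : mmul (mpow n 1) c = lm h.
  by apply: mdivmK; apply/mdvdP => j; rewrite mpowE; case: eqP => // ->.
have [hm hmax] := lmP h0.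
have dl := hh _ hm.
have dc : mdeg c = d by move: dl; rewrite -lc mdegM mdeg_mpow add1n => -[].
have cs : supp_lt n.+1 c by move: hs; rewrite -lc => /supp_ltM [].
have ir m : supp_lt n.+1 m -> i m = r m.
  by move=> ms; apply/esym/eqP; rewrite -subr_eq0 -serBE iv.
have ilm : is_lm (hcomp d i) c.
  split; first by rewrite hcompE dc eqxx ir // rE // lc.
  move=> m; rewrite hcompE; case: (eqVneq (mdeg m) d) => [dm im|_]; last by rewrite eqxx.
  case: (pselect (supp_lt n.+1 m)) => ms.
    move: im; rewrite ir // rE // => /hmax; rewrite -lc => -[/mmulI ->|/grevlex_cancel ?];
      by [left | right].
  right; right; split; first by rewrite dc dm.
  have [k [nk mk ks]] := last_variable ms; exists k; split; first by rewrite (cs k nk).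
  by move=> j kj; rewrite (ks j kj) (cs j) // ltnW // (leq_ltn_trans nk).
have i0 : hcomp d i != 0 by apply/eqP => e; case: ilm; rewrite e ser0E eqxx.
have [h' [Ih' h'0 h's h'd]] := IH _ (hcI _ Ii d) (@hom_hcomp _ d i) i0.
exists h'; split=> //; have [e he] := h'd; rewrite (lm_eq ilm) in he.
by exists (mmul (mpow n 1) e); rewrite -lc he; apply: monP => j; rewrite !cmM addnCA.
Qed.

End Groebner.

(** * Finite bases *)

Theorem theorem1 (L : fieldType) (I : set (bdseries L)) :
  is_ideal I -> fin_gen_ideal I -> homogeneous_ideal I ->
  exists B : set (bdseries L), finite_set B /\ groebner_basis I B.
Proof.
move=> hI /fin_gen_ideal_of [fs hfs] /homogeneous_ideal_hcomp hcI.
have IE : I = ideal_of fs by apply/funext => f; apply/propext.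
have [N hN] := eventually_xvar_regular fs; rewrite -IE in hN.
have red := lm_reduce hI hcI hN.
pose P m := supp_lt N m /\ exists h : bdseries L, [/\ I h, h != 0 & lm h = m].
have [s [sP sd]] := @dickson N P (fun m => @proj1 _ _).
have hg m : exists g : bdseries L, m \in s -> [/\ I g, g != 0 & lm g = m].
  by case: (boolP (m \in s)) => [/sP [_ [g hg]]|_]; [exists g | exists 0].
pose g m := sval (cid (hg m)).
have gE m : m \in s -> [/\ I (g m), g m != 0 & lm (g m) = m] by rewrite /g; case: cid.
exists [set` [seq g m | m <- s]]%classic; split; first exact: finite_seq.
split=> [f /mapP [m ms ->]|h Ih h0]; first by case: (gE m ms).
have [lh lmax] := lmP h0.
(* the component of top degree of h has the same leading monomial *)
pose d := mdeg (lm h).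
have lmc : is_lm (hcomp d h) (lm h).
  split; first by rewrite hcompE eqxx.
  by move=> m; rewrite hcompE; case: ifP => [_ /lmax //|_]; rewrite eqxx.
have c0 : hcomp d h != 0 by apply/eqP => e; case: lmc; rewrite e ser0E eqxx.
have [h' [Ih' h'0 h's h'd]] := red d _ (hcI _ Ih d) (@hom_hcomp _ d h) c0.
have [|a as_ ad] := sd (lm h'); first by split=> //; exists h'.
have [Ig g0 ga] := gE a as_.
exists (g a); split=> //; first by apply/mapP; exists a.
rewrite ga; have [e1 e1E] := ad; have [e2 e2E] := h'd.
by rewrite -(lm_eq lmc) e2E e1E -mulmA; exists (mmul e1 e2).
Qed.
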